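(* Let $p\in[1,\infty]$, let $M\subset\mathbb{R}^m$ be convex and bounded, let $\mathcal{W}=\{w\in L^p(\Omega,\mathbb{R}^m): w(x)\in M \text{ for a.e. } x\in\Omega\}$, and let $G:\Omega\times\mathbb{R}^{2+m}\to\mathbb{R}$, $G=G(x,u,v,w)$, have partial derivatives $G_u,G_v$. For $w\in\mathcal{W}$ define on $\mathbb{H}_0^{\alpha/2}=H_0^{\alpha/2}(\Omega)\times H_0^{\alpha/2}(\Omega)$ the functional $$F_w(u,v)=\int_\Omega\Big(\tfrac12|(-\Delta)^{\alpha/4}v(x)|^2-\tfrac12|(-\Delta)^{\alpha/4}u(x)|^2+G(x,u(x),v(x),w(x))\Big)dx .$$ Assume: (A1) $G,G_u,G_v$ are measurable in $x$ for every $(u,v,w)\in\mathbb{R}^{2+m}$ and continuous in $(u,v,w)$ for a.e. $x\in\Omega$. (A2) There are $s\in(1,2^*_\alpha)$ and $c>0$ such that, for $z\in\{u,v\}$: if $p=\infty$, then $|G(x,u,v,w)|\le c(1+|u|^s+|v|^s)$ and $|G_z(x,u,v,w)|\le c(1+|u|^{s-1}+|v|^{s-1})$ for a.e. $x\in\Omega$ and all $u,v\in\mathbb{R}$, $w\in M$; if $p\in[1,\infty)$, then $|G(x,u,v,w)|\le c(1+|u|^s+|v|^s+|w|^p)$ and $|G_z(x,u,v,w)|\le c(1+|u|^{s-1}+|v|^{s-1}+|w|^{p-p/s})$ for a.e. $x\in\Omega$ and all $u,v\in\mathbb{R}$, $w\in\mathbb{R}^m$. (A3) For every $u\in H_0^{\alpha/2}(\Omega)$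 there exist $b\in\mathbb{R}$ with $\rho_1^{\alpha/2}>2b$, $\beta_1\in L^2(\Omega)$, $\gamma_1\in L^1(\Omega)$ such that $G(x,u(x),v,w)\ge -b|v|^2-\beta_1(x)v-\gamma_1(x)$ for all $v\in\mathbb{R}$, $w\in M$ and a.e. $x\in\Omega$. (A4) For every $v\in H_0^{\alpha/2}(\Omega)$ there exist $B\in\mathbb{R}$ with $\rho_1^{\alpha/2}>2B$, $\beta_2\in L^2(\Omega)$, $\gamma_2\in L^1(\Omega)$ such that $G(x,u,v(x),w)\le B|u|^2+\beta_2(x)u+\gamma_2(x)$ for all $u\in\mathbb{R}$, $w\in M$ and a.e. $x\in\Omega$. (A5) For every $w\in\mathcal{W}$, $F_w(\cdot,v)$ is concave for every $v\in H_0^{\alpha/2}(\Omega)$ and $F_w(u,\cdot)$ is convex for every $u\in H_0^{\alpha/2}(\Omega)$. Let $w_k\in\mathcal{W}$ for $k=0,1,2,\dots$, let $S_k$ be the set of saddle points of $F_{w_k}$, and suppose $w_k\to w_0$ in $L^p(\Omega,\mathbb{R}^m)$ as $k\to\infty$. Then, with respect to the strong (norm) topology $(s)$ of $\mathbb{H}_0^{\alpha/2}$, $(s)\mathrm{Lim}\sup S_k\ne\emptyset$ and $(s)\mathrm{Lim}\sup S_k\subset S_0$.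
   Context: Standing assumptions: $n\ge 3$, $\Omega\subset\mathbb{R}^n$ is a bounded domain with Lipschitz boundary, $\alpha\in(1,2)$, $2^*_\alpha=\frac{2n}{n-\alpha}$. Let $(z_k,\rho_k)_{k\in\mathbb{N}}$ be the system of ($L^2(\Omega)$-orthonormal) eigenfunctions and eigenvalues of $-\Delta$ on $\Omega$ with homogeneous Dirichlet boundary condition; $\rho_1$ is the principal (smallest) eigenvalue. $H_0^{\alpha/2}(\Omega)$ is the space of functions $z=\sum_k a_kz_k$ with $\sum_k a_k^2\rho_k^{\alpha/2}<\infty$, with norm $\|z\|^2_{H_0^{\alpha/2}(\Omega)}=\sum_k a_k^2\rho_k^{\alpha/2}=\|(-\Delta)^{\alpha/4}z\|^2_{L^2(\Omega)}$, where the (spectral Dirichlet) fractional powers are $(-\Delta)^{\alpha/2}z=\sum_k a_k\rho_k^{\alpha/2}z_k$ and $(-\Delta)^{\alpha/4}z=\sum_k a_k\rho_k^{\alpha/4}z_k$. The space $\mathbb{H}_0^{\alpha/2}$ carries the norm $\|(u,v)\|^2=\|u\|^2_{H_0^{\alpha/2}(\Omega)}+\|v\|^2_{H_0^{\alpha/2}(\Omega)}$. A pair $(u_0,v_0)\in\mathbb{H}_0^{\alpha/2}$ is a saddle point of $F_w$ if $F_w(u,v_0)\le F_w(u_0,v_0)\le F_w(u_0,v)$ for all $u,v\in H_0^{\alpha/2}(\Omega)$. For a sequence $\{X_k\}_{k\in\mathbb{N}}$ of subsets of a topological space $(\mathcal{H},\tau)$, the upper Kuratowski–Painlevé limit $(\tau)\mathrm{Lim}\sup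 X_k$ is the set of all $\tau$-cluster points of sequences $\{x_k\}_{k\in\mathbb{N}}$ with $x_k\in X_k$ for all $k\in\mathbb{N}$. *)

(* Defs.v *)
From HB Require Import structures.
From mathcomp Require Import all_boot all_order all_algebra.
From mathcomp Require Import all_classical all_reals all_analysis.

Set Implicit Arguments.
Unset Strict Implicit.
Unset Printing Implicit Defensive.

Import Order.TTheory GRing.Theory Num.Theory.
Import numFieldNormedType.Exports.

Local Open Scope classical_set_scope.
Local Open Scope ring_scope.

Section LebesgueMeasure.
Context (R : realType) (n : nat).

Definition box (ab : 'rV[R]_n * 'rV[R]_n) : set 'rV[R]_n :=
  [set x | forall i, ab.1 0 i < x 0 i <= ab.2 0 i].

Definition box_volume (ab : 'rV[R]_n * 'rV[R]_n) : \bar R :=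
  (\prod_(i < n) Num.max 0 (ab.2 0 i - ab.1 0 i))%:E.

Definition lebesgue_outer (A : set 'rV[R]_n) : \bar R :=
  ereal_inf [set (\esum_(c in C) box_volume c)%E |
    C in [set C : set ('rV[R]_n * 'rV[R]_n) |
            countable C /\ A `<=` \bigcup_(c in C) box c]].

Let box_volume_ge0 c : (0 <= box_volume c)%E.
Proof. by rewrite lee_fin prodr_ge0 // => i _; rewrite le_max lexx. Qed.

Let lebesgue_outer0 : lebesgue_outer set0 = 0%E.
Proof.
apply/eqP; rewrite eq_le; apply/andP; split.
  apply: ereal_inf_lbound; exists set0; last by rewrite esum_set0.
  by split; [exact: countable0 | exact: sub0set].
by apply: le_ereal_inf_tmp => _ [C _ <-]; exact: esum_ge0.
Qed.

Let lebesgue_outer_ge0 A : (0 <= lebesgue_outer A)%E.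
Proof. by apply: le_ereal_inf_tmp => _ [C _ <-]; exact: esum_ge0. Qed.

Let le_lebesgue_outer :
  {homo lebesgue_outer : A B / A `<=` B >-> (A <= B)%E}.
Proof.
move=> A B AB; apply: ereal_inf_le_tmp => _ [C [cC BC] <-].
by exists C => //; split => //; exact: subset_trans BC.
Qed.

Let lebesgue_outer_sigma_subadditive : sigma_subadditive lebesgue_outer.
Proof.
move=> A; have [[i Ai]|] := pselect (exists i, lebesgue_outer (A i) = +oo%E).
  rewrite (eseries_pinfty _ _ Ai) ?leey// => k _.
  by rewrite -ltNye (lt_le_trans _ (lebesgue_outer_ge0 _)).
move/forallNP => Afin; apply/lee_addgt0Pr => e e0.
have epos k : 0 < e / (2 ^ k.+1)%:R by rewrite divr_gt0// ltr0n expn_gt0.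
have /choice[C C_] : forall k, exists C : set ('rV[R]_n * 'rV[R]_n),
    [/\ countable C, A k `<=` \bigcup_(c in C) box c &
     (\esum_(c in C) box_volume c <=
        lebesgue_outer (A k) + (e / (2 ^ k.+1)%:R)%:E)%E].
  move=> k; have Akfin : lebesgue_outer (A k) \is a fin_num.
    by rewrite ge0_fin_numE// lt_neqAle leey andbT; apply/eqP.
  have [_ [C [cC AC] <-] lt] := lb_ereal_inf_adherent (epos k) Akfin.
  by exists C; split => //; exact: ltW.
apply: (@le_trans _ _ (\esum_(c in \bigcup_k C k) box_volume c)%E).
  apply: ereal_inf_lbound; exists (\bigcup_k C k) => //; split.
    by apply: bigcup_countable => // k _; have [] := C_ k.
  move=> x [k _ Akx]; have [_ /(_ _ Akx)[c Cc bx] _] := C_ k.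
  by exists c => //; exists k.
apply: (@le_trans _ _
    (\sum_(k <oo) (lebesgue_outer (A k) + (e / (2 ^ k.+1)%:R)%:E))%E).
  rewrite seqDU_bigcup_eq (esum_bigcupT _ _ (trivIset_seqDU C) box_volume_ge0).
  rewrite -nneseries_esumT; last by move=> k; exact: esum_ge0.
  apply: lee_nneseries => [k _ _|k _]; first exact: esum_ge0.
  have [_ _] := C_ k; apply: le_trans; rewrite esum_mkcond [leRHS]esum_mkcond.
  apply: le_esum => c _; case: ifPn => [|_]; last by case: ifP.
  by move=> /set_mem Cc; rewrite ifT//; exact/mem_set/(subset_seqDU Cc).
exact: epsilon_trick (fun k => lebesgue_outer_ge0 (A k)) (ltW e0).
Qed.

HB.instance Definition _ := isOuterMeasure.Build R _ lebesgue_outer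
  lebesgue_outer0 lebesgue_outer_ge0 le_lebesgue_outer
  lebesgue_outer_sigma_subadditive.

End LebesgueMeasure.

(* The domain carries the Caratheodory sigma-algebra, so that `measurable' means
   Lebesgue measurable and the measure is complete. *)
Definition lebesgue (R : realType) (n : nat) :
    set (caratheodory_type (@lebesgue_outer R n)) -> \bar R :=
  @lebesgue_outer R n.
HB.instance Definition _ (R : realType) (n : nat) :=
  isMeasure.Build _ _ _ (@lebesgue R n)
    (@caratheodory_measure0 _ _ (@lebesgue_outer R n))
    (@caratheodory_measure_ge0 _ _ (@lebesgue_outer R n))
    (@caratheodory_measure_sigma_additive _ _ (@lebesgue_outer R n)).

Arguments lebesgue : clear implicits.

Section EuclideanSpace.
Context (R : realType) (n : nat).
Implicit Types (x y : 'rV[R]_n) (Omega : set 'rV[R]_n).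

Definition dot x y : R := \sum_(i < n) x 0 i * y 0 i.

(* The norm `|x| of the library on 'rV[R]_n is the maximum norm. *)
Definition enorm x : R := Num.sqrt (dot x x).

(* Near each boundary point, Omega is the part lying above a Lipschitz graph in
   some direction e; y - <y, e> e is the projection of y on the hyperplane
   orthogonal to e, and only the values of gamma there matter. *)
Definition lipschitz_boundary Omega : Prop :=
  forall x0, (closure Omega `\` interior Omega) x0 ->
  exists (e : 'rV[R]_n) (gamma : 'rV[R]_n -> R^o) (k : R),
    [/\ dot e e = 1, k.-lipschitz gamma &
      \forall y \near x0, Omega y <-> gamma (y - dot y e *: e) < dot y e].

Definition bounded_lipschitz_domain Omega : Prop :=
  [/\ Omega !=set0, open Omega, connected Omega, bounded_set Omega &
      lipschitz_boundary Omega].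

End EuclideanSpace.

Section LebesgueSpaces.
Context (R : realType) (n : nat) (Omega : set 'rV[R]_n).
Implicit Types (f g u : 'rV[R]_n -> R) (p : \bar R).

Definition Lp_fun p f : Prop :=
  (f \_ Omega : caratheodory_type (@lebesgue_outer R n) -> R)
    \in Lfun (lebesgue R n) p.

Definition Lp_norm p f : \bar R :=
  'N[lebesgue R n]_p[EFin \o (f \_ Omega)].

Definition ip f g : R := \int[lebesgue R n]_(x in Omega) (f x * g x).

Definition Lp_vfun m p (w : 'rV[R]_n -> 'rV[R]_m) : Prop :=
  forall i, Lp_fun p (fun x => w x 0 i).

Definition Lp_vcvg m p (w : nat -> 'rV[R]_n -> 'rV[R]_m)
    (w0 : 'rV[R]_n -> 'rV[R]_m) : Prop :=
  (fun k => Lp_norm p (fun x => enorm (w k x - w0 x))) @ \oo --> 0%E.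

End LebesgueSpaces.

Section DirichletLaplacian.
Context (R : realType) (n : nat) (Omega : set 'rV[R]_n).
Implicit Types (u f phi : 'rV[R]_n -> R) (z : nat -> 'rV[R]_n -> R)
  (rho : nat -> R).

Definition partial (i : 'I_n) phi : 'rV[R]_n -> R :=
  fun x => 'D_(delta_mx 0 i) phi x.

Definition smooth phi : Prop := forall (s : seq 'I_n),
  continuous (foldr partial phi s : 'rV[R]_n -> R^o) /\
  forall i x, derivable (foldr partial phi s : 'rV[R]_n -> R^o) x (delta_mx 0 i).

Definition test_function phi : Prop :=
  [/\ smooth phi, compact (closure [set x | phi x != 0]) &
      closure [set x | phi x != 0] `<=` Omega].

Definition weak_gradient u (g : 'I_n -> 'rV[R]_n -> R) : Prop :=
  forall i phi, test_function phi ->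
    ip Omega u (partial i phi) = - ip Omega (g i) phi.

(* u lies in H^1_0(Omega), the H^1-closure of the test functions, and g is its
   weak gradient. *)
Definition H10_with_gradient u (g : 'I_n -> 'rV[R]_n -> R) : Prop :=
  [/\ Lp_fun Omega 2%:E u, (forall i, Lp_fun Omega 2%:E (g i)),
      weak_gradient u g &
      exists phi : nat -> 'rV[R]_n -> R,
        [/\ forall j, test_function (phi j),
            (fun j => Lp_norm Omega 2%:E (phi j \- u)) @ \oo --> 0%E &
            forall i, (fun j => Lp_norm Omega 2%:E (partial i (phi j) \- g i))
                        @ \oo --> 0%E]].

(* - Delta u = lambda u in Omega, u = 0 on the boundary, in the weak sense. *)
Definition dirichlet_eigen u (lambda : R) : Prop :=
  exists2 g, H10_with_gradient u g &
    forall phi, test_function phi ->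
      \sum_(i < n) ip Omega (g i) (partial i phi) = lambda * ip Omega u phi.

Definition L2_expansion z (a : nat -> R) f : Prop :=
  Lp_fun Omega 2%:E f /\
  (fun N => Lp_norm Omega 2%:E (fun x => f x - \sum_(k < N) a k * z k x))
    @ \oo --> 0%E.

(* Indices start at 0: rho 0 is the principal eigenvalue. Eigenvalues are
   repeated according to multiplicity, and no ordering beyond the minimality of
   rho 0 is imposed. *)
Definition dirichlet_eigensystem z rho : Prop :=
  [/\ forall k, dirichlet_eigen (z k) (rho k),
      forall j k, ip Omega (z j) (z k) = (j == k)%:R,
      forall u, Lp_fun Omega 2%:E u ->
        L2_expansion z (fun k => ip Omega u (z k)) u &
      forall k, rho 0%N <= rho k].

End DirichletLaplacian.

Section FractionalSpace.
Context (R : realType) (n : nat) (Omega : set 'rV[R]_n).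
Context (z : nat -> 'rV[R]_n -> R) (rho : nat -> R) (alpha : R).
Implicit Types (u v : 'rV[R]_n -> R).

(* As z is orthonormal, the coefficients in u = \sum_k a_k z_k are the inner
   products of u with the z_k. *)
Definition coef u k : R := ip Omega u (z k).

Definition frac_sqnorm u : \bar R :=
  (\sum_(0 <= k <oo) (coef u k ^+ 2 * rho k `^ (alpha / 2))%:E)%E.

(* The space H_0^{alpha/2}(Omega); here and below its elements are functions,
   not classes of functions modulo equality almost everywhere. *)
Definition Hfrac : set ('rV[R]_n -> R) :=
  [set u | L2_expansion Omega z (coef u) u /\ (frac_sqnorm u < +oo)%E].

(* (- Delta)^beta u = \sum_k a_k rho_k^beta z_k, as a limit in L^2(Omega). *)
Definition frac_laplacian (beta : R) u : 'rV[R]_n -> R :=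
  xget (fun=> 0)
    [set f | L2_expansion Omega z (fun k => coef u k * rho k `^ beta) f].

Definition Hpair : Type :=
  {uv : ('rV[R]_n -> R) * ('rV[R]_n -> R) | Hfrac uv.1 /\ Hfrac uv.2}.

Definition Hpair_dist (p q : Hpair) : R :=
  Num.sqrt (fine (frac_sqnorm ((sval p).1 \- (sval q).1)) +
            fine (frac_sqnorm ((sval p).2 \- (sval q).2))).

Definition Hpair_open : set_system Hpair :=
  [set U | forall p, U p ->
     exists2 e : R, 0 < e & [set q | Hpair_dist p q < e] `<=` U].

Let Hpair_openT : Hpair_open setT.
Proof. by move=> p _; exists 1. Qed.

Let Hpair_openI : setI_closed Hpair_open.
Proof.
move=> U V oU oV p [/oU[e e0 eU] /oV[d d0 dV]].
exists (Num.min e d); first by rewrite lt_min e0.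
by move=> q /=; rewrite lt_min => /andP[/eU Uq /dV Vq].
Qed.

Let Hpair_open_bigcup (I : Type) (f : I -> set Hpair) :
  (forall i, Hpair_open (f i)) -> Hpair_open (\bigcup_i f i).
Proof.
move=> of_ p [i _ /of_[e e0 ef]]; exists e => // q /ef fq.
by exists i.
Qed.

HB.instance Definition _ := gen_eqMixin Hpair.
HB.instance Definition _ := gen_choiceMixin Hpair.
HB.instance Definition _ := isOpenTopological.Build Hpair
  Hpair_openT Hpair_openI Hpair_open_bigcup.

Definition concave_on_Hfrac (F : ('rV[R]_n -> R) -> R) : Prop :=
  forall u1 u2 (t : R), Hfrac u1 -> Hfrac u2 -> 0 <= t <= 1 ->
    t * F u1 + (1 - t) * F u2 <= F (fun x => t * u1 x + (1 - t) * u2 x).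

Definition convex_on_Hfrac (F : ('rV[R]_n -> R) -> R) : Prop :=
  forall u1 u2 (t : R), Hfrac u1 -> Hfrac u2 -> 0 <= t <= 1 ->
    F (fun x => t * u1 x + (1 - t) * u2 x) <= t * F u1 + (1 - t) * F u2.

Definition saddle_points (F : ('rV[R]_n -> R) -> ('rV[R]_n -> R) -> R) :
    set Hpair :=
  [set p | forall u v, Hfrac u -> Hfrac v ->
     F u (sval p).2 <= F (sval p).1 (sval p).2 <= F (sval p).1 v].

Definition energy m (G : 'rV[R]_n -> R -> R -> 'rV[R]_m -> R)
    (w : 'rV[R]_n -> 'rV[R]_m) u v : R :=
  \int[lebesgue R n]_(x in Omega)
    (2^-1 * `|frac_laplacian (alpha / 4) v x| ^+ 2
     - 2^-1 * `|frac_laplacian (alpha / 4) u x| ^+ 2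
     + G x (u x) (v x) (w x)).

End FractionalSpace.

Section PartialDerivatives.
Context (R : realType) (n m : nat).
Variable (G : 'rV[R]_n -> R -> R -> 'rV[R]_m -> R).

Definition Gu x (u v : R) w : R := derive1 (fun t : R => G x t v w : R^o) u.
Definition Gv x (u v : R) w : R := derive1 (fun t : R => G x u t w : R^o) v.

(* Measurable in x for all (u, v, w), continuous in (u, v, w) for a.e. x. *)
Definition caratheodory_fun (Omega : set 'rV[R]_n) : Prop :=
  (forall u v w, measurable_fun
     (Omega : set (caratheodory_type (@lebesgue_outer R n)))
     (fun x => G x u v w : R)) /\
  {ae lebesgue R n, forall x, Omega x ->
     continuous (fun q : R * R * 'rV[R]_m => G x q.1.1 q.1.2 q.2 : R^o)}.

End PartialDerivatives.

Section Controls.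
Context (R : realType) (n m : nat).

Definition admissible_control (Omega : set 'rV[R]_n) (p : \bar R)
    (M : set 'rV[R]_m) (w : 'rV[R]_n -> 'rV[R]_m) : Prop :=
  Lp_vfun Omega p w /\ {ae lebesgue R n, forall x, Omega x -> M (w x)}.

End Controls.

Definition kuratowski_limsup (T : topologicalType) (X : nat -> set T) : set T :=
  [set x | exists2 s : nat -> T, (forall k, X k (s k)) & cluster (s @ \oo) x].

(* Main.v *)
(** Write [a] and [b] for the coefficients of [u] and [v] in the eigenbasis and
    [N a = \sum_k a_k^2 rho_k^(alpha/2)]. Then
    [F_w (u, v) = N b / 2 - N a / 2 + I_w (a, b)] with [I_w] the integral of [G], and
    [(u, v)] is a saddle point iff [F_w (u', v) <= F_w (u, v')] for all [u'], [v'].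

    An [N]-bounded sequence has a coordinatewise convergent subsequence; as
    [rho_k --> +oo] (Rellich) and [rho_0 > 0] (Poincare), it converges strongly in
    [L^2(Omega)], hence almost everywhere along a further subsequence. By (A3), (A4)
    and Fatou's lemma [I_w] is therefore lower semicontinuous in [b] and upper
    semicontinuous in [a], even along varying controls, while the gaps [2b] and
    [2B < rho_0^(alpha/2)] make [F_w] coercive in [v] and anticoercive in [u],
    uniformly in [w].

    Saddle points of [F_(w_k)] are thus bounded, and the saddle inequality passes to
    coordinatewise limits; choosing the limit itself for [u'], [v'] forces
    [N a_k --> N a] and [N b_k --> N b], so that the convergence is strong. The same
    stability reduces the existence of saddle points to the functionals
    [F_w + eps N b], whose minimizers in [b] are unique by the parallelogram law. *)
Require Import Defs.
From mathcomp Require Import all_boot all_order all_algebra.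
From mathcomp Require Import all_classical all_reals all_analysis.
From mathcomp Require Import measurable_realfun ess_sup_inf ring lra.
Import Order.TTheory GRing.Theory Num.Theory.
Import numFieldNormedType.Exports.
Local Open Scope classical_set_scope.
Local Open Scope ring_scope.

Set Implicit Arguments.
Unset Strict Implicit.
Unset Printing Implicit Defensive.

(** * Weighted sequence spaces *)

(** An eigensystem is only assumed orthonormal and complete with [rho 0] minimal, so positivity and
    divergence of the eigenvalues must be proved. For divergence, Rellich's theorem is used
    quantitatively: up to [eta] times the Dirichlet integral, finitely many functions capture the
    squared L^2 norm of every test function, and infinitely many orthonormal eigenfunctions with
    bounded eigenvalues would contradict Bessel's inequality.

    (A5) gives no strict convexity; the term eps N b supplies it, and uniqueness of minimizers then
    makes the minimizers along a segment issuing from a maximin point converge to the prescribed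
    one, which replaces a minimax theorem.

    Weak convergence is enough to pass to the limit because, in the saddle property written as one
    inequality, the quadratic terms of both unknowns sit on the smaller side, where lower
    semicontinuity works in the right direction.

    The constants of (A3) depend on u and those of (A4) on v, never on w, whence the uniformity in
    the control. Together the two conditions bound |G| along u, v, w by an integrable function. *)

Lemma fmap_ultra (T U : Type) (f : T -> U) (F : set_system T) :
  UltraFilter F -> UltraFilter (f @ F).
Proof.
move=> UF; split; first exact: fmap_proper_filter.
move=> G PG sG; apply/seteqP; split=> A; last exact: sG.
move=> GA; have [//|nA] := in_ultra_setVsetC (f @^-1` A) UF.
have GnA : G (~` A) by apply: sG.
by have [x []] := filter_ex (filterI GA GnA).
Qed.

Section WeightedSequences.
Context (R : realType) (lam : nat -> R) (lam_gt0 : forall k, 0 < lam k).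
Implicit Types (a b : nat -> R) (t c e : R).

Definition wsum (K : nat) a : R := \sum_(0 <= k < K) (a k ^+ 2 * lam k).
Definition wnorm a : \bar R := (\sum_(0 <= k <oo) (a k ^+ 2 * lam k)%:E)%E.
Definition wspace : set (nat -> R) := [set a | (wnorm a < +oo)%E].
(** Meaningful only on [wspace]: [fine] sends an infinite norm to 0. *)
Definition wreal a : R := fine (wnorm a).

Let term_ge0 a k : 0 <= a k ^+ 2 * lam k.
Proof. by rewrite mulr_ge0 ?sqr_ge0 // ltW. Qed.

Lemma wsum_ge0 K a : 0 <= wsum K a.
Proof. by rewrite sumr_ge0. Qed.

Lemma wnorm_ge0 a : (0 <= wnorm a)%E.
Proof. by apply: nneseries_ge0 => k _ _; rewrite lee_fin. Qed.

Lemma wreal_ge0 a : 0 <= wreal a.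
Proof. exact/fine_ge0/wnorm_ge0. Qed.

Lemma wrealK a : wspace a -> wnorm a = (wreal a)%:E.
Proof. by move=> Ha; rewrite fineK // ge0_fin_numE // wnorm_ge0. Qed.

Lemma wsum_le a K : wspace a -> wsum K a <= wreal a.
Proof.
move=> Ha; rewrite -lee_fin -wrealK // /wsum -sumEFin.
by apply: nneseries_lim_ge => k _ _; rewrite lee_fin.
Qed.

(** Identities are proved for the finite sums [wsum], where no summability is at stake; this
    criterion and [wsum_cvg] carry them over to the infinite sums. *)
Lemma wspace_bound a c : (forall K, wsum K a <= c) -> wspace a /\ wreal a <= c.
Proof.
move=> Hc; have le : (wnorm a <= c%:E)%E.
  apply: lime_le; first by apply: is_cvg_nneseries => k _ _; rewrite lee_fin.
  by near=> K; rewrite sumEFin lee_fin; exact: Hc.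
have Ha : wspace a by apply: le_lt_trans le _; rewrite ltry.
by split => //; rewrite -lee_fin -wrealK.
Unshelve. all: by end_near. Qed.

Lemma wsum_cvg a : wspace a -> (wsum ^~ a) @ \oo --> wreal a.
Proof.
move=> Ha; apply/(@fine_cvg _ _ _ _ (fun K => (wsum K a)%:E)).
rewrite -wrealK //.
have -> : (fun K => (wsum K a)%:E) = (fun K => \sum_(0 <= k < K) (a k ^+ 2 * lam k)%:E)%E.
  by apply/funext => K /=; rewrite sumEFin.
by apply: is_cvg_nneseries => k _ _; rewrite lee_fin.
Qed.

Lemma wsum_gt a e : wspace a -> 0 < e -> exists K, wreal a - e < wsum K a.
Proof.
move=> Ha e0; have /cvgrPdist_lt/(_ _ e0) := wsum_cvg Ha.
move=> [K _ /(_ K (leqnn _))] /=; rewrite ger0_norm ?subr_ge0 ?wsum_le // => h.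
by exists K; lra.
Qed.

Definition wadd a b : nat -> R := fun k => a k + b k.
Definition wsub a b : nat -> R := fun k => a k - b k.
Definition wscale t a : nat -> R := fun k => t * a k.

Lemma wsum_parallelogram K a b :
  wsum K (wadd a b) + wsum K (wsub a b) = 2 * wsum K a + 2 * wsum K b.
Proof.
rewrite /wsum !mulr_sumr -!big_split /=; apply: eq_bigr => k _.
by rewrite /wadd /wsub; ring.
Qed.

Lemma wspace_add_sub a b : wspace a -> wspace b ->
  wspace (wadd a b) /\ wspace (wsub a b).
Proof.
move=> Ha Hb; have H K := wsum_parallelogram K a b.
split; apply: (proj1 (@wspace_bound _ (2 * wreal a + 2 * wreal b) _)) => K;
  have := H K; have := wsum_le K Ha; have := wsum_le K Hb;
  have := wsum_ge0 K (wsub a b); have := wsum_ge0 K (wadd a b); lra.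
Qed.

Lemma wspace_add a b : wspace a -> wspace b -> wspace (wadd a b).
Proof. by move=> Ha Hb; have [] := wspace_add_sub Ha Hb. Qed.

Lemma wspace_sub a b : wspace a -> wspace b -> wspace (wsub a b).
Proof. by move=> Ha Hb; have [] := wspace_add_sub Ha Hb. Qed.

Lemma wreal_parallelogram a b : wspace a -> wspace b ->
  wreal (wadd a b) + wreal (wsub a b) = 2 * wreal a + 2 * wreal b.
Proof.
move=> Ha Hb; have [Hp Hm] := wspace_add_sub Ha Hb.
have h1 : (fun K => wsum K (wadd a b) + wsum K (wsub a b)) @ \oo -->
  wreal (wadd a b) + wreal (wsub a b) by apply: cvgD; exact: wsum_cvg.
have h2 : (fun K => wsum K (wadd a b) + wsum K (wsub a b)) @ \oo -->
  2 * wreal a + 2 * wreal b.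
  under eq_fun do rewrite wsum_parallelogram.
  by apply: cvgD; apply: cvgMl_tmp; exact: wsum_cvg.
exact: cvg_unique h1 h2.
Qed.

Lemma wsum_scale K t a : wsum K (wscale t a) = t ^+ 2 * wsum K a.
Proof.
by rewrite /wsum mulr_sumr; apply: eq_bigr => k _; rewrite /wscale exprMn mulrA.
Qed.

Lemma wspace_scale t a : wspace a -> wspace (wscale t a).
Proof.
move=> Ha; apply: (proj1 (@wspace_bound _ (t ^+ 2 * wreal a) _)) => K.
by rewrite wsum_scale ler_wpM2l ?sqr_ge0 ?wsum_le.
Qed.

Lemma wreal_scale t a : wspace a -> wreal (wscale t a) = t ^+ 2 * wreal a.
Proof.
move=> Ha; have h1 := wsum_cvg (wspace_scale t Ha).
have h2 : (fun K => wsum K (wscale t a)) @ \oo --> t ^+ 2 * wreal a.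
  under eq_fun do rewrite wsum_scale.
  by apply: cvgMl_tmp; exact: wsum_cvg.
exact: cvg_unique h1 h2.
Qed.

Lemma wspace0 : wspace (fun=> 0).
Proof.
apply: (proj1 (@wspace_bound _ 0 _)) => K.
by rewrite /wsum big1 // => k _; rewrite expr0n mul0r.
Qed.

Lemma wreal0 : wreal (fun=> 0) = 0.
Proof.
apply/eqP; rewrite eq_le wreal_ge0 andbT.
apply: (proj2 (@wspace_bound _ 0 _)) => K.
by rewrite /wsum big1 // => k _; rewrite expr0n mul0r.
Qed.

Lemma coord_le a k : wspace a -> a k ^+ 2 * lam k <= wreal a.
Proof.
move=> Ha; apply: le_trans (wsum_le k.+1 Ha).
by rewrite /wsum big_nat_recr //= lerDr sumr_ge0.
Qed.

Lemma wreal_eq0 a : wspace a -> wreal a = 0 -> a = fun=> 0.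
Proof.
move=> Ha a0; apply/funext => k; have := coord_le k Ha.
rewrite a0 => h; have : a k ^+ 2 * lam k = 0 by apply/eqP; rewrite eq_le h term_ge0.
by move=> /eqP; rewrite mulf_eq0 (gt_eqF (lam_gt0 k)) orbF sqrf_eq0 => /eqP.
Qed.

Definition coordinatewise (s : nat -> nat -> R) a :=
  forall k, (fun j => s j k) @ \oo --> a k.

Lemma wsum_coordinatewise s a K : coordinatewise s a ->
  (fun j => wsum K (s j)) @ \oo --> wsum K a.
Proof.
move=> sa; elim: K => [|K IH].
  by rewrite /wsum big_nil; under eq_fun do rewrite big_nil; exact: cvg_cst.
rewrite /wsum big_nat_recr //=; under eq_fun do rewrite big_nat_recr //=.
apply: cvgD => //; apply: cvgMr_tmp.
by rewrite expr2; under eq_fun do rewrite expr2; apply: cvgM; exact: sa.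
Qed.

(** Weak lower semicontinuity of the norm: some finite partial sum captures [wreal a] up to [e], is
    continuous in finitely many coordinates, and is dominated by the full sum of [s j]. *)
Lemma wreal_lsc_near s a e : coordinatewise s a -> wspace a ->
  (forall j, wspace (s j)) -> 0 < e ->
  \forall j \near \oo, wreal a - e <= wreal (s j).
Proof.
move=> sa Ha Hs e0; have [K hK] := wsum_gt Ha e0.
have d0 : 0 < wsum K a - (wreal a - e) by lra.
have /cvgrPdist_lt/(_ _ d0) := @wsum_coordinatewise s a K sa.
apply: filterS => j /= h; apply: le_trans (wsum_le K (Hs j)).
by move: h; rewrite ltr_norml => /andP[_ ?]; lra.
Qed.

Lemma wspace_bounded_limit s a c : coordinatewise s a ->
  (forall j, wspace (s j)) -> (forall j, wreal (s j) <= c) ->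
  wspace a /\ wreal a <= c.
Proof.
move=> sa Hs Hc; apply: wspace_bound => K.
apply: (cvgr_to_le (@wsum_coordinatewise s a K sa)).
by near=> j; exact: le_trans (wsum_le _ (Hs j)) (Hc j).
Unshelve. all: by end_near. Qed.

(** The diagonal argument is replaced by one ultrafilter finer than [\oo], along which all
    coordinates converge at once; its members are nonempty, so the indices of the subsequence can be
    picked one after the other. *)
Lemma wbounded_subsequence s c : (forall j, wspace (s j)) ->
  (forall j, wreal (s j) <= c) ->
  exists f : nat -> nat, exists a,
    [/\ {homo f : i j / (i < j)%N}, wspace a & coordinatewise (s \o f) a].
Proof.
move=> Hs Hc.
have [F [UF ooF]] := @ultraFilterLemma nat \oo _.
have lims k : exists x : R, (fun j => s j k) @ F --> x.
  (* From [x ^+ 2 <= y] follows [|x| <= y + 1], which avoids a square root. *)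
  pose r := c / lam k + 1.
  have sr j : s j k \in `[- r, r].
    have h : s j k ^+ 2 <= c / lam k.
      by rewrite ler_pdivlMr //; exact: le_trans (coord_le k (Hs j)) (Hc j).
    rewrite in_itv /= -ler_norml.
    have : `|s j k| ^+ 2 <= c / lam k by rewrite real_normK ?num_real.
    rewrite /r; have := normr_ge0 (s j k); nra.
  have := @segment_compact R (- r) r; rewrite compact_ultra.
  move=> /(_ ((fun j => s j k) @ F)) [].
  - exact: fmap_ultra.
  - by rewrite /fmap /=; apply: filterS (@filterT _ F _) => j _; exact: sr.
  - by move=> x [_ ?]; exists x.
have [a ha] := choice lims.
(* Finitely many conditions, each holding on a member of [F], hold jointly on a member; since [F]
   refines [\oo], the index can moreover be taken beyond [i0]. *)
have step j i0 : exists i, (i0 < i)%N /\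
    forall k, (k <= j)%N -> `|a k - s i k| < j.+1%:R^-1.
  have : F [set i | (i0 < i)%N /\ forall k, (k <= j)%N -> `|a k - s i k| < j.+1%:R^-1].
    apply: filterI; first by apply: ooF; exact: nbhs_infty_gt.
    have : forall l, \forall i \near F, forall k, (k < l)%N -> `|a k - s i k| < j.+1%:R^-1.
      elim => [|l IH]; first by near=> i.
      have jj : 0 < j.+1%:R^-1 :> R by rewrite invr_gt0.
      have /cvgrPdist_lt/(_ _ jj) := ha l.
      move: IH; apply: filterS2 => i IH h k; rewrite ltnS leq_eqVlt => /orP[/eqP ->//|].
      exact: IH.
    by move=> /(_ j.+1); apply: filterS => i h k kj; exact: h.
  by move=> /filter_ex[i hi]; exists i.
have [g hg] : {g : nat -> nat -> nat | forall j i0, (i0 < g j i0)%N /\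
    forall k, (k <= j)%N -> `|a k - s (g j i0) k| < j.+1%:R^-1}.
  exists (fun j i0 => xget 0%N [set i | (i0 < i)%N /\
    forall k, (k <= j)%N -> `|a k - s i k| < j.+1%:R^-1]) => j i0.
  by case: xgetP => [i _ //|no]; have [i /no] := step j i0.
pose f := fix f j := if j is j'.+1 then g j (f j') else g 0%N 0%N.
have fS j : (f j < f j.+1)%N by have [] := hg j.+1 (f j).
have fa j k : (k <= j)%N -> `|a k - s (f j) k| < j.+1%:R^-1.
  by case: j => [|j]; [have [_] := hg 0%N 0%N | have [_] := hg j.+1 (f j)]; apply.
have sfa : coordinatewise (s \o f) a.
  move=> k; apply/cvgrPdist_lt => e e0.
  near=> j; apply: (@lt_trans _ _ j.+1%:R^-1).
    by apply: fa; near: j; exact: nbhs_infty_ge.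
  near: j; exact: (near_infty_natSinv_lt (PosNum e0)).
exists f, a; split => //; first exact: (homo_ltn ltn_trans fS).
by have [] := @wspace_bounded_limit (s \o f) a c sfa (fun j => Hs _) (fun j => Hc _).
Unshelve. all: by end_near. Qed.

End WeightedSequences.

(** * Saddle points of convex-concave functionals *)

Section SaddlePoints.
Context (R : realType) (lam : nat -> R) (lam_gt0 : forall k, 0 < lam k).
Local Notation X := (nat -> R).
Local Notation H := (wspace lam).
Local Notation N := (wreal lam).
Implicit Types (I : X -> X -> R) (J : nat -> X -> X -> R) (c e y C : R).

(** [kappa] and [C] are chosen before the index [j], hence uniformly in the controls. [kappa] is
    what remains of the coefficient 1/2 of [N b] in [saddle_functional] after the potential has
    consumed its share. *)
Definition coercive_along J := forall a, H a ->
  exists (kappa : R) C, 0 < kappa /\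
    forall j b, H b -> - (2^-1 - kappa) * N b - C <= J j a b.

(* Coordinatewise convergence of an N-bounded sequence is weak convergence; J j will
   be the functional of the j-th control and I that of the limit control. *)
Definition lsc_along J I := forall kappa : nat -> nat, kappa @ \oo --> \oo ->
  forall a s b c e, H a -> (forall j, H (s j)) -> (forall j, N (s j) <= c) ->
    coordinatewise s b -> 0 < e ->
    \forall j \near \oo, I a b - e <= J (kappa j) a (s j).

(** The exchange of the two players: upper semicontinuity and anticoercivity in the first variable
    become lower semicontinuity and coercivity in the second, so that each property is stated
    once. *)
Definition flip J : nat -> X -> X -> R := fun j a b => - J j b a.
Definition flip1 I : X -> X -> R := fun a b => - I b a.

Definition saddle_functional I a b : R := N b / 2 - N a / 2 + I a b.
Local Notation F := saddle_functional.

Lemma saddle_limit J I (kappa : nat -> nat) (eps : nat -> R)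
    (sa sb : nat -> X) a b c :
  lsc_along J I -> lsc_along (flip J) (flip1 I) ->
  kappa @ \oo --> \oo -> (forall j, 0 <= eps j) -> eps @ \oo --> 0 ->
  (forall j, H (sa j)) -> (forall j, H (sb j)) ->
  (forall j, N (sa j) <= c) -> (forall j, N (sb j) <= c) ->
  coordinatewise sa a -> coordinatewise sb b ->
  (forall j a' b', H a' -> H b' ->
     F (J (kappa j)) a' (sb j) + eps j * N (sb j) <=
     F (J (kappa j)) (sa j) b' + eps j * N b') ->
  [/\ forall a' b', H a' -> H b' -> F I a' b <= F I a b',
      (fun j => N (wsub (sa j) a)) @ \oo --> 0 &
      (fun j => N (wsub (sb j) b)) @ \oo --> 0].
Proof.
move=> lJ uJ kc e0 ec Hsa Hsb Na Nb ca cb sad.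
have [Ha Nac] := wspace_bounded_limit lam_gt0 ca Hsa Na.
have [Hb Nbc] := wspace_bounded_limit lam_gt0 cb Hsb Nb.
(* The norms of the sequence stay on the left, while its potentials are replaced by their limits.
   Each of the two semicontinuity bounds costs one [e], and the perturbation [eps j * N b'] the
   third. *)
have key a' b' e : H a' -> H b' -> 0 < e -> \forall j \near \oo,
    (N (sa j) + N (sb j)) / 2 <=
    N a' / 2 + N b' / 2 + I a b' - I a' b + 3 * e.
  move=> Ha' Hb' ep.
  have ed : 0 < e / (N b' + 1) by rewrite divr_gt0// ltr_wpDl ?wreal_ge0.
  have eb : \forall j \near \oo, eps j * N b' <= e.
    have /cvgrPdist_lt/(_ _ ed) := ec; apply: filterS => j.
    rewrite sub0r normrN ger0_norm // ltr_pdivlMr ?ltr_wpDl ?wreal_ge0 // => h.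
    by have := e0 j; nra.
  have h1 := lJ _ kc a' sb b c e Ha' Hsb Nb cb ep.
  have h2 := uJ _ kc b' sa a c e Hb' Hsa Na ca ep.
  move: eb h1 h2; apply: filterS3 => j k1 k2 k3.
  have := sad j a' b' Ha' Hb'; rewrite /F /flip /flip1 /= in k3 *.
  have := mulr_ge0 (e0 j) (wreal_ge0 lam_gt0 (sb j)); lra.
have lsa e : 0 < e -> \forall j \near \oo, N a - e <= N (sa j).
  exact: wreal_lsc_near.
have lsb e : 0 < e -> \forall j \near \oo, N b - e <= N (sb j).
  exact: wreal_lsc_near.
(* [key] at the limit point itself: doubling its error gives six parts, and separating [N (sa j)]
   from the sum by the lower semicontinuity of the other norm costs a seventh. *)
have upa e : 0 < e -> \forall j \near \oo, N (sa j) <= N a + e.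
  move=> ep; have e7 : 0 < e / 7 by lra.
  have := key a b _ Ha Hb e7; have := lsb _ e7.
  by apply: filterS2 => j; lra.
have upb e : 0 < e -> \forall j \near \oo, N (sb j) <= N b + e.
  move=> ep; have e7 : 0 < e / 7 by lra.
  have := key a b _ Ha Hb e7; have := lsa _ e7.
  by apply: filterS2 => j; lra.
(* Weak convergence with no gain of norm is strong: by the parallelogram law
   [N (s - l) = 2 N s + 2 N l - N (s + l)], and [s + l] converges weakly to [2 l], whose squared
   norm is [4 N l]. *)
have strong (s : nat -> X) l : (forall j, H (s j)) -> H l -> coordinatewise s l ->
    (forall e, 0 < e -> \forall j \near \oo, N (s j) <= N l + e) ->
    (fun j => N (wsub (s j) l)) @ \oo --> 0.
  move=> Hs Hl sl up; apply/cvgrPdist_le => e ep; have e4 : 0 < e / 4 by lra.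
  have sum_lim : coordinatewise (fun j => wadd (s j) l) (wadd l l).
    by move=> k; apply: cvgD; [exact: sl | exact: cvg_cst].
  have ll : wadd l l = wscale 2 l by apply/funext => k; rewrite /wadd /wscale; ring.
  have := wreal_lsc_near lam_gt0 sum_lim (wspace_add lam_gt0 Hl Hl)
    (fun j => wspace_add lam_gt0 (Hs j) Hl) e4.
  rewrite ll wreal_scale //; have := up _ e4; apply: filterS2 => j h1 h2.
  rewrite sub0r normrN ger0_norm ?wreal_ge0 //.
  by have := wreal_parallelogram lam_gt0 (Hs j) Hl; lra.
split; [|exact: strong|exact: strong].
move=> a' b' Ha' Hb'; rewrite /F leNgt; apply/negP => lt.
set d := N b / 2 - N a' / 2 + I a' b - (N b' / 2 - N a / 2 + I a b').
have d6 : 0 < d / 6 by rewrite /d; lra.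
have h1 := key a' b' _ Ha' Hb' d6; have h2 := lsa _ d6; have h3 := lsb _ d6.
have [j [k1 [k2 k3]]] := filter_ex (filterI h1 (filterI h2 h3)).
by rewrite /d in k1 k2 k3 d6; lra.
Unshelve. all: by end_near. Qed.

(** The saddle inequality is tested at the origin: the lower bound of the left side and the upper
    bound of the right side combine to [k1 * N (sb j) + k2 * N (sa j) <= C1 + C2]. *)
Lemma coercive_saddles_bounded J (kappa : nat -> nat) (eps : nat -> R)
    (sa sb : nat -> X) :
  coercive_along J -> coercive_along (flip J) -> (forall j, 0 <= eps j) ->
  (forall j, H (sa j)) -> (forall j, H (sb j)) ->
  (forall j a' b', H a' -> H b' ->
     F (J (kappa j)) a' (sb j) + eps j * N (sb j) <=
     F (J (kappa j)) (sa j) b' + eps j * N b') ->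
  exists c, (forall j, N (sa j) <= c) /\ (forall j, N (sb j) <= c).
Proof.
move=> cJ cfJ e0 Hsa Hsb sad.
have H0 := wspace0 lam_gt0.
have [k1 [C1 [k1_gt0 h1]]] := cJ _ H0; have [k2 [C2 [k2_gt0 h2]]] := cfJ _ H0.
have bound j : k1 * N (sb j) + k2 * N (sa j) <= C1 + C2.
  have := sad j _ _ H0 H0; have := h1 (kappa j) _ (Hsb j).
  have := h2 (kappa j) _ (Hsa j); have := mulr_ge0 (e0 j) (wreal_ge0 lam_gt0 (sb j)).
  by rewrite /F /flip wreal0 //; lra.
have pa j := wreal_ge0 lam_gt0 (sa j); have pb j := wreal_ge0 lam_gt0 (sb j).
exists ((C1 + C2) / k1 + (C1 + C2) / k2).
have C0 : 0 <= C1 + C2.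
  by apply: le_trans (bound 0%N); rewrite addr_ge0 // mulr_ge0 // ltW.
have q1 : 0 <= (C1 + C2) / k1 by rewrite divr_ge0 // ltW.
have q2 : 0 <= (C1 + C2) / k2 by rewrite divr_ge0 // ltW.
split=> j; have := bound j; have := pa j; have := pb j => x0 y0 xy.
  apply: (@le_trans _ _ ((C1 + C2) / k2)); last by lra.
  by rewrite ler_pdivlMr //; nra.
apply: (@le_trans _ _ ((C1 + C2) / k1)); last by lra.
by rewrite ler_pdivlMr //; nra.
Qed.

(** Serves twice: with a fixed control and [eps] tending to 0 for the existence of saddle points,
    and with varying controls and [eps] equal to 0 for the upper limit of the saddle sets. *)
Lemma saddle_stability J I (kappa : nat -> nat) (eps : nat -> R)
    (sa sb : nat -> X) :
  lsc_along J I -> lsc_along (flip J) (flip1 I) ->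
  coercive_along J -> coercive_along (flip J) ->
  kappa @ \oo --> \oo -> (forall j, 0 <= eps j) -> eps @ \oo --> 0 ->
  (forall j, H (sa j)) -> (forall j, H (sb j)) ->
  (forall j a' b', H a' -> H b' ->
     F (J (kappa j)) a' (sb j) + eps j * N (sb j) <=
     F (J (kappa j)) (sa j) b' + eps j * N b') ->
  exists (f : nat -> nat) a b,
    [/\ {homo f : i j / (i < j)%N}, H a /\ H b,
        forall a' b', H a' -> H b' -> F I a' b <= F I a b',
        (fun j => N (wsub (sa (f j)) a)) @ \oo --> 0 &
        (fun j => N (wsub (sb (f j)) b)) @ \oo --> 0].
Proof.
move=> lJ uJ cJ cfJ kc e0 ec Hsa Hsb sad.
have [c [ca cb]] := coercive_saddles_bounded cJ cfJ e0 Hsa Hsb sad.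
have [f [a [fi Ha fa]]] := wbounded_subsequence lam_gt0 Hsa ca.
have [g [b [gi Hb gb]]] := @wbounded_subsequence _ _ lam_gt0 (sb \o f) c
  (fun j => Hsb (f j)) (fun j => cb (f j)).
have fgi : {homo f \o g : i j / (i < j)%N} by move=> i j /gi/fi.
have toinfty (h : nat -> nat) : {homo h : i j / (i < j)%N} -> h @ \oo --> \oo.
  move=> hi; apply/cvgnyPge => A; near=> j; apply: (@leq_trans j).
    by near: j; exact: nbhs_infty_ge.
  by elim: (j) => // i IH; exact: leq_ltn_trans IH (hi i i.+1 _).
have fga : coordinatewise (sa \o (f \o g)) a.
  by move=> k; exact: (@cvg_comp _ _ _ g (fun j => sa (f j) k) _ _ _ (toinfty g gi) (fa k)).
have kfg : (kappa \o (f \o g)) @ \oo --> \oo by exact: (@cvg_comp _ _ _ (f \o g) kappa _ _ _ (toinfty _ fgi) kc).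
have efg : (eps \o (f \o g)) @ \oo --> 0 by exact: (@cvg_comp _ _ _ (f \o g) eps _ _ _ (toinfty _ fgi) ec).
have [] := @saddle_limit J I (kappa \o (f \o g)) (eps \o (f \o g))
  (sa \o (f \o g)) (sb \o (f \o g)) a b c lJ uJ kfg _ efg _ _ _ _ fga gb _ => //.
- by move=> j; exact: e0.
- by move=> j; exact: Hsa.
- by move=> j; exact: Hsb.
- by move=> j; exact: ca.
- by move=> j; exact: cb.
- by move=> j a' b' Ha' Hb'; exact: sad.
by move=> s1 s2 s3; exists (f \o g), a, b.
Unshelve. all: by end_near. Qed.

(** * Existence of a saddle point for one functional *)

Section Existence.
Variable I : X -> X -> R.
Hypothesis lI : lsc_along (fun=> I) I.
Hypothesis uI : lsc_along (flip (fun=> I)) (flip1 I).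
Hypothesis cI : coercive_along (fun=> I).
Hypothesis cfI : coercive_along (flip (fun=> I)).
Hypothesis concI : forall a1 a2 b (t : R), H a1 -> H a2 -> H b -> 0 <= t <= 1 ->
  t * F I a1 b + (1 - t) * F I a2 b <=
  F I (wadd (wscale t a1) (wscale (1 - t) a2)) b.
Hypothesis convI : forall a b1 b2 (t : R), H a -> H b1 -> H b2 -> 0 <= t <= 1 ->
  F I a (wadd (wscale t b1) (wscale (1 - t) b2)) <=
  t * F I a b1 + (1 - t) * F I a b2.

Let cvg_id_infty : (fun j : nat => j) @ \oo --> \oo.
Proof. exact: cvg_id. Qed.

Lemma functional_lsc a s b c e : H a -> (forall j, H (s j)) ->
  (forall j, N (s j) <= c) -> coordinatewise s b -> 0 < e ->
  \forall j \near \oo, F I a b - e <= F I a (s j).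
Proof.
move=> Ha Hs Nc sb e0; have e2 : 0 < e / 2 by lra.
have [Hb _] := wspace_bounded_limit lam_gt0 sb Hs Nc.
have := wreal_lsc_near lam_gt0 sb Hb Hs e2.
have := lI cvg_id_infty Ha Hs Nc sb e2.
by apply: filterS2 => j; rewrite /F; lra.
Qed.

Lemma functional_usc b s a c e : H b -> (forall j, H (s j)) ->
  (forall j, N (s j) <= c) -> coordinatewise s a -> 0 < e ->
  \forall j \near \oo, F I (s j) b <= F I a b + e.
Proof.
move=> Hb Hs Nc sa e0; have e2 : 0 < e / 2 by lra.
have [Ha _] := wspace_bounded_limit lam_gt0 sa Hs Nc.
have := wreal_lsc_near lam_gt0 sa Ha Hs e2.
have := uI cvg_id_infty Hb Hs Nc sa e2.
by apply: filterS2 => j; rewrite /F /flip /flip1; lra.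
Qed.

Lemma functional_coercive a : H a -> exists (kappa : R) C, 0 < kappa /\
  forall b, H b -> kappa * N b - C <= F I a b.
Proof.
move=> Ha; have [kappa [C [k0 h]]] := cI Ha.
exists kappa, (C + N a / 2); split => // b Hb.
by have := h 0%N b Hb; rewrite /F; lra.
Qed.

Lemma functional_anticoercive b : H b -> exists (kappa : R) C, 0 < kappa /\
  forall a, H a -> F I a b <= C - kappa * N a.
Proof.
move=> Hb; have [kappa [C [k0 h]]] := cfI Hb.
exists kappa, (C + N b / 2); split => // a Ha.
by have := h 0%N a Ha; rewrite /F /flip; lra.
Qed.

Section Perturbed.
Variables (eps : R) (eps_gt0 : 0 < eps).
Let Fe a b := F I a b + eps * N b.

Let Fe_lsc a s b c e : H a -> (forall j, H (s j)) ->
  (forall j, N (s j) <= c) -> coordinatewise s b -> 0 < e ->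
  \forall j \near \oo, Fe a b - e <= Fe a (s j).
Proof.
move=> Ha Hs Nc sb e0; have e2 : 0 < e / 2 by lra.
have [Hb _] := wspace_bounded_limit lam_gt0 sb Hs Nc.
have e2' : 0 < e / 2 / eps by rewrite divr_gt0.
have := wreal_lsc_near lam_gt0 sb Hb Hs e2'.
have := functional_lsc Ha Hs Nc sb e2.
apply: filterS2 => j h1 h2; rewrite /Fe.
have : eps * (N b - e / 2 / eps) <= eps * N (s j) by rewrite ler_wpM2l // ltW.
by rewrite mulrBr mulrCA divff ?gt_eqF // mulr1; lra.
Qed.

Let coerc a : H a -> exists (kappa : R) C, 0 < kappa /\
  forall b, H b -> kappa * N b - C <= Fe a b.
Proof.
move=> Ha; have [kappa [C [k0 h]]] := functional_coercive Ha.
exists kappa, C; split => // b Hb; have := h b Hb.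
by rewrite /Fe; have := mulr_ge0 (ltW eps_gt0) (wreal_ge0 lam_gt0 b); lra.
Qed.

Let bounded_of a (s : nat -> X) C : H a -> (forall j, H (s j)) ->
  (forall j, Fe a (s j) <= C) -> exists c, forall j, N (s j) <= c.
Proof.
move=> Ha Hs hC; have [kappa [C' [k0 h]]] := coerc Ha.
exists ((C + C') / kappa) => j; rewrite ler_pdivlMr //.
by have := h _ (Hs j); have := hC j; lra.
Qed.

Let lsc_le a (s : nat -> X) b c y (r : nat -> R) : H a -> (forall j, H (s j)) ->
  (forall j, N (s j) <= c) -> coordinatewise s b ->
  (forall j, Fe a (s j) <= r j) -> r @ \oo --> y -> Fe a b <= y.
Proof.
move=> Ha Hs Nc sb hr ry; apply/ler_addgt0Pr => e e0.
have e2 : 0 < e / 2 by lra.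
have /cvgrPdist_lt/(_ _ e2) h1 := ry.
have [j [k1 k2]] := filter_ex (filterI h1 (Fe_lsc Ha Hs Nc sb e2)).
move: k1 k2 (hr j); rewrite /= ltr_norml => /andP[k1 _]; lra.
Qed.

(** The direct method: coercivity bounds a minimizing sequence, and the functional is lower
    semicontinuous along a coordinatewise convergent subsequence. *)
Let minimizer a : H a -> exists2 b, H b & forall b', H b' -> Fe a b <= Fe a b'.
Proof.
move=> Ha; pose S := [set Fe a b | b in H].
have S0 : S !=set0 by exists (Fe a (fun=> 0)), (fun=> 0); first exact: wspace0.
have lbS : has_inf S.
  split => //; have [kappa [C [k0 h]]] := coerc Ha.
  exists (- C) => _ [b Hb <-].
  by have := h b Hb; have := mulr_ge0 (ltW k0) (wreal_ge0 lam_gt0 b); lra.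
have appr j : exists b, H b /\ Fe a b <= inf S + j.+1%:R^-1.
  have jj : 0 < j.+1%:R^-1 :> R by rewrite invr_gt0.
  have [_ [b Hb <-] lt] := inf_adherent jj lbS.
  by exists b; split => //; exact: ltW.
have [s hs] := choice appr.
have Hs j : H (s j) := proj1 (hs j).
have [c Nc] : exists c, forall j, N (s j) <= c.
  apply: (@bounded_of a s (inf S + 1)) => // j.
  apply: le_trans (proj2 (hs j)) _; rewrite lerD2l.
  by rewrite invf_le1 // ler1n.
have [f [b [fi Hb fb]]] := wbounded_subsequence lam_gt0 Hs Nc.
exists b => // b' Hb'; apply: (@le_trans _ _ (inf S)); last first.
  by apply: ge_inf; [case: lbS | exists b'].
apply: (@lsc_le a (s \o f) b c (inf S) (fun j => inf S + j.+1%:R^-1)) => //.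
- by move=> j; exact: Hs.
- by move=> j; exact: Nc.
- move=> j; apply: le_trans (proj2 (hs (f j))) _.
  rewrite lerD2l lef_pV2 ?posrE // ler_nat ltnS.
  by elim: (j) => // i IH; exact: leq_ltn_trans IH (fi i i.+1 _).
rewrite -[X in _ --> X]addr0; apply: cvgD; first exact: cvg_cst.
exact: cvg_harmonic.
Qed.

Let Fe_conc a1 a2 b (t : R) : H a1 -> H a2 -> H b -> 0 <= t <= 1 ->
  t * Fe a1 b + (1 - t) * Fe a2 b <=
  Fe (wadd (wscale t a1) (wscale (1 - t) a2)) b.
Proof. by move=> h1 h2 h3 h4; have := concI h1 h2 h3 h4; rewrite /Fe; lra. Qed.

(* Let u0 maximize the concave function a |-> min_b Fe a b, and v0 be the minimizer
   for u0. The minimizers for t u + (1 - t) u0 converge, as t --> 0, to a minimizer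
   for u0, which is v0 by uniqueness, and bound Fe u by the minimax value. *)
Lemma perturbed_saddle : exists a b, [/\ H a, H b &
  forall a' b', H a' -> H b' -> Fe a' b <= Fe a b'].
Proof.
have [mf hm] : {mf : X -> X | forall a, H a -> H (mf a) /\
    forall b', H b' -> Fe a (mf a) <= Fe a b'}.
  exists (fun a => xget (fun=> 0) [set b | H b /\
    forall b', H b' -> Fe a b <= Fe a b']) => a Ha.
  case: xgetP => [b _ []//|no]; have [b Hb hb] := minimizer Ha.
  by have := no b; case.
have H0 := wspace0 lam_gt0.
pose S := [set Fe a (mf a) | a in H].
have [k2 [C2 [k2_gt0 h2]]] := functional_anticoercive H0.
(* Testing the minimum at [b = 0] makes the marginal function anticoercive, so its supremum is
   finite and maximizing sequences are bounded. *)
have ub a : H a -> Fe a (mf a) <= C2 - k2 * N a.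
  move=> Ha; have := (proj2 (hm _ Ha)) _ H0; have := h2 a Ha.
  by rewrite {2}/Fe wreal0 //; lra.
have ubS : has_sup S.
  split; first by exists (Fe (fun=> 0) (mf (fun=> 0))), (fun=> 0).
  exists C2 => _ [a Ha <-]; have := ub a Ha.
  by have := mulr_ge0 (ltW k2_gt0) (wreal_ge0 lam_gt0 a); lra.
have appr j : exists a, H a /\ sup S - j.+1%:R^-1 <= Fe a (mf a).
  have jj : 0 < j.+1%:R^-1 :> R by rewrite invr_gt0.
  have [_ [a Ha <-] lt] := sup_adherent jj ubS.
  by exists a; split => //; exact: ltW.
have [s hs] := choice appr.
have Hs j : H (s j) := proj1 (hs j).
have Nc j : N (s j) <= (C2 - sup S + 1) / k2.
  rewrite ler_pdivlMr //; have := proj2 (hs j); have := ub _ (Hs j).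
  have : j.+1%:R^-1 <= 1 :> R by rewrite invf_le1 // ler1n.
  by move: (_^-1) (Fe _ _) (sup S) (N (s j)) => q x y n; lra.
have [f [u0 [fi Hu0 fu]]] := wbounded_subsequence lam_gt0 Hs Nc.
(* For fixed [v], [Fe (s j) v] is at least the marginal value at [s j], hence almost [sup S]; upper
   semicontinuity in the first variable passes this to [u0]. *)
have u0max v : H v -> sup S <= Fe u0 v.
  move=> Hv; apply/ler_addgt0Pr => e e0; have e2 : 0 < e / 2 by lra.
  have := @functional_usc v (s \o f) u0 _ _ Hv (fun j => Hs _) (fun j => Nc _) fu e2.
  move=> h; have := filter_ex (filterI h (near_infty_natSinv_lt (PosNum e2))).
  move=> [j [k1 /= k3]].
  have fj : (j <= f j)%N by elim: (j) => // i IH; exact: leq_ltn_trans IH (fi i i.+1 _).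
  have k3' : (f j).+1%:R^-1 <= j.+1%:R^-1 :> R.
    by rewrite lef_pV2 ?posrE // ler_nat ltnS.
  have := proj2 (hs (f j)); have := (proj2 (hm _ (Hs (f j)))) _ Hv.
  rewrite {2}/Fe /=; rewrite [Fe u0 v]/Fe; move: k1 k3 k3' => /=.
  by move: ((f j).+1%:R^-1) (j.+1%:R^-1) (Fe _ _) => q q' x; lra.
have supS a : H a -> Fe a (mf a) <= sup S.
  by move=> Ha; apply: ub_le_sup; [case: ubS | exists a].
set sS := sup S in u0max supS *.
have [Hv0 v0min] := hm _ Hu0; set v0 := mf u0 in Hv0 v0min.
have v0s : Fe u0 v0 = sS by apply/eqP; rewrite eq_le u0max // supS.
suff main u : H u -> Fe u v0 <= sS.
  by exists u0, v0; split => // a' b' Ha' Hb'; exact: le_trans (main _ Ha') (u0max _ Hb').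
(* The shift by two keeps [t j] strictly below 1, so that [1 - t j] can be divided by. *)
move=> Hu; pose t j : R := j.+2%:R^-1.
have t01 j : 0 <= t j <= 1 by rewrite /t invr_ge0 ler0n invf_le1 // ler1n.
have t1 j : t j < 1 by rewrite /t invf_lt1 // ltr1n.
pose uu j := wadd (wscale (t j) u) (wscale (1 - t j) u0).
have Huu j : H (uu j) by apply: wspace_add => //; exact: wspace_scale.
pose v j := mf (uu j); have Hv j : H (v j) := proj1 (hm _ (Huu j)).
have seg j : t j * Fe u (v j) + (1 - t j) * Fe u0 (v j) <= sS.
  exact: le_trans (Fe_conc Hu Hu0 (Hv j) (t01 j)) (supS _ (Huu j)).
have tpos j : 0 < t j by rewrite /t invr_gt0.
(* In [seg] a convex combination is at most [sS] while its second value is at least [sS] by [u0max];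
   so the first is at most [sS]. *)
have le1 j : Fe u (v j) <= sS.
  have := seg j; have := u0max _ (Hv j); have := t1 j; have := tpos j.
  move=> h1 h3 h4 h5; rewrite leNgt; apply/negP => lt; nra.
have [c Nv] := bounded_of Hu Hv le1.
have [g [vs [gi Hvs gv]]] := wbounded_subsequence lam_gt0 Hv Nv.
have u_vs : Fe u vs <= sS.
  apply: (@lsc_le u (v \o g) vs c _ (fun=> sS)) => //; last exact: cvg_cst.
  - by move=> j; exact: Hv.
  - by move=> j; exact: Nv.
  - by move=> j; exact: le1.
(* [seg] solved for [Fe u0 (v j)], with [Fe u (v j)] bounded below by the minimum over the second
   variable at [u], gives an upper bound [r j] tending to [sS] with [t j]. *)
have u0_vs : Fe u0 vs <= sS.
  have [Hmu mumin] := hm _ Hu.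
  pose r j := (sS - t j * Fe u (mf u)) / (1 - t j).
  have tc : t @ \oo --> 0.
    by have := @cvg_harmonic R; rewrite -cvg_shiftS.
  apply: (@lsc_le u0 (v \o g) vs c _ (r \o g)) => //.
  - by move=> j; exact: Hv.
  - by move=> j; exact: Nv.
  - move=> j; rewrite /r /= ler_pdivlMr ?subr_gt0 //.
    have := seg (g j); have := mumin _ (Hv (g j)); have := tpos (g j).
    move=> h1 h3 h4; have : t (g j) * Fe u (mf u) <= t (g j) * Fe u (v (g j)).
      by rewrite ler_pM2l.
    lra.
  have gc : g @ \oo --> \oo.
    apply/cvgnyPge => A; near=> j; apply: (@leq_trans j).
      by near: j; exact: nbhs_infty_ge.
    by elim: (j) => // i IH; exact: leq_ltn_trans IH (gi i i.+1 _).
  apply: (@cvg_comp _ _ _ g r _ _ _ gc).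
  have -> : sS = (sS - 0 * Fe u (mf u)) / (1 - 0) by rewrite mul0r !subr0 divr1.
  apply: cvgM.
    by apply: cvgB; [exact: cvg_cst | apply: cvgMr_tmp; exact: tc].
  apply: cvgV; first by rewrite subr0 oner_neq0.
  by apply: cvgB; [exact: cvg_cst | exact: tc].
(* At the midpoint the value is at least [sS], but convexity and the parallelogram law put it at
   most at [sS - eps * N (wsub vs v0) / 4]. *)
have vsE : vs = v0.
  have half01 : 0 <= (2^-1 : R) <= 1.
    by rewrite invr_ge0 ler0n invf_le1 ?ltr0n // ler1n.
  have conv := convI Hu0 Hvs Hv0 half01.
  have midE : wadd (wscale 2^-1 vs) (wscale (1 - 2^-1) v0) = wscale 2^-1 (wadd vs v0).
    by apply/funext => k; rewrite /wadd /wscale; field.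
  rewrite midE in conv.
  have Hmid : H (wscale 2^-1 (wadd vs v0)).
    by apply: wspace_scale => //; apply: wspace_add.
  have := u0max _ Hmid; rewrite /Fe wreal_scale //; last exact: wspace_add.
  have := wreal_parallelogram lam_gt0 Hvs Hv0.
  have := wreal_ge0 lam_gt0 (wsub vs v0).
  move: u0_vs v0s conv; rewrite /Fe => e1 e2 e3 e4 e5 e6.
  have : N (wsub vs v0) = 0.
    have : eps * N (wsub vs v0) <= 0 by nra.
    by rewrite pmulr_rle0 // => h; apply/eqP; rewrite eq_le h.
  move=> /(wreal_eq0 lam_gt0 (wspace_sub lam_gt0 Hvs Hv0)) e0.
  apply/funext => k; have /(congr1 (fun w => w k)) := e0.
  by rewrite /wsub => /eqP; rewrite subr_eq0 => /eqP.
by rewrite -vsE.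
Unshelve. all: by end_near. Qed.

End Perturbed.

Lemma saddle_exists : exists a b, [/\ H a, H b &
  forall a' b', H a' -> H b' -> F I a' b <= F I a b'].
Proof.
have pert j := @perturbed_saddle j.+1%:R^-1 (ltac:(by rewrite invr_gt0)).
have [sa hsa] := choice pert; have [sb hsb] := choice hsa.
have e0 j : 0 <= j.+1%:R^-1 :> R by rewrite invr_ge0.
have Hsa j : H (sa j) by have [] := hsb j.
have Hsb j : H (sb j) by have [] := hsb j.
have sad j a' b' : H a' -> H b' -> F I a' (sb j) + j.+1%:R^-1 * N (sb j) <=
    F I (sa j) b' + j.+1%:R^-1 * N b'.
  by have [_ _] := hsb j; apply.
have [f [a [b [_ [Ha Hb] h _ _]]]] := @saddle_stability (fun=> I) I id
  (fun j => j.+1%:R^-1) sa sb lI uI cI cfI cvg_id_infty e0 (@cvg_harmonic R) Hsa Hsb sad.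
by exists a, b.
Qed.

End Existence.

End SaddlePoints.

(** * Real-valued and square integrable functions *)

Section RealIntegrals.
Context d (T : measurableType d) (R : realType) (mu : {measure set T -> \bar R})
  (D : set T) (mD : measurable D).
Implicit Types (f g h u v : T -> R) (s : nat -> T -> R) (c e r t : R).

Definition rint f := mu.-integrable D (EFin \o f).
Local Notation Int f := (Rintegral mu D f).

Lemma rint_measurable f : rint f -> measurable_fun D f.
Proof. by move=> /integrableP[/measurable_EFinP]. Qed.

Lemma rint_le f g : measurable_fun D f -> rint g ->
  (forall x, D x -> `|f x| <= `|g x|) -> rint f.
Proof.
move=> mf ig le; apply: (le_integrable mD _ _ ig); first exact/measurable_EFinP.
by move=> x Dx; rewrite /= lee_fin le.
Qed.

Lemma rintD f g : rint f -> rint g -> rint (fun x => f x + g x).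
Proof.
move=> hf hg; apply: eq_integrable (integrableD mD hf hg) => //.
Qed.

Lemma rintZ r f : rint f -> rint (fun x => r * f x).
Proof.
by move=> hf; apply: eq_integrable (integrableZl mD r hf).
Qed.

Lemma rintN f : rint f -> rint (fun x => - f x).
Proof.
by move=> hf; apply: eq_integrable (integrableN hf).
Qed.

Lemma rintB f g : rint f -> rint g -> rint (fun x => f x - g x).
Proof. by move=> hf hg; apply: rintD => //; exact: rintN. Qed.

Lemma rint_norm f : rint f -> rint (fun x => `|f x|).
Proof.
move=> hf; apply: rint_le (hf) _; last by move=> x _; rewrite normr_id.
by apply: measurableT_comp => //; exact: rint_measurable.
Qed.

Lemma rint_integral f : rint f -> (\int[mu]_(x in D) (f x)%:E)%E = (Int f)%:E.
Proof. by move=> hf; rewrite /Rintegral fineK //; exact: integrable_fin_num. Qed.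

Lemma IntN f : rint f -> Int (fun x => - f x) = - Int f.
Proof.
move=> hf; rewrite -mulN1r -RintegralZl //.
by apply: eq_Rintegral => x _; rewrite mulN1r.
Qed.

Lemma eq_Int f g : (forall x, D x -> f x = g x) -> Int f = Int g.
Proof. by move=> fg; apply: eq_Rintegral => x /set_mem/fg. Qed.

Lemma eq_rint f g : (forall x, D x -> f x = g x) -> rint f -> rint g.
Proof.
move=> fg; apply: eq_integrable => // x /set_mem Dx.
by rewrite /= fg.
Qed.

Lemma ae_eq_Int f g : measurable_fun D f -> measurable_fun D g ->
  {ae mu, forall x, D x -> f x = g x} -> Int f = Int g.
Proof.
move=> mf mg fg; rewrite /Rintegral; congr fine.
apply: ae_eq_integral => //; [exact/measurable_EFinP|exact/measurable_EFinP|].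
by apply: filterS fg => x fg Dx; rewrite fg.
Qed.

Lemma rint_ae_le f g : measurable_fun D f -> rint g ->
  {ae mu, forall x, D x -> `|f x| <= `|g x|} -> rint f.
Proof.
move=> mf hg fg; have mg := rint_measurable hg.
apply/integrableP; split; first exact/measurable_EFinP.
have /integrableP[_] := hg; apply: le_lt_trans.
apply: ae_ge0_le_integral => //.
- by apply: measurableT_comp => //; exact/measurable_EFinP.
- by apply: measurableT_comp => //; exact/measurable_EFinP.
Qed.

Lemma le_Int_ae f g : rint f -> rint g ->
  {ae mu, forall x, D x -> f x <= g x} -> Int f <= Int g.
Proof.
move=> hf hg fg; rewrite -subr_ge0 -RintegralB //.
have hB := rintB hg hf.
rewrite (@ae_eq_Int _ (fun x => `|g x - f x|)).
- by apply: Rintegral_ge0 => x _.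
- exact: rint_measurable.
- exact/rint_measurable/rint_norm.
- by apply: filterS fg => x fg Dx; rewrite ger0_norm // subr_ge0 fg.
Qed.

(** Integrability of the limit is part of the conclusion; this is what makes Fatou's lemma yield
    completeness of L^2 below. *)
Lemma fatou_norm s f c : (forall j, rint (s j)) -> measurable_fun D f ->
  {ae mu, forall x, D x -> (fun j => s j x) @ \oo --> f x} ->
  (forall j, Int (fun x => `|s j x|) <= c) ->
  rint f /\ Int (fun x => `|f x|) <= c.
Proof.
move=> hs mf sf sc.
have ms j : measurable_fun D (s j) := rint_measurable (hs j).
have mn j : measurable_fun D (fun x => `|(s j x)%:E|%E).
  by apply: measurableT_comp => //; exact/measurable_EFinP.
have mfn : measurable_fun D (fun x => `|(f x)%:E|%E).
  by apply: measurableT_comp => //; exact/measurable_EFinP.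
have le : (\int[mu]_(x in D) `|(f x)%:E| <= c%:E)%E.
  (* Fatou's lemma concerns the lower limit of the [|s j|], which agrees with [|f|] only almost
     everywhere. *)
  rewrite (@ge0_ae_eq_integral _ _ _ mu D _ (fun x => limn_einf (fun j => `|(s j x)%:E|%E))) //.
  - apply: le_trans (fatou mu mD mn _) _ => //.
    rewrite limn_einf_lim; apply: lime_le.
      exact: is_cvg_einfs.
    near=> j; apply: (@le_trans _ _ (\int[mu]_(x in D) `|(s j x)%:E|)%E).
      by apply: ereal_inf_lbound; exists j => //=.
    rewrite (_ : (\int[mu]_(x in D) `|(s j x)%:E|)%E = (Int (fun x => `|s j x|))%:E).
      by rewrite lee_fin.
    by rewrite -rint_integral //; exact: rint_norm.
  - rewrite /limn_einf; apply: measurableT_comp => //.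
    by apply: measurable_fun_limn_esup => j; exact: measurableT_comp.
  - move=> x Dx; rewrite limn_einf_lim; apply: lime_ge; first exact: is_cvg_einfs.
    by near=> j; apply: le_ereal_inf_tmp => _ [k _ <-].
  - apply: filterS sf => x sf Dx.
    have h : (fun j => `|(s j x)%:E|%E) @ \oo --> `|(f x)%:E|%E.
      apply: cvg_EFin; first by near=> j.
      by apply: cvg_norm; exact: sf.
    by have [-> _] := cvg_limn_einf_sup h.
have hf : rint f.
  by apply/integrableP; split; [exact/measurable_EFinP|exact: le_lt_trans le (ltry _)].
split => //; rewrite -lee_fin -rint_integral //; exact: rint_norm.
Unshelve. all: by end_near. Qed.

Lemma fatou_ge0 s f c : (forall j, rint (s j)) -> measurable_fun D f ->
  {ae mu, forall x, D x -> (fun j => s j x) @ \oo --> f x} ->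
  (forall j, {ae mu, forall x, D x -> 0 <= s j x}) ->
  (forall j, Int (s j) <= c) ->
  rint f /\ Int f <= c.
Proof.
move=> hs mf sf s0 sc.
have [|hf le] := fatou_norm hs mf sf (c := c).
  move=> j; rewrite (@ae_eq_Int _ (s j)) //.
  - exact/rint_measurable/rint_norm.
  - exact: rint_measurable.
  - by apply: filterS (s0 j) => x s0x Dx; rewrite ger0_norm ?s0x.
split => //; apply: le_trans le; apply: le_Int_ae => //; first exact: rint_norm.
by apply: aeW => x _; exact: ler_norm.
Qed.

Lemma subsequence_of (P : nat -> nat -> Prop) :
  (forall j i0, exists2 i, (i0 < i)%N & P j i) ->
  exists2 f : nat -> nat, {homo f : i j / (i < j)%N} & forall j, P j (f j).
Proof.
move=> H; have [g hg] : {g : nat -> nat -> nat |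
    forall j i0, (i0 < g j i0)%N /\ P j (g j i0)}.
  exists (fun j i0 => xget 0%N [set i | (i0 < i)%N /\ P j i]) => j i0.
  by case: xgetP => [i _ //|no]; have [i i0i Pi] := H j i0; have := no i; case.
pose f := fix f j := if j is j'.+1 then g j (f j') else g 0%N 0%N.
have fS j : (f j < f j.+1)%N by have [] := hg j.+1 (f j).
exists f; first exact: (homo_ltn ltn_trans fS).
by case=> [|j]; [have [] := hg 0%N 0%N | have [] := hg j.+1 (f j)].
Qed.

Lemma increasing_infty (f : nat -> nat) :
  {homo f : i j / (i < j)%N} -> f @ \oo --> \oo.
Proof.
move=> hi; apply/cvgnyPge => A; near=> j; apply: (@leq_trans j).
  by near: j; exact: nbhs_infty_ge.
by elim: (j) => // i IH; exact: leq_ltn_trans IH (hi i i.+1 _).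
Unshelve. all: by end_near. Qed.

(** By monotone convergence the sum of the [|s j|] has a finite integral, hence is finite almost
    everywhere. *)
Lemma summable_norm_ae s (q : nat -> R) c : (forall j, rint (s j)) ->
  (forall j, Int (fun x => `|s j x|) <= q j) ->
  (forall K, \sum_(0 <= j < K) q j <= c) ->
  {ae mu, forall x, D x -> cvgn (series (fun j => `|s j x|))}.
Proof.
move=> hs sq qc.
have mn j : measurable_fun D (fun x => (`|s j x|)%:E).
  by apply/measurable_EFinP; exact/rint_measurable/rint_norm.
pose S x : \bar R := (\sum_(0 <= j <oo) (`|s j x|)%:E)%E.
have S0 x : (0 <= S x)%E by apply: nneseries_ge0 => j _ _; rewrite lee_fin.
have SE : (\int[mu]_(x in D) S x <= c%:E)%E.
  rewrite /S integral_nneseries //; apply: lime_le.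
    by apply: is_cvg_nneseries => j _ _; exact: integral_ge0.
  near=> K; rewrite (eq_bigr (fun j => (Int (fun x => `|s j x|))%:E)).
    rewrite sumEFin lee_fin; apply: le_trans (qc K); exact: ler_sum.
  by move=> j _; rewrite rint_integral //; exact: rint_norm.
have iS : mu.-integrable D S.
  apply/integrableP; split.
    by apply: ge0_emeasurable_sum => // j x Dx _; rewrite lee_fin.
  rewrite (eq_integral S); first exact: le_lt_trans SE (ltry _).
  by move=> x _; rewrite gee0_abs.
apply: filterS (integrable_ae mD iS) => x Sfin Dx.
apply: nondecreasing_is_cvgn.
  by apply/nondecreasing_seqP => j; rewrite /series /= big_nat_recr //= lerDl.
exists (fine (S x)) => _ [K _ <-].
rewrite -lee_fin fineK ?Sfin // /series /= -sumEFin.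
by apply: nneseries_lim_ge => j _; rewrite lee_fin.
Unshelve. all: by end_near. Qed.

Lemma sum_half_le K : \sum_(0 <= j < K) (2^-1 : R) ^+ j <= 2.
Proof.
rewrite (_ : \sum_(0 <= j < K) (2^-1 : R) ^+ j = 2 - 2 * 2^-1 ^+ K).
  by rewrite lerBlDr lerDl mulr_ge0 // exprn_ge0 // invr_ge0.
elim: K => [|K IH]; first by rewrite big_nil expr0; ring.
by rewrite big_nat_recr //= IH exprS; field.
Qed.

(** Along indices whose integrals are at most [2^-j] the series of absolute values converges almost
    everywhere, so its terms tend to 0. *)
Lemma subsequence_ae_cvg0 s : (forall j, rint (s j)) ->
  (fun j => Int (fun x => `|s j x|)) @ \oo --> 0 ->
  exists2 f : nat -> nat, {homo f : i j / (i < j)%N} &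
    {ae mu, forall x, D x -> (fun j => s (f j) x) @ \oo --> 0}.
Proof.
move=> hs s0.
have [|f fi fP] := @subsequence_of (fun j i => Int (fun x => `|s i x|) <= 2^-1 ^+ j).
  move=> j i0; have e0 : 0 < (2^-1 : R) ^+ j by rewrite exprn_gt0 // invr_gt0.
  have /cvgrPdist_le/(_ _ e0) h := s0.
  have [i [h1 h2]] := filter_ex (filterI h (nbhs_infty_gt i0)).
  exists i => //; move: h1 => /=; rewrite sub0r normrN ger0_norm //.
  exact: Rintegral_ge0.
exists f => //.
have := @summable_norm_ae (s \o f) (fun j => 2^-1 ^+ j) 2 (fun j => hs _) fP sum_half_le.
apply: filterS => x cx Dx; apply/norm_cvg0P.
exact: cvg_series_cvg_0 (cx Dx).
Qed.

End RealIntegrals.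

(** * Square integrable functions on a set of finite measure *)

Section SquareIntegrable.
Context d (T : measurableType d) (R : realType) (mu : {measure set T -> \bar R})
  (D : set T) (mD : measurable D) (finD : (mu D < +oo)%E).
Implicit Types (f g h u v : T -> R) (s : nat -> T -> R) (c e r t : R).

Local Notation Int f := (Rintegral mu D f).
Local Notation rint := (rint mu D).

(** Functions, not classes, so [iprod] is only semidefinite. [L2_Lp_fun] and [Lp_fun_L2] identify
    this with [Lp_fun] of exponent 2. *)
Definition L2 f := measurable_fun D f /\ rint (fun x => f x ^+ 2).
Definition iprod f g := Int (fun x => f x * g x).
Local Notation q f := (iprod f f).

Lemma rint_cst c : rint (fun=> c).
Proof.
apply/integrableP; split; first exact: measurable_cst.
by rewrite (eq_integral (fun=> `|c|%:E)) // integral_cst // lte_mul_pinfty // lee_fin.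
Qed.

Lemma L2_mul f g : L2 f -> L2 g -> rint (fun x => f x * g x).
Proof.
move=> [mf hf] [mg hg]; apply: (rint_le mD _ (rintD mD hf hg)).
  exact: measurable_funM.
move=> x _; rewrite [leRHS]ger0_norm ?addr_ge0 ?sqr_ge0 // ler_norml.
by have := sqr_ge0 (f x + g x); have := sqr_ge0 (f x - g x);
  have := sqr_ge0 (f x); have := sqr_ge0 (g x); nra.
Qed.

Lemma L2_rint f : L2 f -> rint f.
Proof.
move=> [mf hf]; apply: (rint_le mD mf (rintD mD (rint_cst 1) hf)) => x _.
rewrite [leRHS]ger0_norm ?addr_ge0 ?sqr_ge0 // ler_norml.
by have := sqr_ge0 (f x + 1); have := sqr_ge0 (f x - 1); have := sqr_ge0 (f x); nra.
Qed.

Lemma L2_cst c : L2 (fun=> c).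
Proof. by split; [exact: measurable_cst | exact: rint_cst]. Qed.

Lemma L2D f g : L2 f -> L2 g -> L2 (fun x => f x + g x).
Proof.
move=> hf hg; have [mf rf] := hf; have [mg rg] := hg; split.
  exact: measurable_funD.
apply: (@eq_rint _ _ _ _ _ mD (fun x => (f x ^+ 2 + g x ^+ 2) + 2 * (f x * g x))).
  by move=> x _; ring.
by apply: rintD => //; [exact: rintD | apply: rintZ => //; exact: L2_mul].
Qed.

Lemma L2Z r f : L2 f -> L2 (fun x => r * f x).
Proof.
move=> [mf rf]; split; first by apply: measurable_funM => //; exact: measurable_cst.
apply: (@eq_rint _ _ _ _ _ mD (fun x => r ^+ 2 * f x ^+ 2)); last exact: rintZ.
by move=> x _; rewrite exprMn.
Qed.

Lemma L2B f g : L2 f -> L2 g -> L2 (fun x => f x - g x).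
Proof.
move=> hf hg; have := L2D hf (L2Z (-1) hg).
by under [X in L2 X]eq_fun do rewrite mulN1r.
Qed.

Lemma L2_sum (F : nat -> T -> R) K : (forall k, L2 (F k)) ->
  L2 (fun x => \sum_(k < K) F k x).
Proof.
move=> hF; elim: K => [|K IH].
  by under [X in L2 X]eq_fun do rewrite big_ord0; exact: L2_cst.
by under [X in L2 X]eq_fun do rewrite big_ord_recr /=; exact: L2D.
Qed.

Lemma L2_ae_le f g : measurable_fun D f -> L2 g ->
  {ae mu, forall x, D x -> `|f x| <= `|g x|} -> L2 f.
Proof.
move=> mf [mg rg] fg; split => //; apply: (rint_ae_le mD _ rg).
  exact: measurable_funX.
apply: filterS fg => x fg Dx; rewrite !normrX.
by rewrite lerXn2r ?nnegrE // fg.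
Qed.

Lemma iprodC f g : iprod f g = iprod g f.
Proof. by apply: eq_Int => x _; rewrite mulrC. Qed.

Lemma iprodDl f g h : L2 f -> L2 g -> L2 h ->
  iprod (fun x => f x + g x) h = iprod f h + iprod g h.
Proof.
move=> hf hg hh; rewrite /iprod -RintegralD //; [|exact: L2_mul|exact: L2_mul].
by apply: eq_Int => x _; rewrite mulrDl.
Qed.

Lemma iprodBl f g h : L2 f -> L2 g -> L2 h ->
  iprod (fun x => f x - g x) h = iprod f h - iprod g h.
Proof.
move=> hf hg hh; rewrite /iprod -RintegralB //; [|exact: L2_mul|exact: L2_mul].
by apply: eq_Int => x _; rewrite mulrBl.
Qed.

Lemma iprodZl r f h : L2 f -> L2 h -> iprod (fun x => r * f x) h = r * iprod f h.
Proof.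
move=> hf hh; rewrite /iprod -RintegralZl //; last exact: L2_mul.
by apply: eq_Int => x _; rewrite mulrA.
Qed.

Lemma iprodBr f g h : L2 f -> L2 g -> L2 h ->
  iprod h (fun x => f x - g x) = iprod h f - iprod h g.
Proof. by move=> *; rewrite iprodC iprodBl // !(iprodC h). Qed.

Lemma iprodZr r f h : L2 f -> L2 h -> iprod h (fun x => r * f x) = r * iprod h f.
Proof. by move=> *; rewrite iprodC iprodZl // (iprodC h). Qed.

Lemma iprod_suml (F : nat -> T -> R) K h : (forall k, L2 (F k)) -> L2 h ->
  iprod (fun x => \sum_(k < K) F k x) h = \sum_(k < K) iprod (F k) h.
Proof.
move=> hF hh; elim: K => [|K IH].
  rewrite big_ord0 /iprod (@eq_Int _ _ _ _ _ _ (fun=> 0)) ?Rintegral_cst ?mul0r //.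
  by move=> x _; rewrite big_ord0 mul0r.
rewrite big_ord_recr /= -IH -iprodDl //; last exact: L2_sum.
by apply: eq_Int => x _; rewrite big_ord_recr.
Qed.

Lemma iprod_ge0 f : 0 <= q f.
Proof. by apply: Rintegral_ge0 => x _; rewrite -expr2 sqr_ge0. Qed.

Lemma iprod_sqrB f g : L2 f -> L2 g ->
  q (fun x => f x - g x) = q f - 2 * iprod f g + q g.
Proof.
move=> hf hg; have hB := L2B hf hg.
by rewrite iprodBl // !iprodBr // (iprodC g f); ring.
Qed.

(** The usual quadratic [comb], at the optimal coefficients when one of the two squared norms is
    positive. When both vanish, the choices (1, 1) and (1, -1) squeeze the inner product to 0. *)
Lemma cauchy_schwarz f g : L2 f -> L2 g -> iprod f g ^+ 2 <= q f * q g.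
Proof.
move=> hf hg; have pf := iprod_ge0 f; have pg := iprod_ge0 g.
have comb r t : 0 <= r ^+ 2 * q f - 2 * r * t * iprod f g + t ^+ 2 * q g.
  have := iprod_ge0 (fun x => r * f x - t * g x).
  rewrite iprod_sqrB; [|exact: L2Z|exact: L2Z].
  rewrite !iprodZl ?iprodZr //; try exact: L2Z.
  by move=> h; rewrite (le_trans h) // le_eqVlt; apply/orP; left; apply/eqP; ring.
case: (ltgtP 0 (q g)) pg => // [pg|pg] _.
  have := comb (q g) (iprod f g).
  have -> : q g ^+ 2 * q f - 2 * q g * iprod f g * iprod f g + iprod f g ^+ 2 * q g
    = q g * (q f * q g - iprod f g ^+ 2) by ring.
  by rewrite pmulr_rge0 // subr_ge0.
case: (ltgtP 0 (q f)) pf => // [pf|pf] _.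
  have := comb (iprod f g) (q f).
  have -> : iprod f g ^+ 2 * q f - 2 * iprod f g * q f * iprod f g + q f ^+ 2 * q g
    = q f * (q f * q g - iprod f g ^+ 2) by ring.
  by rewrite pmulr_rge0 // subr_ge0.
have := comb 1 1; have := comb 1 (-1); rewrite -pf -pg => h1 h2.
have -> : iprod f g = 0 by lra.
by rewrite expr0n /= mulr0.
Qed.

Definition L2cvg s f := (fun j => q (fun x => s j x - f x)) @ \oo --> 0.

Lemma sqr_cvg0 (a : nat -> R) (b : nat -> R) c : 0 <= c ->
  (forall j, a j ^+ 2 <= c * b j) -> b @ \oo --> 0 -> a @ \oo --> 0.
Proof.
move=> c0 ab b0; apply/cvgrPdist_le => e e0.
have d0 : 0 < e ^+ 2 / (c + 1) by rewrite divr_gt0 ?exprn_gt0 // ltr_wpDl.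
have /cvgrPdist_le/(_ _ d0) := b0; apply: filterS => j.
rewrite !sub0r !normrN => h.
have c1 : 0 < c + 1 by lra.
have : `|a j| ^+ 2 <= e ^+ 2.
  rewrite real_normK ?num_real //; apply: le_trans (ab j) _.
  rewrite ler_pdivlMr // in h.
  have := ler_norm (b j); have := normr_ge0 (b j); nra.
by rewrite ler_pXn2r // nnegrE // ltW.
Qed.

Lemma L2cvg_iprod s f h : (forall j, L2 (s j)) -> L2 f -> L2 h -> L2cvg s f ->
  (fun j => iprod h (s j)) @ \oo --> iprod h f.
Proof.
move=> hs hf hh sf.
have : (fun j => iprod h (s j) - iprod h f) @ \oo --> 0.
  apply: (sqr_cvg0 (iprod_ge0 h) _ sf) => j.
  rewrite -iprodBr //; apply: cauchy_schwarz => //; exact: L2B.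
by move=> /subr_cvg0.
Qed.

Lemma L2cvg_sqr s f : (forall j, L2 (s j)) -> L2 f -> L2cvg s f ->
  (fun j => q (s j)) @ \oo --> q f.
Proof.
move=> hs hf sf; have h := L2cvg_iprod hs hf hf sf.
have : (fun j => q (fun x => s j x - f x) + 2 * iprod f (s j) - q f) @ \oo -->
    0 + 2 * q f - q f.
  apply: cvgB; last exact: cvg_cst.
  by apply: cvgD => //; apply: cvgMl_tmp.
have -> : 0 + 2 * q f - q f = q f by ring.
apply: cvg_trans; apply: near_eq_cvg; apply: nearW => j.
by rewrite iprod_sqrB // (iprodC f); ring.
Qed.

Lemma L2cvg_ae_subsequence s f : (forall j, L2 (s j)) -> L2 f -> L2cvg s f ->
  exists2 k : nat -> nat, {homo k : i j / (i < j)%N} &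
    {ae mu, forall x, D x -> (fun j => s (k j) x) @ \oo --> f x}.
Proof.
move=> hs hf sf; have hB j := L2B (hs j) hf.
have [||k ki h] := @subsequence_ae_cvg0 _ _ _ mu D mD (fun j x => (s j x - f x) ^+ 2).
- by move=> j; case: (hB j).
- rewrite (_ : (fun j => _) = fun j => q (fun x => s j x - f x)) //.
  by apply/funext => j; apply: eq_Int => x _; rewrite ger0_norm ?sqr_ge0 // expr2.
exists k => //; apply: filterS h => x h Dx; apply/subr_cvg0.
apply: (@sqr_cvg0 _ (fun j => (s (k j) x - f x) ^+ 2) 1 ler01 _ (h Dx)) => j.
by rewrite mul1r.
Qed.

(** A rapidly converging subsequence has increments summable in L^1, so it converges almost
    everywhere; Fatou's lemma applied to the squared differences then shows that the whole sequence
    converges in L^2. *)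
Lemma riesz_fischer s : (forall j, L2 (s j)) ->
  (forall e, 0 < e -> exists K, forall i j, (K <= i)%N -> (K <= j)%N ->
     q (fun x => s i x - s j x) <= e) ->
  exists2 f, L2 f & L2cvg s f.
Proof.
move=> hs cauchy.
have ms j : measurable_fun D (s j) by case: (hs j).
pose P j k := forall i, (k <= i)%N -> q (fun x => s i x - s k x) <= 2^-1 ^+ j * 2^-1 ^+ j.
have [|k ki kP] := @subsequence_of P.
  move=> j i0; have e0 : 0 < (2^-1 : R) ^+ j * 2^-1 ^+ j.
    by rewrite mulr_gt0 // exprn_gt0 // invr_gt0.
  have [K hK] := cauchy _ e0; exists (maxn K i0.+1); first by rewrite leq_max ltnSn orbT.
  move=> i /=; rewrite geq_max => /andP[Ki _]; apply: hK => //.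
  exact: leq_maxl.
pose dif j x := s (k j.+1) x - s (k j) x.
have hdif j : L2 (dif j) by exact: L2B.
pose m := fine (mu D); have m0 : 0 <= m by exact: fine_ge0.
(* The pointwise bound [|t| <= t^2 / r + r] with [r = 2^-j] turns a squared distance of at most
   [r^2] into an L^1 bound [(1 + m) r]. *)
have difle j : Int (fun x => `|dif j x|) <= (1 + m) * 2^-1 ^+ j.
  pose r : R := 2^-1 ^+ j; have r0 : 0 < r by rewrite exprn_gt0 // invr_gt0.
  have [md rd] := hdif j.
  apply: (@le_trans _ _ (Int (fun x => r^-1 * dif j x ^+ 2 + r))).
    apply: le_Rintegral => //.
    - by apply: rint_norm => //; exact: L2_rint.
    - by apply: rintD => //; [exact: rintZ | exact: rint_cst].
    - move=> x _; rewrite -(ler_pM2l r0) mulrDr mulrA divff ?gt_eqF // mul1r.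
      rewrite -[dif j x ^+ 2]real_normK ?num_real //.
      by have := normr_ge0 (dif j x); nra.
  rewrite RintegralD //; [|exact: rintZ|exact: rint_cst].
  rewrite RintegralZl // Rintegral_cst // -/m.
  have le : Int (fun x => dif j x ^+ 2) <= r * r.
    have := kP j (k j.+1) (ltnW (ki _ _ (ltnSn j))).
    rewrite /iprod; under eq_Rintegral do rewrite -expr2; exact.
  have : r^-1 * Int (fun x => dif j x ^+ 2) <= r.
    by rewrite ler_pdivrMl.
  by rewrite -/r; lra.
have ae := @summable_norm_ae _ _ _ mu D mD dif (fun j => (1 + m) * 2^-1 ^+ j)
  ((1 + m) * 2) (fun j => L2_rint (hdif j)) difle _.
have {}ae : {ae mu, forall x, D x -> cvgn (series (fun j => `|dif j x|))}.
  apply: ae => K; rewrite -mulr_sumr ler_wpM2l ?addr_ge0 //; exact: sum_half_le.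
(* An upper limit, because it is measurable everywhere; outside the convergence set its value is
   immaterial. *)
pose f x := fine (limn_esup (fun j => (s (k j) x)%:E)).
have cf : {ae mu, forall x, D x -> (fun j => s (k j) x) @ \oo --> f x}.
  apply: filterS ae => x cx Dx.
  have c1 : cvgn (series (fun j => dif j x)) by exact/normed_cvg/(cx Dx).
  have c2 : (fun j => s (k j) x) @ \oo --> limn (series (fun j => dif j x)) + s (k 0%N) x.
    rewrite (_ : (fun j => s (k j) x) = fun j => series (fun i => dif i x) j + s (k 0%N) x).
      by apply: cvgD; [exact: c1 | exact: cvg_cst].
    apply/funext => j; rewrite /series /= /dif.
    by rewrite (telescope_sumr (fun i => s (k i) x)) // subrK.
  have c3 : (fun j => (s (k j) x)%:E) @ \oo -->
      (limn (series (fun j => dif j x)) + s (k 0%N) x)%:E.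
    by apply: cvg_EFin; first exact: nearW.
  by rewrite /f; have [_ ->] := cvg_limn_einf_sup c3.
have mf : measurable_fun D f.
  apply: measurableT_comp => //; apply: measurable_fun_limn_esup => j.
  exact/measurable_EFinP.
have ktoinf := increasing_infty ki.
have bound j c : (forall i, (j <= i)%N -> q (fun x => s (k i) x - s j x) <= c) ->
    L2 (fun x => f x - s j x) /\ q (fun x => f x - s j x) <= c.
  move=> hc; have mB : measurable_fun D (fun x => f x - s j x) by exact: measurable_funB.
  have [] := @fatou_ge0 _ _ _ mu D mD (fun i x => (s (k (i + j)%N) x - s j x) ^+ 2)
    (fun x => (f x - s j x) ^+ 2) c.
  - by move=> i; have [] := L2B (hs (k (i + j)%N)) (hs j).
  - exact: measurable_funX.
  - apply: filterS cf => x cf Dx; rewrite expr2; under eq_fun do rewrite expr2.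
    have h : (fun i => s (k (i + j)%N) x - s j x) @ \oo --> f x - s j x.
      apply: cvgB; last exact: cvg_cst.
      by rewrite (cvg_shiftn j (fun i => s (k i) x)); exact: cf.
    exact: cvgM.
  - by move=> i; apply: aeW => x _; exact: sqr_ge0.
  - move=> i; have := hc (i + j)%N (leq_addl _ _); rewrite /iprod.
    by under eq_Rintegral do rewrite -expr2.
  move=> r1 r2; split; first by split.
  by move: r2; rewrite /iprod; under [X in _ -> X <= _]eq_Rintegral do rewrite -expr2.
have kge i : (i <= k i)%N by elim: i => // i IH; exact: leq_ltn_trans IH (ki i i.+1 _).
have near e : 0 < e -> exists K, forall j, (K <= j)%N ->
    L2 (fun x => f x - s j x) /\ q (fun x => f x - s j x) <= e.
  move=> e0; have [K hK] := cauchy e e0; exists K => j Kj; apply: bound => i ji.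
  by apply: hK => //; exact: leq_trans Kj (leq_trans ji (kge i)).
have hf : L2 f.
  have [K hK] := near 1 ltr01; have [h _] := hK K (leqnn K).
  have := L2D h (hs K); congr L2; apply/funext => x; ring.
exists f => //; apply/cvgrPdist_le => e e0; have [K hK] := near e e0.
exists K => // j /= Kj; rewrite sub0r normrN ger0_norm ?iprod_ge0 //.
have [_] := hK j Kj; congr (_ <= _); apply: eq_Int => x _; ring.
Qed.

End SquareIntegrable.

(** * Lebesgue measure on R^n *)

Section InvariantMeasure.
Context d (T : measurableType d) (R : realType) (mu : {measure set T -> \bar R}).
Variables (phi : T -> T) (mphi : measurable_fun [set: T] phi).
Hypothesis mu_phi : forall A, measurable A -> mu (phi @^-1` A) = mu A.
Variables (D : set T) (f : T -> \bar R) (mD : measurable D).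

Lemma ge0_integral_invariant : measurable_fun D f -> (forall x, (0 <= f x)%E) ->
  (\int[mu]_(x in phi @^-1` D) f (phi x) = \int[mu]_(x in D) f x)%E.
Proof.
move=> mf f0; rewrite -(ge0_integral_pushforward mphi mu mD mf (fun x _ => f0 x)).
by apply: eq_measure_integral => A mA _; exact: mu_phi.
Qed.

Lemma integral_invariant : measurable_fun [set: T] f ->
  mu.-integrable (phi @^-1` D) (f \o phi) ->
  (\int[mu]_(x in phi @^-1` D) f (phi x) = \int[mu]_(x in D) f x)%E.
Proof.
move=> mf rf; rewrite -(integral_pushforward mphi mf rf mD).
by apply: eq_measure_integral => A mA _; exact: mu_phi.
Qed.

End InvariantMeasure.

Section LebesgueBasics.
Context (R : realType) (n : nat).
Local Notation V := 'rV[R]_n.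
(* The same carrier: topology and vector structure are on V, measurability on T. *)
Local Notation T := (caratheodory_type (@lebesgue_outer R n)).
Implicit Types (x y : V) (A : set V) (C : set (V * V)).

Lemma box_volume_ge0 (c : V * V) : (0 <= box_volume c)%E.
Proof. by rewrite lee_fin prodr_ge0 // => i _; rewrite le_max lexx. Qed.

Lemma lebesgue_outer_le_cover A C (f : V * V -> V * V) : countable C ->
  A `<=` \bigcup_(c in C) box (f c) ->
  (lebesgue_outer A <= \esum_(c in C) box_volume (f c))%E.
Proof.
move=> cC AC.
have [s sP] : {s : V * V -> V * V | forall d, (f @` C) d -> C (s d) /\ f (s d) = d}.
  exists (fun d => xget d [set c | C c /\ f c = d]) => d [c Cc fcd].
  by case: xgetP => [_ _ //|no]; have := no c; case.
apply: (@le_trans _ _ (\esum_(d in f @` C) box_volume d)%E).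
  apply: ereal_inf_lbound; exists (f @` C) => //; split.
    exact: sub_countable (card_image_le f C) cC.
  by move=> x /AC[c Cc bx]; exists (f c) => //; exists c.
have sbij : set_bij (f @` C) (s @` (f @` C)) s.
  split; [by move=> d fd; exists d| |by move=> _ [d fd <-]; exists d].
  by move=> d d' /set_mem fd /set_mem fd' e; rewrite -(proj2 (sP _ fd)) e (proj2 (sP _ fd')).
rewrite -[leLHS](_ : \esum_(c in s @` (f @` C)) box_volume (f c) = _)%E; last first.
  rewrite (reindex_esum _ _ _ _ sbij); apply: eq_esum => d fd.
  by rewrite (proj2 (sP _ fd)).
rewrite esum_mkcond [leRHS]esum_mkcond; apply: le_esum => c _.
case: ifPn => [/set_mem[d fd <-]|_].
  by rewrite ifT //; apply/mem_set; exact: (proj1 (sP _ fd)).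
by case: ifP => // _; exact: box_volume_ge0.
Qed.

Definition upd x (i : 'I_n) (t : R) : V := \row_j (if j == i then t else x 0 j).

(** The cut of a box by the hyperplane of height [t] in direction [i]. With [min] and [max] it also
    covers a hyperplane that misses the box: one piece then has volume 0. *)
Lemma box_volume_split (c : V * V) i (t : R) :
  box_volume c = (box_volume (c.1, upd c.2 i (Num.min (c.2 0 i) t)%R) +
    box_volume (upd c.1 i (Num.max (c.1 0 i) t)%R, c.2))%E.
Proof.
rewrite /box_volume -EFinD; congr EFin; rewrite /=.
rewrite (bigD1 i) //= [in RHS](bigD1 i) //= [in X in _ = _ + X](bigD1 i) //= !mxE eqxx.
have e1 : \prod_(j < n | j != i)
    Num.max 0 (upd c.2 i (Num.min (c.2 0 i) t) 0 j - c.1 0 j) =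
    \prod_(j < n | j != i) Num.max 0 (c.2 0 j - c.1 0 j).
  by apply: eq_bigr => j ji; rewrite mxE (negbTE ji).
have e2 : \prod_(j < n | j != i)
    Num.max 0 (c.2 0 j - upd c.1 i (Num.max (c.1 0 i) t) 0 j) =
    \prod_(j < n | j != i) Num.max 0 (c.2 0 j - c.1 0 j).
  by apply: eq_bigr => j ji; rewrite mxE (negbTE ji).
rewrite e1 e2 -mulrDl; congr (_ * _).
move: (c.1 0 i) (c.2 0 i) => a b; rewrite minEle !maxEle.
by case: (leP b t) => h1; case: (leP a t) => h2; rewrite ?h1 ?h2;
  do ?[case: leP => ?]; lra.
Qed.

(** Caratheodory's criterion: cutting every box of a cover along the hyperplane gives covers of the
    two parts with the same total volume. *)
Lemma halfspace_measurable (i : 'I_n) (t : R) :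
  measurable ([set x : V | x 0 i <= t] : set T).
Proof.
apply: le_caratheodory_measurable => X.
apply: le_ereal_inf_tmp => _ [C [cC XC] <-].
rewrite (eq_esum (fun c _ => box_volume_split c i t)).
rewrite esumD; [|by move=> *; exact: box_volume_ge0|by move=> *; exact: box_volume_ge0].
apply: leeD.
  apply: (@lebesgue_outer_le_cover _ C (fun c => (c.1, upd c.2 i (Num.min (c.2 0 i) t)))) => //.
  move=> x [/XC[c Cc bx] /= xt]; exists c => // j /=; rewrite mxE.
  have /andP[-> ub] /= := bx j; case: eqP => [ji|//].
  by rewrite le_min -{1}ji ub ji.
apply: (@lebesgue_outer_le_cover _ C (fun c => (upd c.1 i (Num.max (c.1 0 i) t), c.2))) => //.
move=> x [/XC[c Cc bx] /= /negP]; rewrite -ltNge => xt; exists c => // j /=; rewrite mxE.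
have /andP[lb ->] /= := bx j; case: eqP => [ji|]; last by rewrite lb.
by rewrite gt_max -{1}ji lb ji xt.
Qed.

Lemma halfspace_lt_measurable (i : 'I_n) (t : R) :
  measurable ([set x : V | t < x 0 i] : set T).
Proof.
have -> : [set x : V | t < x 0 i] = ~` [set x : V | x 0 i <= t].
  by apply/seteqP; split=> x /=; rewrite ltNge => /negP.
exact/measurableC/halfspace_measurable.
Qed.

Lemma box_measurable (c : V * V) : measurable (box c : set T).
Proof.
have -> : box c = \bigcap_(i in [set: 'I_n])
    ([set x : V | c.1 0 i < x 0 i] `&` [set x : V | x 0 i <= c.2 0 i]).
  apply/seteqP; split=> [x bx i _|x bx i] /=.
    by have /andP[] := bx i.
  by have [|/= -> ->] := bx i.
apply: fin_bigcap_measurable => // i _.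
by apply: measurableI; [exact: halfspace_lt_measurable | exact: halfspace_measurable].
Qed.

Lemma lebesgue_box (c : V * V) : (lebesgue R n (box c) <= box_volume c)%E.
Proof.
rewrite -[leRHS]esum_set1 ?box_volume_ge0 //.
apply: (@lebesgue_outer_le_cover _ [set c] id) => //.
by move=> x bx; exists c.
Qed.

Lemma open_lebesgue_measurable A : open A -> measurable (A : set T).
Proof.
move=> oA.
(* The countably many cubes with rational centre and half-side [1 / (k + 1)]; an open set is the
   union of those it contains. *)
pose Q (d : 'rV[rat]_n * nat) : set V :=
  [set x | forall i, ratr (d.1 0 i) - d.2.+1%:R^-1 < x 0 i <= ratr (d.1 0 i) + d.2.+1%:R^-1].
have QE d : Q d = box (\row_i (ratr (d.1 0 i) - d.2.+1%:R^-1), \row_i (ratr (d.1 0 i) + d.2.+1%:R^-1)).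
  by apply/seteqP; split=> x h i; have := h i; rewrite /= !mxE.
have -> : A = \bigcup_(d in [set: 'rV[rat]_n * nat]) (if `[< Q d `<=` A >] then Q d else set0).
  apply/seteqP; split=> x; last first.
    by case=> d _; case: asboolP => // QA /QA.
  move=> Ax; have /nbhs_ballP[e /= e0 eA] := open_nbhs_nbhs (conj oA Ax).
  (* Two points of such a cube are at maximum distance at most twice its half-side, which must stay
     below [e]. *)
  have [k hk] : exists k, (k.+1%:R^-1 : R) < e / 2.
    by have := near_infty_natSinv_lt (PosNum (ltac:(lra) : 0 < e / 2)) => /filter_ex.
  have near i : exists q : rat, x 0 i - k.+1%:R^-1 < ratr q < x 0 i + k.+1%:R^-1.
    have lt : x 0 i - k.+1%:R^-1 < x 0 i + k.+1%:R^-1.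
      have : 0 < k.+1%:R^-1 :> R by rewrite invr_gt0.
      by move: (k.+1%:R^-1) => q; lra.
    by have [q] := rat_in_itvoo lt; rewrite in_itv /=; exists q.
  have [q hq] := choice near.
  exists (\row_i q i, k) => //; case: asboolP.
    by move=> _ i; rewrite /= mxE; have /andP[] := hq i; move: (k.+1%:R^-1) => r; lra.
  case=> y Qy; apply: eA; split=> // i j; rewrite ord1 /ball /=.
  have := Qy j; rewrite /= mxE => /andP[]; have /andP[] := hq j.
  move: (k.+1%:R^-1) hk => r hk; rewrite ltr_norml.
  by move=> *; apply/andP; split; lra.
apply: countable_bigcupT_measurable; first exact: countableP.
move=> d; case: ifP => _; last exact: measurable0.
by rewrite QE; exact: box_measurable.
Qed.

Lemma continuous_lebesgue_measurable (f : V -> R) :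
  continuous (f : V -> R^o) -> measurable_fun [set: T] (f : T -> R).
Proof.
move=> cf; apply: (measurability _ (RGenOInfty.measurableE R)) => _ [_ [t ->] <-].
rewrite setTI; apply: open_lebesgue_measurable.
by apply: open_comp => [x _|]; [exact: cf | exact: interval_open].
Qed.

Lemma coord_le_norm x i : `|x 0 i| <= `|x|.
Proof.
rewrite [leRHS]/Num.norm /= mx_normrE.
exact: (le_bigmax _ (fun k : 'I_1 * 'I_n => `|x k.1 k.2|) (0, i)).
Qed.

Lemma lebesgue_bounded_lty A : bounded_set A -> (lebesgue R n A < +oo)%E.
Proof.
rewrite /bounded_set /bounded_near => /pinfty_ex_gt0[M _ /= hM].
pose c : V * V := (const_mx (- M - 1), const_mx (M + 1)).
apply: (@le_lt_trans _ _ (box_volume c)); last by rewrite /box_volume ltry.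
apply: le_trans (lebesgue_box c); apply: le_outer_measure => x Ax i.
rewrite !mxE; have := hM x Ax; have := coord_le_norm x i.
by rewrite ler_norml => /andP[] *; apply/andP; split; lra.
Qed.

Lemma lebesgue_translate A y : lebesgue R n [set x | A (x + y)] = lebesgue R n A.
Proof.
have le (B : set V) (v : V) :
    (lebesgue_outer [set x : V | B (x + v)%R] <= lebesgue_outer B)%E.
  apply: le_ereal_inf_tmp => _ [C [cC BC] <-].
  rewrite (_ : (\esum_(c in C) box_volume c = \esum_(c in C) box_volume (c.1 - v, c.2 - v)%R)%E); last first.
    apply: eq_esum => c _; rewrite /box_volume; congr EFin; apply: eq_bigr => i _ /=.
    by rewrite !mxE; congr Num.max; ring.
  apply: lebesgue_outer_le_cover => // x /BC[c Cc bx]; exists c => // i /=.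
  by have := bx i; rewrite !mxE; lra.
apply/eqP; rewrite eq_le; apply/andP; split; first exact: le.
apply: le_trans (le _ (- y)); rewrite le_eqVlt; apply/orP; left; apply/eqP.
by congr lebesgue_outer; apply/seteqP; split => x /=; rewrite subrK.
Qed.

Lemma translate_measurable A y : measurable (A : set T) ->
  measurable ([set x | A (x + y)] : set T).
Proof.
move=> mA; suff : caratheodory_measurable (@lebesgue_outer R n) [set x | A (x + y)] by [].
move=> X; have : caratheodory_measurable (@lebesgue_outer R n) A by exact: mA.
move=> /(_ [set x | X (x - y)]) /= h.
have XE : X = [set x : V | [set z | X (z - y)] (x + y)].
  by apply/seteqP; split=> x /=; rewrite addrK.
have XAE : X `&` [set x | A (x + y)] =
    [set x : V | ([set z | X (z - y)] `&` A) (x + y)].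
  by apply/seteqP; split=> x /=; rewrite addrK.
have XCE : X `&` ~` [set x | A (x + y)] =
    [set x : V | ([set z | X (z - y)] `&` ~` A) (x + y)].
  by apply/seteqP; split=> x /=; rewrite addrK.
rewrite [in LHS]XE XAE XCE.
have := lebesgue_translate [set z | X (z - y)] y.
have := lebesgue_translate ([set z | X (z - y)] `&` A) y.
have := lebesgue_translate ([set z | X (z - y)] `&` ~` A) y.
by rewrite /lebesgue => -> -> ->.
Qed.

Lemma translate_measurable_fun y : measurable_fun [set: T] ((fun x : V => x + y) : T -> T).
Proof. by move=> _ A mA; rewrite setTI; exact: translate_measurable. Qed.

Lemma lebesgue_complete : measure_is_complete (lebesgue R n).
Proof. exact: measure_is_complete_caratheodory. Qed.

Lemma integral_translate (D : set T) (f : T -> \bar R) y : measurable D ->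
  measurable_fun D f -> (forall x, (0 <= f x)%E) ->
  (\int[lebesgue R n]_(x in [set x : V | D (x + y)%R]) f ((x : V) + y)%R =
   \int[lebesgue R n]_(x in D) f x)%E.
Proof.
move=> mD mf f0.
exact: (ge0_integral_invariant (translate_measurable_fun y)
  (fun A _ => lebesgue_translate A y) mD mf f0).
Qed.

End LebesgueBasics.

(** * Poincare inequality and compactness of the embedding of H^1_0 in L^2 *)

Section CompactlySupported.
Context (R : realType) (n : nat).
Local Notation V := 'rV[R]_n.
Local Notation T := (caratheodory_type (@lebesgue_outer R n)).
Local Notation mu := (lebesgue R n).
Local Notation Int f := (Rintegral mu [set: T] f).
Local Notation q f := (Int (fun x => f x ^+ 2)).
Implicit Types (f g : V -> R) (x y : V) (i : 'I_n) (r c t h M : R).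

(** Continuity with compact support, phrased through a bound on the points where [f] is nonzero,
    which passes directly to translates and differences. *)
Definition cc f := continuous (f : V -> R^o) /\
  exists r, forall x, f x != 0 -> `|x| <= r.

Lemma cc_bounded f : cc f -> exists2 M, 0 <= M & forall x, `|f x| <= M.
Proof.
move=> [cf [r fr]].
have [M [_ hM]] : bounded_set ((f : V -> R^o) @` closed_ball_ (fun x => `|x|) 0 r).
  apply: compact_bounded; apply: continuous_compact.
    by apply: continuous_subspaceT => x; exact: cf.
  apply: bounded_closed_compact; last exact: closed_closed_ball_.
  exists r; split; first exact: num_real.
  by move=> M rM x; rewrite /closed_ball_ /= sub0r normrN => /le_trans; apply; exact: ltW.
exists (Num.max 0 (M + 1)) => [|x]; first by rewrite le_max lexx.
have [->|fx] := eqVneq (f x) 0; first by rewrite normr0 le_max lexx.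
rewrite le_max; apply/orP; right; apply: (hM (M + 1)); first by rewrite ltrDl.
by exists x => //; rewrite /closed_ball_ /= sub0r normrN fr.
Qed.

Lemma cc_measurable f : cc f -> measurable_fun [set: T] (f : T -> R).
Proof. by move=> [cf _]; exact: continuous_lebesgue_measurable. Qed.

(** Boxes are open on their lower sides; the margin 1 makes this one contain the closed ball of
    radius [r] in the maximum norm. *)
Definition cube r : set T := box (const_mx (- r - 1), const_mx (r + 1) : V).

Lemma cube_measurable r : measurable (cube r).
Proof. exact: box_measurable. Qed.

Lemma cube_norm r x : `|x| <= r -> cube r x.
Proof.
move=> xr i; rewrite !mxE; have := coord_le_norm x i.
by rewrite ler_norml => /andP[] *; apply/andP; split; lra.
Qed.

Lemma box_lty (c : V * V) : (mu (box c) < +oo)%E.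
Proof. exact: le_lt_trans (lebesgue_box c) (ltry _). Qed.

Lemma rint_supported f r M : measurable_fun [set: T] (f : T -> R) ->
  (forall x, f x != 0 -> `|x| <= r) -> (forall x, `|f x| <= M) ->
  rint mu [set: T] f.
Proof.
move=> mf fr fM.
have mc := cube_measurable r.
have rc : rint mu (cube r) f.
  apply: (rint_le mc _ (rint_cst mc (box_lty _) M)).
    exact: measurable_funS mf.
  by move=> x _; apply: le_trans (fM x) _; exact: ler_norm.
have /(integrable_mkcond _ mc) := rc; congr integrable.
apply/funext => x; rewrite patchE; case: ifPn => // /negP xc.
have [fx|fx] := eqVneq (f x) 0; first by rewrite /= fx.
exfalso; apply/xc/mem_set.
exact/cube_norm/fr.
Qed.

Lemma cc_rint f : cc f -> rint mu [set: T] f.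
Proof.
move=> cf; have [M M0 hM] := cc_bounded cf; have [_ [r hr]] := cf.
exact: rint_supported (cc_measurable cf) hr hM.
Qed.

Lemma cc_sqr f : cc f -> cc (fun x => f x ^+ 2).
Proof.
move=> [cf [r fr]]; split.
  have -> : (fun x => f x ^+ 2) = f \* f by apply/funext => x; rewrite expr2.
  by move=> x; exact: (cvgM (cf x) (cf x)).
by exists r => x; rewrite sqrf_eq0; exact: fr.
Qed.

Lemma ccZ t f : cc f -> cc (fun x => t * f x).
Proof.
move=> [cf [r fr]]; split; first by move=> x; exact: (cvgMl_tmp (cf x)).
by exists r => x; rewrite mulf_eq0 negb_or => /andP[_]; exact: fr.
Qed.

Lemma ccB f g : cc f -> cc g -> cc (fun x => f x - g x).
Proof.
move=> [cf [r fr]] [cg [r' gr]]; split; first by move=> x; exact: (cvgB (cf x) (cg x)).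
exists (Num.max r r') => x; rewrite le_max.
have [f0|f0] := eqVneq (f x) 0; last by rewrite fr.
by rewrite f0 sub0r oppr_eq0 => /gr ->; rewrite orbT.
Qed.

Lemma cc_translate f y : cc f -> cc (fun x => f (x + y)).
Proof.
move=> [cf [r fr]]; split.
  move=> x; apply: (@continuous_comp _ _ _ (fun x : V => x + y) (f : V -> R^o)).
    by refine (@cvgD R V V (nbhs x) _ id (fun=> y) x y _ _); [exact: cvg_id|exact: cvg_cst].
  exact: cf.
exists (r + `|y|) => x /fr h; rewrite -[x](addrK y).
by apply: le_trans (ler_normB _ _) _; rewrite lerD2r.
Qed.

Lemma Int_translate f y : cc f -> (forall x, 0 <= f x) ->
  Int (fun x => f (x + y)) = Int f.
Proof.
move=> cf f0; rewrite /Rintegral; congr fine.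
have := @integral_translate R n setT (fun x => (f x)%:E) y measurableT.
apply; last by move=> x; rewrite lee_fin.
exact/measurable_EFinP/cc_measurable.
Qed.

Lemma sqr_sum_le (a : nat -> R) N :
  (\sum_(0 <= j < N) a j) ^+ 2 <= N%:R * \sum_(0 <= j < N) a j ^+ 2.
Proof.
elim: N => [|N IH]; first by rewrite !big_nil expr0n mulr0.
rewrite !big_nat_recr //=.
set A := \sum_(0 <= i < N) a i in IH *; set B := \sum_(0 <= i < N) a i ^+ 2 in IH *.
have [N0|N0] := posnP N.
  rewrite /A /B N0 !big_nil mul1r !add0r //.
have Np : 0 < N%:R :> R by rewrite ltr0n.
have : 0 <= (A - N%:R * a N) ^+ 2 by exact: sqr_ge0.
have -> : (A - N%:R * a N) ^+ 2 = A ^+ 2 - 2 * N%:R * A * a N + N%:R ^+ 2 * a N ^+ 2 by ring.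
move=> h; have B0 : A ^+ 2 / N%:R <= B by rewrite ler_pdivrMr // mulrC.
have h2 : 2 * A * a N <= A ^+ 2 / N%:R + N%:R * a N ^+ 2.
  have e1 : N%:R * (A ^+ 2 / N%:R) = A ^+ 2 by rewrite mulrC divfK // gt_eqF.
  rewrite -(ler_pM2l Np) mulrDr e1.
  by apply: (@le_trans _ _ (2 * N%:R * A * a N)); [rewrite le_eqVlt; apply/orP; left; apply/eqP; ring|lra].
by rewrite -natr1; lra.
Qed.

Section DirectionalDerivative.
Variables (f : V -> R) (i : 'I_n).
Hypotheses (cf : cc f) (cdf : cc (partial i f)).
Hypothesis df : forall x, derivable (f : V -> R^o) x (delta_mx 0 i).
Local Notation e := (delta_mx 0 i : V).

Lemma line_derive x t : is_derive t 1 (fun s : R => f (x + s *: e) : R^o)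
  (partial i f (x + t *: e)).
Proof.
have cv : (fun h : R => h^-1 *: (((fun s : R => f (x + s *: e) : R^o) \o shift t) (h *: 1) -
    (fun s : R => f (x + s *: e) : R^o) t)) =
  (fun h : R => h^-1 *: (((f : V -> R^o) \o shift (x + t *: e)) (h *: e) - f (x + t *: e))).
  apply/funext => h /=; congr (_ *: (f _ - _)).
  by rewrite addrCA; congr (_ + _); rewrite -scalerDl; congr (_ *: _); rewrite /GRing.scale /= mulr1.
by apply: DeriveDef; rewrite /derivable /derive ?cv; [exact: df|].
Qed.

Lemma mean_value x t : 0 <= t -> exists2 s, 0 <= s <= t &
  f (x + t *: e) - f x = t * partial i f (x + s *: e).
Proof.
move=> t0.
have [||s] := @MVT_segment R (fun s => f (x + s *: e)) (fun s => partial i f (x + s *: e)) 0 t t0.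
- by move=> s _; exact: line_derive.
- apply: continuous_subspaceT => s.
  apply: (@continuous_comp _ _ _ (fun s : R => x + s *: e) (f : V -> R^o)).
    refine (@cvgD R V R (nbhs s) _ (fun=> x) (fun s : R => s *: e) x (s *: e) _ _).
      exact: cvg_cst.
    by refine (@cvgZr_tmp R V R (nbhs s) _ id s e _); exact: cvg_id.
  exact: (proj1 cf).
rewrite in_itv /= => st; rewrite scale0r addr0 subr0 mulrC => ->.
by exists s.
Qed.

Lemma difference_bound M x t : (forall x, `|partial i f x| <= M) -> 0 <= t ->
  `|f (x + t *: e) - f x| <= t * M.
Proof.
move=> hM t0; have [s _ ->] := mean_value x t0.
by rewrite normrM (ger0_norm t0) ler_wpM2l.
Qed.

(** The increment telescopes over [N] equal steps, all of the same L^2 norm by translation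
    invariance; [sqr_sum_le] costs one factor [N] and the number of steps the other. *)
Lemma difference_subdivide h N : 0 <= h -> (0 < N)%N ->
  q (fun x => f (x + h *: e) - f x) <=
  N%:R ^+ 2 * q (fun x => f (x + (h / N%:R) *: e) - f x).
Proof.
move=> h0 N0; pose p j x : R := f (x + (j%:R * (h / N%:R)) *: e).
have ccp j : cc (p j) by exact: cc_translate.
have ccd j : cc (fun x => p j.+1 x - p j x) by exact: ccB.
have NN : N%:R != 0 :> R by rewrite pnatr_eq0 -lt0n.
have tel x : f (x + h *: e) - f x = \sum_(0 <= j < N) (p j.+1 x - p j x).
  rewrite (telescope_sumr (fun j => p j x)) // /p mul0r scale0r addr0.
  by rewrite mulrCA divff // mulr1.
have qE j : q (fun x => p j.+1 x - p j x) = q (fun x => f (x + (h / N%:R) *: e) - f x).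
  have -> : (fun x : T => (p j.+1 x - p j x) ^+ 2) =
    fun x => (fun x : V => (f (x + (h / N%:R) *: e) - f x) ^+ 2) (x + (j%:R * (h / N%:R)) *: e).
    apply/funext => x; rewrite /p -natr1 mulrDl mul1r scalerDl.
    by rewrite addrA.
  apply: (@Int_translate (fun x : V => (f (x + (h / N%:R) *: e) - f x) ^+ 2)).
    by apply: cc_sqr; apply: ccB => //; exact: cc_translate.
  by move=> x; exact: sqr_ge0.
have sumE K : Int (fun x => \sum_(0 <= j < K) (p j.+1 x - p j x) ^+ 2) =
    \sum_(0 <= j < K) q (fun x => p j.+1 x - p j x) /\
    rint mu [set: T] (fun x => \sum_(0 <= j < K) (p j.+1 x - p j x) ^+ 2).
  elim: K => [|K [IH1 IH2]].
    rewrite big_nil; split.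
      by under eq_Rintegral do rewrite big_nil; rewrite Rintegral_cst // mul0r.
    apply: (@eq_rint _ T R mu setT measurableT (fun x => p 0%N x - p 0%N x)).
      by move=> x _; rewrite big_nil subrr.
    by apply: cc_rint; exact: ccB.
  have rK := cc_rint (cc_sqr (ccd K)); split.
    rewrite big_nat_recr //= -IH1 -RintegralD //.
    by apply: eq_Int => x _; rewrite big_nat_recr.
  apply: (@eq_rint _ T R mu setT measurableT _ _ _ (rintD measurableT IH2 rK)).
  by move=> x _; rewrite big_nat_recr.
have [sN rN] := sumE N.
apply: (@le_trans _ _ (Int (fun x => N%:R * \sum_(0 <= j < N) (p j.+1 x - p j x) ^+ 2))).
  apply: le_Rintegral => //.
  - by apply: cc_rint; apply: cc_sqr; apply: ccB => //; exact: cc_translate.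
  - exact: rintZ.
  - by move=> x _; rewrite tel; exact: sqr_sum_le.
rewrite RintegralZl // sN (eq_bigr (fun=> q (fun x => f (x + (h / N%:R) *: e) - f x))) //.
by rewrite sumr_const_nat subn0 -[X in _ * X]mulr_natl mulrA -expr2.
Qed.

(** Dominated convergence: the mean value theorem bounds the integrands by [(h * M) ^+ 2], and they
    all vanish outside one cube. *)
Lemma difference_quotient_cvg h : 0 <= h ->
  (fun N => N.+1%:R ^+ 2 * q (fun x => f (x + (h / N.+1%:R) *: e) - f x)) @ \oo -->
  h ^+ 2 * q (partial i f).
Proof.
move=> h0; have [M M0 hM] := cc_bounded cdf.
have [_ [r fr]] := cf; have [_ [r' dfr]] := cdf.
pose F (N : nat) (x : V) : R := N.+1%:R ^+ 2 * (f (x + (h / N.+1%:R) *: e) - f x) ^+ 2.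
pose F0 (x : V) : R := h ^+ 2 * partial i f x ^+ 2.
have ccF N : cc (F N).
  by apply: ccZ; apply: cc_sqr; apply: ccB => //; exact: cc_translate.
have ccF0 : cc F0 by apply: ccZ; exact: cc_sqr.
have hN N : 0 <= h / N.+1%:R by rewrite divr_ge0.
have FM N x : F N x <= (h * M) ^+ 2.
  rewrite /F -exprMn -[X in X <= _]real_normK ?num_real // normrM ger0_norm ?ler0n //.
  rewrite lerXn2r ?nnegrE ?mulr_ge0 //.
  apply: le_trans (ler_wpM2l (ler0n _ _) (difference_bound x hM (hN N))) _.
  by rewrite mulrA mulrCA divff ?pnatr_eq0 // mulr1.
have Fsupp N x : F N x != 0 -> `|x| <= r + h * `|e|.
  have [f0|f0] := eqVneq (f x) 0; last first.
    by move=> _; apply: le_trans (fr _ f0) _; rewrite lerDl mulr_ge0.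
  rewrite /F f0 subr0 mulf_eq0 negb_or !sqrf_eq0 => /andP[_ h1].
  have le := fr _ h1.
  rewrite -[x](addrK ((h / N.+1%:R) *: e)); apply: le_trans (ler_normB _ _) _.
  apply: lerD => //; rewrite normrZ ger0_norm //; apply: ler_wpM2r => //.
  by rewrite ler_pdivrMr ?ltr0n // ler_peMr // ler1n.
have F_ge0 N x : 0 <= F N x by rewrite mulr_ge0 // sqr_ge0.
pose g : V -> R := \1_(cube (r + h * `|e|)).
have mg : measurable_fun [set: T] (g : T -> R).
  by apply: measurable_indic; exact: cube_measurable.
pose gM (x : T) : R := (h * M) ^+ 2 * g x.
have rgM : rint mu [set: T] gM.
  have mc := cube_measurable (r + h * `|e|).
  apply: rintZ => //; rewrite /g.
  have := rint_cst mc (box_lty _) (1 : R); rewrite /rint => /(integrable_mkcond _ mc).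
  congr integrable; apply/funext => x; rewrite patchE /= /indic.
  by case: ifP.
have [] := @dominated_convergence _ _ _ mu setT measurableT
  (fun N x => (F N x)%:E) (fun x => (F0 x)%:E) (EFin \o gM).
- by move=> N; exact/measurable_EFinP/cc_measurable.
- exact/measurable_EFinP/cc_measurable.
- apply: aeW => x0 _; apply: cvg_EFin; first exact: nearW.
  pose x : V := x0; rewrite -/x.
  have FE : (fun N => F N x) = (fun N => (N.+1%:R * (f (x + (h / N.+1%:R) *: e) - f x)) ^+ 2).
    by apply/funext => N; rewrite /F exprMn.
  suff lim : (fun N => N.+1%:R * (f (x + (h / N.+1%:R) *: e) - f x)) @ \oo --> h * partial i f x.
    rewrite (_ : fine \o _ = fun N => F N x) // FE /F0 -exprMn expr2.
    by under eq_fun do rewrite expr2; exact: cvgM.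
  (* The derivative is a limit over punctured neighbourhoods of 0, so the zero step is treated
     apart. *)
  have [->|hne] := eqVneq h 0.
    rewrite mul0r (_ : (fun N => _) = fun=> 0); first exact: cvg_cst.
    by apply/funext => N; rewrite mul0r scale0r addr0 subrr mulr0.
  have lin : (fun t : R => t^-1 *: (((f : V -> R^o) \o shift x) (t *: e) - f x)) @ 0^' -->
    partial i f x := @df x.
  have tn0 N : h / N.+1%:R != 0 by rewrite mulf_neq0 // invr_eq0 pnatr_eq0.
  have tnc : (fun N => h / N.+1%:R) @ \oo --> 0.
    by rewrite -(mulr0 h); apply: cvgMl_tmp; exact: cvg_harmonic.
  have tnd : (fun N => h / N.+1%:R) @ \oo --> 0^'.
    move=> P P0; have := tnc _ P0; rewrite /nbhs /= => h1.
    by apply: filterS h1 => N /= H; exact: H (tn0 N).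
  have lim2 := cvgMl_tmp (a := h) (@cvg_comp _ _ _ _ _ _ _ _ tnd lin).
  rewrite (_ : (fun N => _) = (fun N => h * ((h / N.+1%:R)^-1 *:
    (((f : V -> R^o) \o shift x) ((h / N.+1%:R) *: e) - f x)))); first exact: lim2.
  apply/funext => N /=.
  rewrite /GRing.scale /= mulrA (addrC _ x); congr (_ * _).
  by rewrite invf_div mulrCA divff // mulr1.
- exact: rgM.
- apply: aeW => x N _; rewrite gee0_abs ?lee_fin // /gM /g.
  have [f0|f0] := eqVneq (F N x) 0.
    by rewrite f0 mulr_ge0 ?sqr_ge0 // indicE ler0n.
  rewrite indicE mem_set ?mulr1 //; exact/cube_norm/(Fsupp N).
move=> _ _ h3.
have E1 u : cc u -> (\int[mu]_x (u x)%:E)%E = (Int u)%:E.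
  by move=> cu; rewrite rint_integral //; exact: cc_rint.
rewrite E1 // in h3.
have := fine_cvg h3; rewrite /F0 RintegralZl //; last exact: cc_rint (cc_sqr cdf).
move=> h4; rewrite (_ : (fun N => _) = fun N => fine (\int[mu]_x (F N x)%:E)%E); first exact: h4.
apply/funext => N; rewrite E1 //= /F RintegralZl //; apply: cc_rint; apply: cc_sqr.
by apply: ccB => //; exact: cc_translate.
Qed.

(** The left side is bounded by the subdivided increments for every [N], and these tend to the right
    side. This takes the place of integrating the derivative along lines. *)
Lemma translate_estimate h : 0 <= h ->
  q (fun x => f (x + h *: e) - f x) <= h ^+ 2 * q (partial i f).
Proof.
move=> h0; apply: (cvgr_to_ge (difference_quotient_cvg h0)).
by apply: nearW => N; exact: difference_subdivide.
Qed.

(** A shift by [h = 2 r + 1] exceeds the width of the support, so [f] and its translate have product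
    0 and the squared norm of their difference is twice that of [f]. *)
Lemma poincare r : 0 <= r -> (forall x, f x != 0 -> `|x| <= r) ->
  2 * q f <= (2 * r + 1) ^+ 2 * q (partial i f).
Proof.
move=> r0 fr; pose h := 2 * r + 1; have h0 : 0 <= h by rewrite /h; lra.
apply: le_trans (translate_estimate h0).
have ct : cc (fun x => f (x + h *: e)) by exact: cc_translate.
have prod0 x : f (x + h *: e) * f x = 0.
  apply/eqP; rewrite mulf_eq0; apply: contraT; rewrite negb_or => /andP[n1 n2].
  have := fr _ n1; have := fr _ n2 => l1 l2.
  have := le_trans (coord_le_norm _ i) l1; have := le_trans (coord_le_norm _ i) l2.
  rewrite !mxE !eqxx mulr1 !ler_norml /h => /andP[a1 a2] /andP[a3 a4]; lra.
have -> : q (fun x => f (x + h *: e) - f x) = q (fun x => f (x + h *: e)) + q f.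
  rewrite -RintegralD //; [|exact: cc_rint (cc_sqr ct)|exact: cc_rint (cc_sqr cf)].
  by apply: eq_Int => x _; rewrite sqrrB prod0 mul0rn subr0.
rewrite (@Int_translate (fun x => f x ^+ 2)); [lra|exact: cc_sqr|].
by move=> x; exact: sqr_ge0.
Qed.

End DirectionalDerivative.

End CompactlySupported.

(** * Cell averages under bisection *)

Section Cells.
Context (R : realType) (n : nat).
Local Notation V := 'rV[R]_n.
Local Notation T := (caratheodory_type (@lebesgue_outer R n)).
Local Notation mu := (lebesgue R n).
Local Notation Int D f := (Rintegral mu D f).
Implicit Types (f g : V -> R) (a l x y : V) (i j : 'I_n) (r c t h M : R).

Definition cell a l : set T := box (a, a + l).

Lemma cellP a l x : cell a l x <-> forall j, a 0 j < x 0 j <= a 0 j + l 0 j.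
Proof. by split=> h j; have := h j; rewrite /= mxE. Qed.

Lemma cell_measurable a l : measurable (cell a l).
Proof. exact: box_measurable. Qed.

Lemma cell_lty a l : (mu (cell a l) < +oo)%E.
Proof. exact: box_lty. Qed.

(** The common volume of all cells of sides [l], by translation invariance ([mu_cell]). *)
Definition mcell l : R := fine (mu (cell 0 l)).

Lemma cell_translate a l y : [set x : V | cell (a + y) l (x + y)] = cell a l.
Proof.
by apply/seteqP; split=> x /cellP h; apply/cellP => j; have := h j; rewrite !mxE; lra.
Qed.

Lemma mu_cell a l : fine (mu (cell a l)) = mcell l.
Proof.
rewrite /mcell; congr fine; rewrite -[in LHS](add0r a) -(lebesgue_translate (cell (0 + a) l) a).
by rewrite cell_translate.
Qed.

Lemma cc_rintS (D : set T) f : measurable D -> cc f -> rint mu D f.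
Proof. by move=> mD cf; apply: (integrableS measurableT) => //; exact: cc_rint. Qed.

Lemma cc_L2 (D : set T) f : measurable D -> cc f -> L2 mu D f.
Proof.
move=> mD cf; split; last exact/cc_rintS/cc_sqr.
by apply: measurable_funS (cc_measurable cf).
Qed.

Lemma Int_translateS (D : set T) f y : measurable D -> cc f ->
  Int [set x : V | D (x + y)] (fun x => f (x + y)) = Int D f.
Proof.
move=> mD cf; rewrite /Rintegral; congr fine.
have mDy := translate_measurable y mD.
have mf : measurable_fun [set: T] (EFin \o f) by exact/measurable_EFinP/cc_measurable.
have rf : mu.-integrable ((fun x : T => (x : V) + y : T) @^-1` D)
    ((EFin \o f) \o (fun x : T => (x : V) + y)) by exact: (cc_rintS mDy (cc_translate y cf)).
exact: (integral_invariant (translate_measurable_fun y)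
  (fun A _ => lebesgue_translate A y) mD mf rf).
Qed.

Definition half i l : V := (l 0 i / 2) *: delta_mx 0 i.
Definition halve i l : V := upd l i (l 0 i / 2).

Lemma cell_split i a l : 0 <= l 0 i ->
  cell a l = cell a (halve i l) `|` cell (a + half i l) (halve i l).
Proof.
move=> l0; apply/seteqP; split=> x.
  move=> /cellP h; have := h i; case: (leP (x 0 i) (a 0 i + l 0 i / 2)) => le hi.
    left; apply/cellP => j; have := h j; rewrite !mxE.
    by case: eqP => [->|//]; rewrite (andP (h i)).1 le.
  right; apply/cellP => j; have := h j; rewrite !mxE eqxx.
  by case: eqP => [->|_] //=; move: le (h i); rewrite ?mulr1 ?mulr0 ?addr0 //; lra.
case=> /cellP h; apply/cellP => j; have := h j; rewrite !mxE ?eqxx; case: eqP => [->|_] //=; rewrite ?mulr1 ?mulr0 ?addr0 //; lra.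
Qed.

Lemma cell_disjoint i a l :
  [disjoint cell a (halve i l) & cell (a + half i l) (halve i l)].
Proof.
apply/disj_setPS => x [/cellP h1 /cellP h2].
have := h1 i; have := h2 i; rewrite !mxE !eqxx /= mulr1; lra.
Qed.

Lemma mcell_halve i l : 0 <= l 0 i -> mcell l = 2 * mcell (halve i l).
Proof.
move=> l0; rewrite -(mu_cell 0) (cell_split 0 l0) measureU; last 3 first.
- exact: cell_measurable.
- exact: cell_measurable.
- exact/disj_set2P/cell_disjoint.
rewrite fineD; last 2 first.
- by rewrite ge0_fin_numE //; exact: cell_lty.
- by rewrite ge0_fin_numE //; exact: cell_lty.
by rewrite !mu_cell; ring.
Qed.

Lemma Int_cell_split i a l f : 0 <= l 0 i -> rint mu (cell a l) f ->
  Int (cell a l) f =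
  Int (cell a (halve i l)) f + Int (cell (a + half i l) (halve i l)) f.
Proof.
move=> l0; rewrite (cell_split a l0) => rf.
apply: Rintegral_setU => //; [exact: cell_measurable|exact: cell_measurable|].
exact: cell_disjoint.
Qed.

Lemma Int_cell_sqr a l f : cc f ->
  Int (cell a l) f ^+ 2 <= mcell l * Int (cell a l) (fun x => f x ^+ 2).
Proof.
move=> cf; have mc := cell_measurable a l; have fc := cell_lty a l.
have := cauchy_schwarz mc (cc_L2 mc cf) (L2_cst mc fc 1).
rewrite /iprod (@eq_Int _ T R mu (cell a l) (fun x => f x * 1) f); last by move=> x _; rewrite mulr1.
rewrite Rintegral_cst // mu_cell !mul1r mulrC.
by under [X in _ <= _ * X -> _]eq_Rintegral do rewrite -expr2.
Qed.

Definition grid := (seq V * V)%type.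
Definition bisect (st : grid) i : grid :=
  (st.1 ++ [seq a + half i st.2 | a <- st.1], halve i st.2).
(** The squared L^2 norm of the projection of [f] onto the functions constant on each cell. Cells of
    volume 0 contribute 0, by the convention for division by 0. *)
Definition energy_on (st : grid) f : R :=
  \sum_(a <- st.1) Int (cell a st.2) f ^+ 2 / mcell st.2.
(** The total gain of energy that all future bisections can bring. Halving the side [l i] gains at
    most [2^-1 * (l i / 2) ^+ 2 = l i ^+ 2 / 8] times the integral of the squared derivative;
    summing over successive halvings, 1/8 (1 + 1/4 + ...) = 1/6. *)
Definition deficit (st : grid) f : R :=
  \sum_i st.2 0 i ^+ 2 / 6 * Int setT (fun x => partial i f x ^+ 2).
(** The partition of [Q] into cells, in the integrated form in which it is used. *)
Definition tiles (Q : set T) (st : grid) := forall f, rint mu setT f ->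
  \sum_(a <- st.1) Int (cell a st.2) f = Int Q f.
Definition nonneg_side (st : grid) := forall i, 0 <= st.2 0 i.

Lemma nonneg_side_bisect st i : nonneg_side st -> nonneg_side (bisect st i).
Proof.
move=> h j; rewrite /= mxE; case: eqP => [_|_]; last exact: h.
by rewrite divr_ge0.
Qed.

Lemma tiles_bisect Q st i : nonneg_side st -> tiles Q st -> tiles Q (bisect st i).
Proof.
move=> s0 hQ f rf; rewrite -hQ // /= big_cat /= big_map -big_split /=.
apply: eq_bigr => a _; rewrite -Int_cell_split //.
by apply: (integrableS measurableT) => //; exact: cell_measurable.
Qed.

Definition C1c f := [/\ cc f, forall i, cc (partial i f) &
  forall i x, derivable (f : V -> R^o) x (delta_mx 0 i)].

(* For an integrand with means p, q over the two halves of a cell, bisection adds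
   m (p - q)^2 / 4, where p - q is the mean of a difference of translates. *)
Lemma bisect_energy Q st i f : measurable Q -> nonneg_side st -> tiles Q st -> C1c f ->
  energy_on (bisect st i) f + deficit (bisect st i) f <= energy_on st f + deficit st f.
Proof.
move=> mQ s0 hQ [cf cdf df]; case: st s0 hQ => A l s0 hQ.
pose l' := halve i l; pose y := half i l; pose m' := mcell l'.
have l0 : 0 <= l 0 i := s0 i.
pose g x : R := f (x + y) - f x.
have cg : cc g by apply: ccB => //; exact: cc_translate.
have m'0 : 0 <= m' by exact: fine_ge0.
have step a : Int (cell a l') f ^+ 2 / m' + Int (cell (a + y) l') f ^+ 2 / m' <=
    Int (cell a l) f ^+ 2 / mcell l + 2^-1 * Int (cell a l') (fun x => g x ^+ 2).
  rewrite (mcell_halve l0) -/l' -/m' (@Int_cell_split i a l) //; last first.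
    exact: (cc_rintS (cell_measurable _ _)).
  rewrite -/l' -/y; set P := Int (cell a l') f; set P' := Int (cell (a + y) l') f.
  have dE : P' - P = Int (cell a l') g.
    rewrite /P' -(Int_translateS y (cell_measurable _ _) cf) cell_translate -RintegralB //.
    - exact: cell_measurable.
    - exact: (cc_rintS (cell_measurable _ _) (cc_translate _ cf)).
    - exact: (cc_rintS (cell_measurable _ _) cf).
  have := Int_cell_sqr a l' cg; rewrite -dE -/m'.
  set G := Int (cell a l') (fun x => g x ^+ 2) => le.
  have G0 : 0 <= G by apply: Rintegral_ge0 => x _; exact: sqr_ge0.
  have [m0|mn0] := eqVneq m' 0.
    by rewrite m0 mulr0 !invr0 !mulr0; lra.
  have mp : 0 < m' by rewrite lt_neqAle eq_sym mn0.
  have -> : P ^+ 2 / m' + P' ^+ 2 / m' = (P + P') ^+ 2 / (2 * m') + (P' - P) ^+ 2 / (2 * m').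
    by field; exact/negP/negPn.
  rewrite lerD2l ler_pdivrMr ?mulr_gt0 //.
  by apply: le_trans le _; lra.
have stepS : energy_on (bisect (A, l) i) f <=
    energy_on (A, l) f + 2^-1 * Int setT (fun x => g x ^+ 2).
  rewrite /energy_on /= big_cat /= big_map -big_split /=.
  apply: (le_trans (ler_sum _ (fun a _ => step a))).
  rewrite big_split /= lerD2l -mulr_sumr ler_wpM2l ?invr_ge0 //.
  have rg := cc_rint (cc_sqr cg).
  apply: (@le_trans _ _ (Int Q (fun x => g x ^+ 2))).
    rewrite -hQ //=; apply: ler_sum => a _.
    rewrite (@Int_cell_split i a l) //; last exact: (cc_rintS (cell_measurable _ _) (cc_sqr cg)).
    by rewrite lerDl; apply: Rintegral_ge0 => x _; exact: sqr_ge0.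
  rewrite -[in leRHS](setvU Q) Rintegral_setU //; last 3 first.
  - exact: measurableC.
  - by rewrite setvU.
  - by apply/disj_setPS => x [].
  by rewrite lerDr; apply: Rintegral_ge0 => x _; exact: sqr_ge0.
have gle : Int setT (fun x => g x ^+ 2) <=
    (l 0 i / 2) ^+ 2 * Int setT (fun x => partial i f x ^+ 2).
  by apply: translate_estimate => //; rewrite divr_ge0.
have defE : deficit (A, l) f = deficit (bisect (A, l) i) f +
    l 0 i ^+ 2 / 8 * Int setT (fun x => partial i f x ^+ 2).
  rewrite /deficit (bigD1 i) //= [in RHS](bigD1 i) //= mxE eqxx.
  have -> : \sum_(j < n | j != i) halve i l 0 j ^+ 2 / 6 * Int setT (fun x => partial j f x ^+ 2) =
    \sum_(j < n | j != i) l 0 j ^+ 2 / 6 * Int setT (fun x => partial j f x ^+ 2).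
    by apply: eq_bigr => j /negbTE ji; rewrite mxE ji.
  by field.
rewrite defE; move: stepS gle; set D := Int setT (fun x => partial i f x ^+ 2).
set E1 := energy_on _ _; set E2 := energy_on _ _; lra.
Qed.

End Cells.

(** * The refinement limit and compactness for test functions *)

Section Rellich.
Context (R : realType) (n : nat).
Local Notation V := 'rV[R]_n.
Local Notation T := (caratheodory_type (@lebesgue_outer R n)).
Local Notation mu := (lebesgue R n).
Local Notation Int D f := (Rintegral mu D f).
Implicit Types (f g : V -> R) (a l x y : V) (i j : 'I_n) (r c t h M : R).

Lemma bisect_all (Q : set T) (s : seq 'I_n) (st : grid R n) :
  measurable Q -> nonneg_side st -> tiles Q st ->
  let st' := foldl (@bisect R n) st s in
  [/\ nonneg_side st', tiles Q st',
      (size st'.1)%:R * mcell st'.2 = (size st.1)%:R * mcell st.2 &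
      forall f, C1c f -> energy_on st' f + deficit st' f <= energy_on st f + deficit st f].
Proof.
move=> mQ; elim: s st => [|i s IH] st s0 hQ /=; first by split.
have s0' := nonneg_side_bisect i s0; have hQ' := tiles_bisect i s0 hQ.
have [h1 h2 h3 h4] := IH _ s0' hQ'; split => //.
  rewrite h3 /= size_cat size_map addnn -mul2n natrM.
  by rewrite (mcell_halve (s0 i)); ring.
move=> f Cf; apply: le_trans (h4 f Cf) _.
exact: bisect_energy mQ s0 hQ Cf.
Qed.

Lemma bisect_all_side (s : seq 'I_n) (st : grid R n) j : uniq s ->
  (foldl (@bisect R n) st s).2 0 j = if j \in s then st.2 0 j / 2 else st.2 0 j.
Proof.
elim: s st => [|i s IH] st //= /andP[is_ us]; rewrite IH // inE /= mxE.
case: eqP => [->|_] /=; last by [].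
by rewrite (negbTE is_).
Qed.

Definition refine k (st : grid R n) : grid R n :=
  iter k (fun st => foldl (@bisect R n) st (enum 'I_n)) st.

Lemma refine_spec (Q : set T) k (st : grid R n) :
  measurable Q -> nonneg_side st -> tiles Q st ->
  [/\ nonneg_side (refine k st), tiles Q (refine k st),
      (size (refine k st).1)%:R * mcell (refine k st).2 = (size st.1)%:R * mcell st.2,
      (forall f, C1c f -> energy_on (refine k st) f + deficit (refine k st) f <=
         energy_on st f + deficit st f) &
      forall j, (refine k st).2 0 j = st.2 0 j * 2^-1 ^+ k].
Proof.
move=> mQ s0 hQ; elim: k => [|k [h1 h2 h3 h4 h5]].
  by split => // j; rewrite expr0 mulr1.
have [g1 g2 g3 g4] := bisect_all (enum 'I_n) mQ h1 h2.
split => //=; first by rewrite g3.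
  by move=> f Cf; apply: le_trans (g4 f Cf) (h4 f Cf).
by move=> j; rewrite bisect_all_side ?enum_uniq // mem_enum /= -/(refine k st) h5 exprSr mulrA.
Qed.

Lemma C1c_bound f : C1c f -> exists2 M, 0 <= M & forall i x, `|partial i f x| <= M.
Proof.
move=> [_ cdf _].
have bd i : exists M, 0 <= M /\ forall x, `|partial i f x| <= M.
  by have [M M0 hM] := cc_bounded (cdf i); exists M.
have [M hM] := choice bd; exists (\sum_i M i).
  by apply: sumr_ge0 => i _; case: (hM i).
move=> i x; apply: le_trans (proj2 (hM i) x) _.
rewrite (bigD1 i) //= lerDl; apply: sumr_ge0 => j _; by case: (hM j).
Qed.

(** The path moves in one coordinate direction at a time, so partial derivatives suffice. Increments
    are nonnegative because cells are based at their lower corner. *)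
Lemma path_bound f M x (t : 'I_n -> R) (s : seq 'I_n) : C1c f ->
  (forall i x, `|partial i f x| <= M) -> (forall i, 0 <= t i) ->
  `|f (x + \sum_(i <- s) t i *: delta_mx 0 i) - f x| <= \sum_(i <- s) t i * M.
Proof.
move=> [cf _ df] hM t0; elim: s => [|i s IH].
  by rewrite !big_nil addr0 subrr normr0.
rewrite !big_cons [_ *: _ + _]addrC addrA.
set z := x + _ in IH *.
have := difference_bound cf (fun x => @df i x) z (hM i) (t0 i).
have := ler_normD (f (z + t i *: 'e_i) - f z) (f z - f x).
by rewrite addrA subrK; lra.
Qed.

Lemma cell_oscillation f M a l (eta : R) x : C1c f -> 0 <= M ->
  (forall i x, `|partial i f x| <= M) -> (forall j, l 0 j <= eta) ->
  cell a l x -> `|f x - f a| <= n%:R * (eta * M).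
Proof.
move=> Cf M0 hM le /cellP cx.
have t0 i : 0 <= x 0 i - a 0 i by have := cx i; lra.
have := path_bound a (index_enum 'I_n) Cf hM t0.
have -> : a + \sum_i (x 0 i - a 0 i) *: 'e_i = x.
  have -> : \sum_i (x 0 i - a 0 i) *: 'e_i = x - a.
    by rewrite [RHS]row_sum_delta; apply: eq_bigr => i _; rewrite !mxE.
  by rewrite addrCA subrr addr0.
move=> h; apply: le_trans h _.
rewrite (_ : n%:R * (eta * M) = \sum_(i < n) eta * M); last first.
  by rewrite sumr_const card_ord mulr_natl.
apply: ler_sum => i _; apply: ler_wpM2r => //.
by have := cx i; have := le i; lra.
Qed.

(** The mean is the best constant: the left side minus the first term on the right is at most the
    integral of [(f - c) ^+ 2] for any [c], here for [c = f a]. *)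
Lemma cell_variance f a l (delta : R) : cc f -> 0 <= delta ->
  (forall x, cell a l x -> `|f x - f a| <= delta) ->
  Int (cell a l) (fun x => f x ^+ 2) <=
  Int (cell a l) f ^+ 2 / mcell l + delta ^+ 2 * mcell l.
Proof.
move=> cf d0 osc; set c := f a in osc; set m := mcell l.
have m0 : 0 <= m by exact: fine_ge0.
have mE : m = fine (mu (cell a l)) by rewrite mu_cell.
have mc := cell_measurable a l; have fc := cell_lty a l.
have rf := cc_rintS mc cf; have rf2 := cc_rintS mc (cc_sqr cf).
have rc k := rint_cst mc fc k.
have var : Int (cell a l) (fun x => (f x - c) ^+ 2) =
    Int (cell a l) (fun x => f x ^+ 2) - 2 * c * Int (cell a l) f + c ^+ 2 * m.
  rewrite -RintegralZl // mE -Rintegral_cst // -RintegralB //; last exact: (rintZ mc _ rf).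
  rewrite -RintegralD //; [|exact: (rintB mc rf2 (rintZ mc _ rf))|exact: rc].
  by apply: eq_Int => x _; ring.
have varle : Int (cell a l) (fun x => (f x - c) ^+ 2) <= delta ^+ 2 * m.
  rewrite mE -Rintegral_cst //; apply: le_Rintegral => //.
    apply: (@eq_rint _ T R mu _ mc (fun x => f x ^+ 2 - (2 * c) * f x + c ^+ 2)).
      by move=> x _; ring.
    exact: (rintD mc (rintB mc rf2 (rintZ mc _ rf)) (rc _)).
    exact: rc.
  move=> x cx; rewrite -[X in X <= _]real_normK ?num_real //.
  by rewrite lerXn2r ?nnegrE //; exact: osc.
have cs := Int_cell_sqr a l cf; rewrite -/m in cs.
set I1 := Int (cell a l) f in var cs *; set I2 := Int (cell a l) (fun x => f x ^+ 2) in var cs *.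
have [mz|mn] := eqVneq m 0.
  move: cs var varle; rewrite mz mul0r invr0 !mulr0 => cs var varle.
  have : I1 = 0 by apply/eqP; rewrite -sqrf_eq0 eq_le cs sqr_ge0.
  by move=> I10; rewrite I10 in var; lra.
have mp : 0 < m by rewrite lt_neqAle eq_sym mn.
have : 0 <= (I1 - c * m) ^+ 2 / m by rewrite divr_ge0 ?sqr_ge0.
have -> : (I1 - c * m) ^+ 2 / m = I1 ^+ 2 / m - 2 * c * I1 + c ^+ 2 * m by field.
by lra.
Qed.

(** Bisection never increases [energy_on] plus [deficit], while under refinement the energy catches
    up with the full integral because [f] oscillates little on small cells. The initial sum
    therefore dominates the integral. *)
Lemma energy_limit (Q : set T) (st : grid R n) f : measurable Q ->
  nonneg_side st -> tiles Q st -> C1c f ->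
  Int Q (fun x => f x ^+ 2) <= energy_on st f + deficit st f.
Proof.
move=> mQ s0 hQ Cf; have [cf cdf df] := Cf.
have [M M0 hM] := C1c_bound Cf.
pose L : R := \sum_j st.2 0 j.
have L0 : 0 <= L by exact: sumr_ge0.
pose m0 := (size st.1)%:R * mcell st.2.
have m00 : 0 <= m0 by rewrite mulr_ge0 //; exact: fine_ge0.
have bound k : Int Q (fun x => f x ^+ 2) <= energy_on st f + deficit st f +
    (n%:R * (L * M)) ^+ 2 * m0 * 2^-1 ^+ k.
  have [h1 h2 h3 h4 h5] := refine_spec k mQ s0 hQ.
  set st' := refine k st in h1 h2 h3 h4 h5.
  have k0 : 0 <= (2^-1 : R) ^+ k by rewrite exprn_ge0 // invr_ge0.
  have k1 : (2^-1 : R) ^+ k <= 1 by rewrite exprn_ile1 // ?invr_ge0 // invf_le1 // ler1n.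
  pose delta := n%:R * (L * 2^-1 ^+ k * M).
  have d0 : 0 <= delta by rewrite !mulr_ge0.
  have side j : st'.2 0 j <= L * 2^-1 ^+ k.
    rewrite h5; apply: ler_wpM2r => //; rewrite /L (bigD1 j) //= lerDl.
    exact: sumr_ge0.
  rewrite -h2; last exact: cc_rint (cc_sqr cf).
  have : \sum_(a <- st'.1) Int (cell a st'.2) (fun x => f x ^+ 2) <=
      \sum_(a <- st'.1) (Int (cell a st'.2) f ^+ 2 / mcell st'.2 + delta ^+ 2 * mcell st'.2).
    apply: ler_sum => a _; apply: cell_variance => // x cx.
    exact: cell_oscillation Cf M0 hM side cx.
  rewrite big_split /= -/(energy_on st' f) => /le_trans; apply.
  have -> : \sum_(a <- st'.1) delta ^+ 2 * mcell st'.2 = delta ^+ 2 * m0.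
    by rewrite big_const_seq count_predT iter_addr_0 /m0 -h3 mulrCA mulr_natl.
  have D0 : 0 <= deficit st' f.
    apply: sumr_ge0 => i _; rewrite mulr_ge0 ?divr_ge0 ?sqr_ge0 //.
    by apply: Rintegral_ge0 => x _; exact: sqr_ge0.
  have := h4 f Cf => le.
  (* Refinement preserves the total volume [m0], so the error carries the factor [2^-k] twice; one
     of them is bounded by 1. *)
  have : delta ^+ 2 * m0 <= (n%:R * (L * M)) ^+ 2 * m0 * 2^-1 ^+ k.
    have -> : delta ^+ 2 * m0 =
        (n%:R * (L * M)) ^+ 2 * m0 * (2^-1 ^+ k * 2^-1 ^+ k) by rewrite /delta; ring.
    apply: ler_wpM2l; first by rewrite mulr_ge0 // sqr_ge0.
    by apply: ler_piMl.
  lra.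
set C := (n%:R * (L * M)) ^+ 2 * m0 in bound.
have to_limit : (fun k => energy_on st f + deficit st f + C * 2^-1 ^+ k) @ \oo -->
    energy_on st f + deficit st f + C * 0.
  apply: cvgD; first exact: cvg_cst.
  by apply: cvgMl_tmp; apply: cvg_expr; rewrite ger0_norm ?invr_ge0 // invf_lt1 // ltr1n.
rewrite -[leRHS]addr0 -(mulr0 C); apply: (cvgr_to_ge to_limit).
by apply: nearW => k; exact: bound.
Qed.

Section TestFunctions.
Variables (Omega : set V).
Hypotheses (bOmega : bounded_set Omega) (oOmega : open Omega).

Lemma Omega_measurable : measurable (Omega : set T).
Proof. exact: open_lebesgue_measurable. Qed.

Lemma Omega_lty : (mu Omega < +oo)%E.
Proof. exact: lebesgue_bounded_lty. Qed.

Lemma Omega_norm : exists2 r, 0 <= r & forall x, Omega x -> `|x| <= r.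
Proof.
move: bOmega; rewrite /bounded_set /bounded_near => /pinfty_ex_gt0[M M0 /= hM].
by exists M => //; exact: ltW.
Qed.

Lemma test_out f x : test_function Omega f -> ~ Omega x -> f x = 0.
Proof.
move=> [_ _ sub] nx; have [//|fx] := eqVneq (f x) 0.
by exfalso; apply/nx/sub; apply: subset_closure.
Qed.

Lemma partial_out f x i : test_function Omega f -> ~ Omega x -> partial i f x = 0.
Proof.
move=> [_ _ sub] nx; have ncl : ~ closure [set x | f x != 0] x by move=> /sub.
rewrite /partial (@near_eq_derive _ _ _ _ (cst 0)) ?derive_cst //.
have : nbhs x (~` closure [set x | f x != 0]).
  by apply: open_nbhs_nbhs; split => //; apply: closed_openC; exact: closed_closure.
apply: filterS => y ny /=; have [//|fy] := eqVneq (f y) 0.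
by exfalso; apply: ny; apply: subset_closure.
Qed.

Lemma test_C1c f : test_function Omega f -> C1c f.
Proof.
move=> tf; have [sm _ _] := tf; have [r r0 hr] := Omega_norm.
have [c0 d0] := sm [::].
split=> //.
- split => //; exists r => x fx; apply: hr; apply: contrapT => nx.
  by move: fx; rewrite (test_out tf nx) eqxx.
- move=> i; have [ci _] := sm [:: i]; split => //.
  exists r => x fx; apply: hr; apply: contrapT => nx.
  by move: fx; rewrite (partial_out i tf nx) eqxx.
Qed.

Lemma Int_outside (g : V -> R) (D : set T) : (forall x, ~ Omega x -> g x = 0) ->
  Int (D `&` Omega) g = Int D g.
Proof.
move=> g0; rewrite Rintegral_mkcondr; apply: eq_Int => x _; rewrite patchE.
by case: ifPn => // /negP nx; rewrite g0 // => Ox; apply/nx/mem_set.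
Qed.

Lemma Int_outsideT (g : V -> R) : (forall x, ~ Omega x -> g x = 0) ->
  Int Omega g = Int setT g.
Proof. by move=> g0; rewrite -(Int_outside setT g0) setTI. Qed.

Lemma test_L2 f : test_function Omega f -> L2 mu Omega f.
Proof. by move=> /test_C1c[cf _ _]; apply: cc_L2 => //; exact: Omega_measurable. Qed.

Lemma test_partial_L2 f i : test_function Omega f -> L2 mu Omega (partial i f).
Proof. by move=> /test_C1c[_ cf _]; apply: cc_L2 => //; exact: Omega_measurable. Qed.

Lemma test_sqr f : test_function Omega f ->
  iprod mu Omega f f = Int setT (fun x => f x ^+ 2).
Proof.
move=> tf; rewrite -Int_outsideT; last by move=> x /(test_out tf) ->; rewrite expr0n.
by apply: eq_Int => x _; rewrite expr2.
Qed.

Lemma test_partial_sqr f i : test_function Omega f ->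
  iprod mu Omega (partial i f) (partial i f) = Int setT (fun x => partial i f x ^+ 2).
Proof.
move=> tf; rewrite -Int_outsideT; last first.
  by move=> x /(partial_out i tf) ->; rewrite expr0n.
by apply: eq_Int => x _; rewrite expr2.
Qed.

Lemma test_poincare i : exists2 C, 0 < C & forall f, test_function Omega f ->
  iprod mu Omega f f <= C * iprod mu Omega (partial i f) (partial i f).
Proof.
have [r r0 hr] := Omega_norm.
exists ((2 * r + 1) ^+ 2 / 2); first by rewrite divr_gt0 ?exprn_gt0 //; lra.
move=> f tf; rewrite test_sqr // test_partial_sqr //.
have [cf cdf df] := test_C1c tf.
have fr x : f x != 0 -> `|x| <= r.
  move=> fx; apply: hr; apply: contrapT => nx.
  by move: fx; rewrite (test_out tf nx) eqxx.
by have := poincare cf (cdf i) (fun x => @df i x) r0 fr; lra.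
Qed.

(* A quantitative form of the compactness of H^1_0 in L^2; the h b are normalized
   indicators of the cells of a fine grid. *)
Lemma finite_rank_poincare (eta : R) : 0 < eta -> exists N (h : 'I_N -> V -> R),
  (forall b, L2 mu Omega (h b) /\ iprod mu Omega (h b) (h b) <= 1) /\
  forall f, test_function Omega f ->
    iprod mu Omega f f <= \sum_b iprod mu Omega f (h b) ^+ 2 +
      eta * \sum_i iprod mu Omega (partial i f) (partial i f).
Proof.
move=> eta0; have [r r0 hr] := Omega_norm.
(* The starting cell has coordinates in [(- r - 1, r + 1]] and so contains [Omega]. *)
pose a0 : V := const_mx (- r - 1); pose l0 : V := const_mx (2 * r + 2).
pose st0 : grid R n := ([:: a0], l0); pose Q := cell a0 l0.
have mQ : measurable Q := cell_measurable a0 l0.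
have s0 : nonneg_side st0 by move=> j; rewrite /= mxE; lra.
have hQ : tiles Q st0 by move=> f rf; rewrite /= big_seq1.
(* After [k] refinements the sides are [(2 r + 2) 2^-k], and this makes every coefficient of
   [deficit] at most [eta]. A side below both 1 and [eta] has its square below [eta]. *)
have [k hk] : exists k, ((2 * r + 2) * 2^-1 ^+ k) ^+ 2 / 6 <= eta.
  have lim0 : (fun k => ((2 * r + 2) * 2^-1 ^+ k)) @ \oo --> (2 * r + 2) * 0.
    by apply: cvgMl_tmp; apply: cvg_expr; rewrite ger0_norm ?invr_ge0 // invf_lt1 // ltr1n.
  rewrite mulr0 in lim0.
  have e1 : 0 < Num.min 1 eta by rewrite lt_min ltr01.
  have /cvgrPdist_lt/(_ _ e1)/filter_ex[k] := lim0.
  rewrite sub0r normrN lt_min => /andP[h1 h2]; exists k.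
  move: h1 h2; set u := (2 * r + 2) * _; rewrite -[u ^+ 2]real_normK ?num_real //.
  by have := normr_ge0 u; nra.
have [h1 h2 _ h4 h5] := refine_spec k mQ s0 hQ.
set st := refine k st0 in h1 h2 h4 h5.
(* With this normalization the squared inner products with the [h a] are exactly the terms of
   [energy_on]. *)
pose c := (Num.sqrt (mcell st.2))^-1.
have m0 : 0 <= mcell st.2 by exact: fine_ge0.
have c2 : c ^+ 2 = (mcell st.2)^-1 by rewrite /c exprVn sqr_sqrtr.
have mO := Omega_measurable; have fO := Omega_lty.
pose h a : V -> R := fun x => c * \1_(cell a st.2) x.
have mind a : measurable_fun (Omega : set T) (\1_(cell a st.2) : T -> R).
  by apply: measurable_indic; exact: cell_measurable.
have L2ind a : L2 mu Omega (\1_(cell a st.2)).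
  apply: (L2_ae_le mO (mind a) (L2_cst mO fO 1)).
  by apply: aeW => x _; rewrite normr1 indicE ger0_norm ?ler0n // lern1 leq_b1.
have L2h a : L2 mu Omega (h a) by exact: L2Z.
have Intind a (g : V -> R) : Int Omega (fun x => \1_(cell a st.2) x * g x) = Int (Omega `&` cell a st.2) g.
  rewrite Rintegral_mkcondr; apply: eq_Int => x _; rewrite patchE indicE.
  by case: ifPn; rewrite ?mul1r ?mul0r.
exists (size st.1), (fun k => h (nth 0 st.1 k)); split.
  move=> k'; move: (nth 0 st.1 k') => a; split => //.
  rewrite iprodZl // iprodZr // mulrA -expr2 c2 /iprod (Intind a (\1_(cell a st.2))).
  have -> : Int (Omega `&` cell a st.2) (\1_(cell a st.2)) = fine (mu (Omega `&` cell a st.2)).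
    rewrite -[RHS]mul1r -Rintegral_cst; last by apply: measurableI => //; exact: cell_measurable.
    by apply: eq_Int => x [_ cx]; rewrite indicE mem_set.
  have le : fine (mu (Omega `&` cell a st.2)) <= mcell st.2.
    rewrite -(mu_cell a); apply: fine_le.
    - rewrite ge0_fin_numE //; apply: le_lt_trans (cell_lty a st.2); apply: le_measure.
      + by rewrite inE; apply: measurableI => //; exact: cell_measurable.
      + by rewrite inE; exact: cell_measurable.
      + by move=> x [].
    - by rewrite ge0_fin_numE //; exact: cell_lty.
    - apply: le_measure.
      + by rewrite inE; apply: measurableI => //; exact: cell_measurable.
      + by rewrite inE; exact: cell_measurable.
      + by move=> x [].
  have [mz|mn] := eqVneq (mcell st.2) 0; first by rewrite mz invr0 mul0r.
  by rewrite mulrC ler_pdivrMr ?mul1r // lt_neqAle eq_sym mn.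
move=> f tf; have Cf := test_C1c tf; have Lf := test_L2 tf.
rewrite (eq_bigr (fun k' : 'I_(size st.1) =>
    Int (cell (nth 0 st.1 k') st.2) f ^+ 2 / mcell st.2)); last first.
  move=> k' _; move: (nth 0 st.1 k') => a; rewrite iprodZr // exprMn c2 mulrC; congr (_ ^+ 2 / _).
  rewrite iprodC /iprod Intind setIC Int_outside //.
  exact: (fun x => @test_out f x tf).
have -> : iprod mu Omega f f = Int Q (fun x => f x ^+ 2).
  rewrite test_sqr // -(Int_outsideT (g := fun x => f x ^+ 2)); last first.
    by move=> x /(test_out tf) ->; rewrite expr0n.
  rewrite -(Int_outside Q (g := fun x => f x ^+ 2)); last first.
    by move=> x /(test_out tf) ->; rewrite expr0n.
  congr Rintegral; apply/seteqP; split; last by move=> x [].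
  move=> x Ox; split => //; apply/cellP => j; rewrite !mxE.
  have := le_trans (coord_le_norm x j) (hr x Ox).
  by rewrite ler_norml => /andP[? ?]; apply/andP; split; lra.
apply: le_trans (energy_limit mQ h1 h2 Cf) _.
rewrite /energy_on (big_nth 0) big_mkord lerD2l mulr_sumr.
apply: ler_sum => i _; rewrite test_partial_sqr //; apply: ler_wpM2r.
  by apply: Rintegral_ge0 => x _; exact: sqr_ge0.
by rewrite h5 /= mxE.
Qed.

End TestFunctions.

End Rellich.

(** * Integrals of Caratheodory functions *)

Lemma cvg_row (R : realType) (m : nat) (w : nat -> 'rV[R]_m) (w0 : 'rV[R]_m) :
  (forall i, (fun k => w k 0 i) @ \oo --> w0 0 i) -> w @ \oo --> w0.
Proof.
move=> wi; apply/cvg_ballP => e e0.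
have h : \forall k \near \oo, forall i, ball (w0 0 i) e (w k 0 i).
  apply: filter_forall => i; have /cvg_ballP/(_ _ e0) := wi i; exact.
by apply: filterS h => k h; split => // i j; rewrite ord1; exact: h.
Qed.

Lemma cvg_triple (R : realType) (m : nat) (a b : nat -> R) (a0 b0 : R)
    (w : nat -> 'rV[R]_m) (w0 : 'rV[R]_m) :
  a @ \oo --> a0 -> b @ \oo --> b0 -> w @ \oo --> w0 ->
  (fun k => (a k, b k, w k)) @ \oo --> (a0, b0, w0).
Proof.
move=> ha hb hw.
exact: (@cvg_pair _ _ _ _ (nbhs (a0, b0)) (nbhs w0) _ _ _ (fun k => (a k, b k)) w
  (@cvg_pair _ _ _ _ (nbhs a0) (nbhs b0) _ _ _ a b ha hb) hw).
Qed.

Section Caratheodory.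
Context d (T : measurableType d) (R : realType) (mu : {measure set T -> \bar R})
  (D : set T) (mD : measurable D) (cmu : measure_is_complete mu) (m : nat).
Implicit Types (u v : T -> R) (w : T -> 'rV[R]_m).

Lemma measurable_countable_selection (J : countType) (phi : T -> J) (H : J -> T -> R) :
  (forall j, measurable (D `&` [set x | phi x = j])) ->
  (forall j, measurable_fun D (H j)) -> measurable_fun D (fun x => H (phi x) x).
Proof.
move=> mphi mH _ B mB.
have -> : D `&` (fun x => H (phi x) x) @^-1` B =
    \bigcup_(j in [set: J]) ((D `&` [set x | phi x = j]) `&` (D `&` (H j) @^-1` B)).
  apply/seteqP; split=> x /=.
    by move=> [Dx Bx]; exists (phi x).
  by move=> [j _ [[Dx <-] [_ Bx]]].
apply: countable_bigcupT_measurable; first exact: countableP.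
by move=> j; apply: measurableI => //; exact: mH.
Qed.

(** On the exceptional null set the limit is arbitrary; completeness of the measure makes every
    subset of it measurable. *)
Lemma measurable_ae_limit (s : nat -> T -> R) (f : T -> R) :
  (forall k, measurable_fun D (s k)) ->
  {ae mu, forall x, D x -> (fun k => s k x) @ \oo --> f x} -> measurable_fun D f.
Proof.
move=> ms [N [mN N0 sN]].
have DE : D = (D `\` N) `|` (D `&` N) by rewrite setUC setUIDK.
have mDN : measurable (D `\` N) by exact: measurableD.
have mDI : measurable (D `&` N) by exact: measurableI.
rewrite DE; apply/measurable_funU => //; split.
  apply: (@measurable_fun_cvg _ _ _ _ s).
    by move=> k; apply: measurable_funS (ms k) => //; exact: subDsetl.
  move=> x [Dx Nx]; apply: contrapT => nc; apply: Nx; apply: sN => /= H.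
  by apply: nc; exact: H.
move=> _ B mB; apply: cmu; exists N; split => //.
by move=> x [[]].
Qed.

Definition grid_index k (u v : T -> R) w (x : T) : int * int * 'rV[int]_m :=
  (Num.floor (u x * k.+1%:R), Num.floor (v x * k.+1%:R),
   \row_i Num.floor (w x 0 i * k.+1%:R)).

Definition grid_point k (j : int) : R := j%:~R / k.+1%:R.

Lemma grid_point_cvg (t : R) :
  (fun k => grid_point k (Num.floor (t * k.+1%:R))) @ \oo --> t.
Proof.
apply/cvgrPdist_le => e e0; near=> k.
have k0 : 0 < k.+1%:R :> R by rewrite ltr0n.
have /andP[h1 h2] := floor_itv (t * k.+1%:R).
rewrite -ler_pdivrMr // in h1; rewrite intrD -ltr_pdivlMr // in h2.
have ke : k.+1%:R^-1 < e by near: k; exact: (near_infty_natSinv_lt (PosNum e0)).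
rewrite mulrDl mul1r in h2.
have a1 : grid_point k (Num.floor (t * k.+1%:R)) <= t := h1.
have a2 : t < grid_point k (Num.floor (t * k.+1%:R)) + k.+1%:R^-1 := h2.
rewrite ler_norml; move: (grid_point k _) a1 a2 => a a1 a2.
by move: (k.+1%:R^-1) ke a2 => b ke a2; apply/andP; split; lra.
Unshelve. all: by end_near. Qed.

Lemma floor_measurable u k (j : int) : measurable_fun D u ->
  measurable (D `&` [set x | Num.floor (u x * k.+1%:R) = j]).
Proof.
move=> mu'; have k0 : 0 < k.+1%:R :> R by rewrite ltr0n.
have -> : D `&` [set x | Num.floor (u x * k.+1%:R) = j] =
    D `&` u @^-1` `[j%:~R / k.+1%:R, (j + 1)%:~R / k.+1%:R[%classic.
  congr (_ `&` _); apply/seteqP; split=> x /=; rewrite in_itv /= ler_pdivrMr // ltr_pdivlMr //.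
    by move=> <-; exact: floor_itv.
  by move=> h; apply: floor_def; rewrite h.
exact: mu'.
Qed.

(** Rounding [u], [v], [w] down to multiples of [1 / (k + 1)] leaves countably many argument values,
    for each of which [G] is measurable in [x]; continuity in the arguments gives the limit. *)
Lemma caratheodory_measurable (G : T -> R -> R -> 'rV[R]_m -> R) u v w :
  (forall a b y, measurable_fun D (fun x => G x a b y)) ->
  {ae mu, forall x, D x ->
     continuous (fun q : R * R * 'rV[R]_m => G x q.1.1 q.1.2 q.2 : R^o)} ->
  measurable_fun D u -> measurable_fun D v ->
  (forall i, measurable_fun D (fun x => w x 0 i)) ->
  measurable_fun D (fun x => G x (u x) (v x) (w x)).
Proof.
move=> mG cG mu' mv mw.
pose H k (j : int * int * 'rV[int]_m) x := G x (grid_point k j.1.1) (grid_point k j.1.2)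
  (\row_i grid_point k (j.2 0 i)).
apply: (@measurable_ae_limit (fun k x => H k (grid_index k u v w x) x)).
  move=> k; apply: measurable_countable_selection => [[[a b] y]|j]; last exact: mG.
  have -> : D `&` [set x | grid_index k u v w x = (a, b, y)] =
      (D `&` [set x | Num.floor (u x * k.+1%:R) = a]) `&`
      ((D `&` [set x | Num.floor (v x * k.+1%:R) = b]) `&`
       \bigcap_(i in [set: 'I_m]) (D `&` [set x | Num.floor (w x 0 i * k.+1%:R) = y 0 i])).
    apply/seteqP; split=> x /=.
      move=> [Dx [ha hb hy]]; split => //; split => // i _; split => //=.
      by rewrite -hy mxE.
    move=> [[Dx ha] [[_ hb] hy]]; split => //; rewrite /grid_index ha hb; congr (_, _).
    by apply/rowP => i; rewrite mxE; have [] := hy i I.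
  apply: measurableI; first exact: floor_measurable.
  apply: measurableI; first exact: floor_measurable.
  apply: fin_bigcap_measurable => // i _; exact: floor_measurable.
apply: filterS cG => x cG Dx.
have h : (fun k => (grid_point k (Num.floor (u x * k.+1%:R)),
    grid_point k (Num.floor (v x * k.+1%:R)),
    \row_i grid_point k (Num.floor (w x 0 i * k.+1%:R)))) @ \oo --> (u x, v x, w x).
  apply: cvg_triple; [exact: grid_point_cvg|exact: grid_point_cvg|apply: cvg_row => i].
  by under eq_fun do rewrite mxE; exact: grid_point_cvg.
have HE : (fun k => H k (grid_index k u v w x) x) =
  (fun q : R * R * 'rV[R]_m => G x q.1.1 q.1.2 q.2 : R^o) \o
  (fun k => (grid_point k (Num.floor (u x * k.+1%:R)),
    grid_point k (Num.floor (v x * k.+1%:R)),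
    \row_i grid_point k (Num.floor (w x 0 i * k.+1%:R)))).
  by apply/funext => k /=; rewrite /H /=; congr G; apply/rowP => i; rewrite !mxE.
by rewrite HE; exact: (@cvg_comp _ _ _ _ _ _ _ _ h (cG Dx (u x, v x, w x))).
Qed.

End Caratheodory.

(** * Coercivity and semicontinuity of the integral of G *)

Section Superposition.
Context d (T : measurableType d) (R : realType) (mu : {measure set T -> \bar R})
  (D : set T) (mD : measurable D) (finD : (mu D < +oo)%E)
  (cmu : measure_is_complete mu) (m : nat) (M : set 'rV[R]_m).
Implicit Types (u v : T -> R) (w : T -> 'rV[R]_m) (W : nat -> T -> 'rV[R]_m).
Local Notation Int f := (Rintegral mu D f).
Local Notation q f := (iprod mu D f f).
Local Notation L2 := (L2 mu D).
Local Notation rint := (rint mu D).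

Definition control w := (forall i, measurable_fun D (fun x => w x 0 i)) /\
  {ae mu, forall x, D x -> M (w x)}.

(** The subsequence form of convergence in measure, directly usable after any earlier extraction;
    [Lp_vcvg_ae_subsequence] derives it from L^p convergence. *)
Definition ae_subsequence W w := forall kappa : nat -> nat, kappa @ \oo --> \oo ->
  exists2 l : nat -> nat, {homo l : i j / (i < j)%N} &
    {ae mu, forall x, D x -> (fun j => W (kappa (l j)) x) @ \oo --> w x}.

Context (X : set (T -> R)) (X_L2 : forall u, X u -> L2 u).
Context (G : T -> R -> R -> 'rV[R]_m -> R) (lam0 : R).
Hypothesis Gmeas : forall a b y, measurable_fun D (fun x => G x a b y).
Hypothesis Gcont : {ae mu, forall x, D x ->
  continuous (fun q : R * R * 'rV[R]_m => G x q.1.1 q.1.2 q.2 : R^o)}.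
Hypothesis Glow : forall u, X u -> exists (b : R) (beta gamma : T -> R),
  [/\ 2 * b < lam0, L2 beta, rint gamma &
   {ae mu, forall x, D x -> forall (t : R) y, M y ->
     - b * `|t| ^+ 2 - beta x * t - gamma x <= G x (u x) t y}].
Hypothesis lam0_gt0 : 0 < lam0.

Definition superpose w u v := Int (fun x => G x (u x) (v x) (w x)).

Hypothesis Gint : forall u v w, X u -> X v -> control w ->
  rint (fun x => G x (u x) (v x) (w x)).

Lemma lower_bound_int (b : R) (beta gamma : T -> R) v : L2 beta -> rint gamma -> L2 v ->
  rint (fun x => b * v x ^+ 2 + beta x * v x + gamma x) /\
  Int (fun x => b * v x ^+ 2 + beta x * v x + gamma x) =
  b * q v + iprod mu D beta v + Int gamma.
Proof.
move=> hb hg hv.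
have r1 : rint (fun x => b * v x ^+ 2) by apply: rintZ => //; case: hv.
have r2 : rint (fun x => beta x * v x) by exact: L2_mul.
have r12 := rintD mD r1 r2.
split; first exact: rintD.
rewrite RintegralD // RintegralD // RintegralZl //; last by case: hv.
Qed.

(** Half of the gap between [b] and [lam0 / 2] is given up to absorb the linear term. The constants
    come from [Glow] at [u] alone, hence hold for all controls. *)
Lemma superpose_coercive u : X u -> exists c C : R, [/\ 0 <= c, c < lam0 / 2 &
  forall w v, control w -> X v -> - c * q v - C <= superpose w u v].
Proof.
move=> Xu; have [b [beta [gamma [blam hb hg low]]]] := Glow Xu.
pose b' := Num.max 0 b.
(* Replacing [b] by [max 0 b] makes the final coefficient nonnegative; it still lies below
   [lam0 / 2] since [lam0] is positive. *)
have b'0 : 0 <= b' by rewrite le_max lexx.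
have bb' : b <= b' by rewrite le_max lexx orbT.
have b'lam : 2 * b' < lam0.
  by rewrite /b' maxEle; case: ifP => _; rewrite ?mulr0.
pose delta := (lam0 / 2 - b') / 2.
have d0 : 0 < delta by rewrite /delta; lra.
exists (b' + delta), (q beta / (4 * delta) + Int gamma); split; [lra|rewrite /delta; lra|].
move=> w v [mw Mw] Xv; have hv := X_L2 Xv.
have [r1 E1] := lower_bound_int b hb hg hv.
have le : - Int (fun x => b * v x ^+ 2 + beta x * v x + gamma x) <= superpose w u v.
  rewrite -IntN //; apply: le_Int_ae => //; first exact: rintN.
    by apply: Gint.
  move: low Mw; apply: filterS2 => x low Mx Dx.
  have := low Dx (v x) (w x) (Mx Dx).
  by rewrite real_normK ?num_real //; lra.
apply: le_trans le; rewrite E1.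
have qv := iprod_ge0 mu D v; have qb := iprod_ge0 mu D beta.
(* Young's inequality, read off from the nonnegative squared norm of [beta - 2 delta v]. *)
have cs : iprod mu D beta v <= delta * q v + q beta / (4 * delta).
  have := iprod_ge0 mu D (fun x => beta x - (2 * delta) * v x).
  rewrite iprod_sqrB //; last exact: L2Z.
  rewrite iprodZl ?iprodZr //; try exact: L2Z.
  have d4 : 0 < 4 * delta by lra.
  move=> h; rewrite -(ler_pM2l d4) mulrDr.
  have -> : 4 * delta * (q beta / (4 * delta)) = q beta by rewrite mulrC divfK // gt_eqF.
  lra.
have : b * q v <= b' * q v by rewrite ler_wpM2r.
lra.
Qed.

Lemma frequently_subsequence (P : nat -> Prop) : ~ (\forall j \near \oo, P j) ->
  exists2 f : nat -> nat, {homo f : i j / (i < j)%N} & forall j, ~ P (f j).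
Proof.
move=> nP; apply: (@subsequence_of (fun _ j => ~ P j)) => _ i0.
apply: contrapT => no; apply: nP; exists i0.+1 => // j /= i0j.
by apply: contrapT => nPj; apply: no; exists j.
Qed.

(** Along a sequence violating the claim, further extraction makes controls and states converge
    almost everywhere. Fatou's lemma applies once the quadratic minorant is subtracted, and the
    integrals of the minorant converge because [s] converges strongly in L^2. *)
Lemma superpose_lsc W w (kappa : nat -> nat) u v (s : nat -> T -> R) (e : R) :
  (forall k, control (W k)) -> control w -> ae_subsequence W w ->
  kappa @ \oo --> \oo -> X u -> X v -> (forall j, X (s j)) -> L2cvg mu D s v -> 0 < e ->
  \forall j \near \oo, superpose w u v - e <= superpose (W (kappa j)) u (s j).
Proof.
move=> cW cw Ww kinf Xu Xv Xs sv e0; apply: contrapT => /frequently_subsequence[f fi fP].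
have finf := increasing_infty fi.
have kf : (kappa \o f) @ \oo --> \oo := @cvg_comp _ _ _ f kappa _ _ _ finf kinf.
have [l li lW] := Ww _ kf.
have linf := increasing_infty li.
have sfl : L2cvg mu D (fun j => s (f (l j))) v.
  exact: (@cvg_comp _ _ _ (f \o l) _ _ _ _ (@cvg_comp _ _ _ l f _ _ _ linf finf) sv).
have [k ki ks] := L2cvg_ae_subsequence mD (fun j => X_L2 (Xs _)) (X_L2 Xv) sfl.
have kinf' := increasing_infty ki.
pose g := f \o l \o k.
have sg : L2cvg mu D (fun j => s (g j)) v.
  exact: (@cvg_comp _ _ _ k _ _ _ _ kinf' sfl).
have Wg : {ae mu, forall x, D x -> (fun j => W (kappa (g j)) x) @ \oo --> w x}.
  apply: filterS lW => x lW Dx.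
  exact: (@cvg_comp _ _ _ k _ _ _ _ kinf' (lW Dx)).
have [b [beta [gamma [_ hb hg low]]]] := Glow Xu.
(* Minus the lower bound of [Glow]: adding it makes the integrands nonnegative almost everywhere. *)
pose P t x := b * t ^+ 2 + beta x * t + gamma x : R.
have rP z : X z -> rint (fun x => P (z x) x).
  by move=> Xz; have [] := lower_bound_int b hb hg (X_L2 Xz).
have IP z : X z -> Int (fun x => P (z x) x) = b * q z + iprod mu D beta z + Int gamma.
  by move=> Xz; have [] := lower_bound_int b hb hg (X_L2 Xz).
have limP : (fun j => Int (fun x => P (s (g j) x) x)) @ \oo --> Int (fun x => P (v x) x).
  rewrite IP // (_ : (fun j => _) = fun j => b * q (s (g j)) + iprod mu D beta (s (g j)) + Int gamma);
    last by apply/funext => j; exact: IP.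
  apply: cvgD; last exact: cvg_cst.
  apply: cvgD; last by apply: (L2cvg_iprod mD _ _ hb sg) => [j|]; exact: X_L2.
  by apply: cvgMl_tmp; apply: (L2cvg_sqr mD _ _ sg) => [j|]; exact: X_L2.
have e2 : 0 < e / 2 by lra.
(* [fatou_ge0] wants a bound for every index, hence the shift by [J]. Of the violation [e], half
   pays for the integrals of [P]; the other half contradicts Fatou. *)
have /cvgrPdist_le/(_ _ e2)[J _ hJ] := limP.
have rG j := Gint Xu (Xs (g (j + J)%N)) (cW (kappa (g (j + J)%N))).
have rPs j := rP _ (Xs (g (j + J)%N)).
have rGv := Gint Xu Xv cw.
have [] := @fatou_ge0 _ _ _ mu D mD
  (fun j x => G x (u x) (s (g (j + J)%N) x) (W (kappa (g (j + J)%N)) x) + P (s (g (j + J)%N) x) x)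
  (fun x => G x (u x) (v x) (w x) + P (v x) x)
  (superpose w u v + Int (fun x => P (v x) x) - e / 2).
- by move=> j; exact: (rintD mD (rG j) (rPs j)).
- exact: (rint_measurable (rintD mD rGv (rP _ Xv))).
- move: ks Wg Gcont; apply: filterS3 => x ks Wg cG Dx.
  have h : (fun j => (u x, s (g j) x, W (kappa (g j)) x)) @ \oo --> (u x, v x, w x).
    by apply: cvg_triple; [exact: cvg_cst|exact: ks|exact: Wg].
  have hG := @cvg_comp _ _ _ _ _ _ _ _ h (cG Dx (u x, v x, w x)).
  have hP : (fun j => P (s (g j) x) x) @ \oo --> P (v x) x.
    apply: cvgD; last exact: cvg_cst.
    apply: cvgD; apply: cvgMl_tmp; last exact: ks.
    by rewrite expr2; under eq_fun do rewrite expr2; exact: (cvgM (ks Dx) (ks Dx)).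
  have := cvgD hG hP; rewrite -(cvg_shiftn J); exact.
- move=> j; have [_ Mw] := cW (kappa (g (j + J)%N)).
  move: low Mw; apply: filterS2 => x low Mx Dx.
  have := low Dx (s (g (j + J)%N) x) _ (Mx Dx).
  by rewrite real_normK ?num_real // /P; lra.
- move=> j; rewrite (RintegralD mD (rG j) (rPs j)).
  have := fP (l (k (j + J)%N)); rewrite -/(g (j + J)%N) => /negP; rewrite -ltNge.
  have := hJ (j + J)%N (leq_addl _ _); rewrite /= ler_norml => /andP[h1 h2].
  rewrite /superpose; lra.
move=> _; rewrite (RintegralD mD rGv (rP _ Xv)).
by rewrite /superpose; lra.
Qed.

End Superposition.

(** * Eigenfunctions and fractional spaces *)

Section Bridge.
Context (R : realType) (n : nat) (Omega : set 'rV[R]_n).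
Local Notation V := 'rV[R]_n.
Local Notation T := (caratheodory_type (@lebesgue_outer R n)).
Local Notation mu := (lebesgue R n).
Hypothesis mO : measurable (Omega : set T).
Implicit Types (f g : V -> R).
Local Notation q f := (iprod mu Omega f f).

Lemma Lp_fun_measurable p f : Lp_fun Omega p f -> measurable_fun (Omega : set T) (f : T -> R).
Proof.
rewrite /Lp_fun inE => /andP[]; rewrite inE /= => mf _.
by apply/(measurable_restrictT _ mO).
Qed.

Lemma Lp_fun1_rint f : Lp_fun Omega 1%:E f -> rint mu Omega f.
Proof.
move=> /Lfun1_integrable h; apply/(integrable_mkcond _ mO); move: h.
by congr integrable; apply/funext => x; rewrite !patchE /=; case: ifP => //; rewrite patchE => ->.
Qed.

Lemma Lnorm2E f : measurable_fun (Omega : set T) (f : T -> R) ->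
  Lp_norm Omega 2%:E f =
  (((\int[mu]_(x in Omega) (f x ^+ 2)%:E) : \bar R) `^ 2^-1)%E.
Proof.
move=> mf; rewrite /Lp_norm unlock; congr (_ `^ _)%E.
rewrite [RHS]integral_mkcond; apply: eq_integral => x _ /=.
rewrite !patchE; case: ifP => _.
  by rewrite -[f x ^+ 2]real_normK ?num_real // -powR_mulrn.
by rewrite normr0 powR0 // pnatr_eq0.
Qed.

Lemma L2_Lp_fun f : L2 mu Omega f -> Lp_fun Omega 2%:E f.
Proof.
move=> [mf rf]; rewrite /Lp_fun inE; apply/andP; split.
  by rewrite inE /=; apply/(measurable_restrictT _ mO).
rewrite inE /= /finite_norm -/(Lp_norm Omega 2%:E f) Lnorm2E //.
by rewrite rint_integral // poweR_EFin ltry.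
Qed.

Lemma Lp_fun_L2 f : Lp_fun Omega 2%:E f -> L2 mu Omega f.
Proof.
move=> h; split; first exact: Lp_fun_measurable h.
apply/(integrable_mkcond _ mO); move: (Lfun2_integrable_sqr h).
congr integrable; apply/funext => x; rewrite patchE /=; case: ifPn => xO.
  by rewrite patchE xO.
by rewrite patchE (negbTE xO) expr0n.
Qed.

Lemma Lp_norm2 f : L2 mu Omega f -> Lp_norm Omega 2%:E f = (Num.sqrt (q f))%:E.
Proof.
move=> [mf rf]; rewrite Lnorm2E // rint_integral // poweR_EFin powR12_sqrt.
  by [].
by apply: Rintegral_ge0 => x _; exact: sqr_ge0.
Qed.

Lemma Lp_norm2_cvg (f : nat -> V -> R) : (forall j, L2 mu Omega (f j)) ->
  (fun j => Lp_norm Omega 2%:E (f j)) @ \oo --> 0%E <->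
  (fun j => q (f j)) @ \oo --> 0.
Proof.
move=> hf.
have -> : (fun j => Lp_norm Omega 2%:E (f j)) = fun j => (Num.sqrt (q (f j)))%:E.
  by apply/funext => j; exact: Lp_norm2.
have q0 j : 0 <= q (f j) := iprod_ge0 mu Omega (f j).
split=> [h|h].
  have h1 := fine_cvg h.
  have h2 : (fun j => Num.sqrt (q (f j)) * Num.sqrt (q (f j))) @ \oo --> (0 * 0 : R).
    by apply: cvgM; exact: h1.
  rewrite mulr0 in h2; move: h2.
  by under eq_fun do rewrite -expr2 sqr_sqrtr //.
apply: cvg_EFin; first exact: nearW.
rewrite -(@sqrtr0 R); apply: (@continuous_cvg _ _ _ _ _ (fun j => q (f j)) Num.sqrt 0) => //.
exact: sqrt_continuous.
Qed.

End Bridge.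

Lemma cvg_sum (R : realType) (I : finType) (F : I -> nat -> R) (l : I -> R) :
  (forall i, F i @ \oo --> l i) -> (fun j => \sum_i F i j) @ \oo --> \sum_i l i.
Proof.
move=> h; elim: (index_enum I) => [|i r IH].
  by rewrite big_nil; under eq_fun do rewrite big_nil; exact: cvg_cst.
by rewrite big_cons; under eq_fun do rewrite big_cons; apply: cvgD; [exact: h|exact: IH].
Qed.

Section Bessel.
Context d (T : measurableType d) (R : realType) (mu : {measure set T -> \bar R})
  (D : set T) (mD : measurable D) (finD : (mu D < +oo)%E).
Variable (e : nat -> T -> R).
Hypotheses (eL2 : forall k, L2 mu D (e k)).
Hypothesis (eO : forall j k, iprod mu D (e j) (e k) = (j == k)%:R).
Local Notation q f := (iprod mu D f f).

Definition partial_sum (a : nat -> R) (N : nat) : T -> R :=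
  fun x => \sum_(k < N) a k * e k x.

Lemma partial_sum_L2 a N : L2 mu D (partial_sum a N).
Proof. by apply: (L2_sum mD finD (F := fun k x => a k * e k x)) => k; exact: L2Z. Qed.

Lemma iprod_partial_sum a N h : L2 mu D h ->
  iprod mu D (partial_sum a N) h = \sum_(k < N) a k * iprod mu D (e k) h.
Proof.
move=> hh; rewrite /partial_sum (iprod_suml mD finD (F := fun k x => a k * e k x)) //.
  by apply: eq_bigr => k _; rewrite iprodZl.
by move=> k; exact: L2Z.
Qed.

Lemma iprod_partial_sum_basis a N j : iprod mu D (partial_sum a N) (e j) =
  if (j < N)%N then a j else 0.
Proof.
rewrite iprod_partial_sum //; under eq_bigr do rewrite eO.
case: ifPn => jN.
  rewrite (bigD1 (Ordinal jN)) //= eqxx mulr1 big1 ?addr0 // => k kj.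
  by rewrite (_ : _ == _ = false) ?mulr0 //; apply/negbTE; apply: contraNN kj => /eqP kj; apply/eqP/val_inj.
apply: big1 => k _; rewrite (_ : _ == _ = false) ?mulr0 //.
by apply/negbTE; apply: contraNN jN => /eqP <-; exact: ltn_ord.
Qed.

Lemma sqr_partial_sum a N : q (partial_sum a N) = \sum_(k < N) a k ^+ 2.
Proof.
rewrite iprod_partial_sum; last exact: partial_sum_L2.
apply: eq_bigr => k _; rewrite iprodC iprod_partial_sum_basis ltn_ord.
by rewrite expr2.
Qed.

Lemma sqr_sub_partial_sum f N : L2 mu D f ->
  q (fun x => f x - partial_sum (fun k => iprod mu D f (e k)) N x) =
  q f - \sum_(k < N) iprod mu D f (e k) ^+ 2.
Proof.
move=> hf; rewrite iprod_sqrB //; last exact: partial_sum_L2.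
rewrite sqr_partial_sum iprodC iprod_partial_sum //.
rewrite (eq_bigr (fun k : 'I_N => iprod mu D f (e k) ^+ 2)); first by ring.
by move=> k _; rewrite (iprodC _ _ (e k)) expr2.
Qed.

Lemma bessel f N : L2 mu D f -> \sum_(k < N) iprod mu D f (e k) ^+ 2 <= q f.
Proof.
move=> hf; have := sqr_sub_partial_sum N hf.
by have := iprod_ge0 mu D (fun x => f x - partial_sum (fun k => iprod mu D f (e k)) N x); lra.
Qed.

End Bessel.

(** * Positivity and divergence of the Dirichlet eigenvalues *)

Section DirichletSpectrum.
Context (R : realType) (n : nat) (Omega : set 'rV[R]_n).
Local Notation V := 'rV[R]_n.
Local Notation T := (caratheodory_type (@lebesgue_outer R n)).
Local Notation mu := (lebesgue R n).
Hypotheses (bOmega : bounded_set Omega) (oOmega : open Omega).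
Implicit Types (f u : V -> R).
Local Notation q f := (iprod mu Omega f f).
Local Notation L2 := (L2 mu Omega).

Let mO : measurable (Omega : set T) := Omega_measurable oOmega.
Let fO : (mu Omega < +oo)%E := Omega_lty bOmega.

Lemma H10_approximation u g : H10_with_gradient Omega u g ->
  [/\ L2 u, forall i, L2 (g i) & exists phi : nat -> V -> R,
    [/\ forall j, test_function Omega (phi j), L2cvg mu Omega phi u &
        forall i, L2cvg mu Omega (fun j => partial i (phi j)) (g i)]].
Proof.
move=> [/(Lp_fun_L2 mO) hu hg _ [phi [tphi cu cg]]].
have hgi i : L2 (g i) by exact: Lp_fun_L2.
split => //; exists phi; split => //.
  apply/(Lp_norm2_cvg mO); last exact: cu.
  by move=> j; apply: L2B; [exact: mO|exact: test_L2|exact: hu].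
move=> i; apply/(Lp_norm2_cvg mO); last exact: cg.
by move=> j; apply: L2B => //; exact: test_partial_L2.
Qed.

(** The weak equation is available for test functions only; evaluated along those approximating [u]
    in H^1_0, it gives in the limit that the Dirichlet integral of [u] is [lambda]. *)
Lemma eigen_gradient u lambda : dirichlet_eigen Omega u lambda -> q u = 1 ->
  L2 u /\ exists phi : nat -> V -> R, exists g : 'I_n -> V -> R,
    [/\ forall j, test_function Omega (phi j), L2cvg mu Omega phi u,
      forall i, L2 (g i) /\ L2cvg mu Omega (fun j => partial i (phi j)) (g i) &
      \sum_i q (g i) = lambda].
Proof.
move=> [g /H10_approximation[hu hg [phi [tphi cu cg]]] weak] u1.
split => //; exists phi, g; split => //.
have l1 : (fun j => \sum_i iprod mu Omega (g i) (partial i (phi j))) @ \oo --> \sum_i q (g i).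
  apply: (cvg_sum (F := fun i j => iprod mu Omega (g i) (partial i (phi j)))) => i.
  by apply: L2cvg_iprod => // j; exact: test_partial_L2.
have l2 : (fun j => lambda * iprod mu Omega u (phi j)) @ \oo --> lambda * q u.
  apply: cvgMl_tmp; apply: L2cvg_iprod => // j; exact: test_L2.
have e12 : (fun j => \sum_i iprod mu Omega (g i) (partial i (phi j))) =
    (fun j => lambda * iprod mu Omega u (phi j)).
  by apply/funext => j; exact: weak.
rewrite e12 in l1; rewrite (cvg_unique _ l1 l2) ?u1 ?mulr1 //.
Qed.

Lemma eigen_poincare (i0 : 'I_n) : exists2 C, 0 < C &
  forall u lambda, dirichlet_eigen Omega u lambda -> q u = 1 -> 1 <= C * lambda.
Proof.
have [C C0 hC] := test_poincare bOmega i0; exists C => // u lambda eu u1.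
have [hu [phi [g [tphi cu cg gl]]]] := eigen_gradient eu u1.
have [hg cgi] := cg i0.
have h1 := L2cvg_sqr mO (fun j => test_L2 bOmega oOmega (tphi j)) hu cu.
have h2 := L2cvg_sqr mO (fun j => test_partial_L2 bOmega oOmega i0 (tphi j)) hg cgi.
apply: (@le_trans _ _ (C * q (g i0))).
  rewrite -u1; apply: (ler_cvg_to h1 (cvgMl_tmp (a := C) h2)).
  by apply: nearW => j; exact: hC.
rewrite ler_pM2l // -gl (bigD1 i0) //= lerDl.
by apply: sumr_ge0 => i _; exact: iprod_ge0.
Qed.

Lemma eigen_finite_rank (eta : R) : 0 < eta -> exists N (h : 'I_N -> V -> R),
  (forall b, L2 (h b) /\ q (h b) <= 1) /\
  forall u lambda, dirichlet_eigen Omega u lambda -> q u = 1 ->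
    1 <= \sum_b iprod mu Omega u (h b) ^+ 2 + eta * lambda.
Proof.
move=> eta0; have [N [h [hh hC]]] := finite_rank_poincare bOmega oOmega eta0.
exists N, h; split => // u lambda eu u1.
have [hu [phi [g [tphi cu cg gl]]]] := eigen_gradient eu u1.
have tL2 j := test_L2 bOmega oOmega (tphi j).
have h1 := L2cvg_sqr mO tL2 hu cu.
have h2 : (fun j => \sum_b iprod mu Omega (phi j) (h b) ^+ 2 +
    eta * \sum_i iprod mu Omega (partial i (phi j)) (partial i (phi j))) @ \oo -->
    \sum_b iprod mu Omega u (h b) ^+ 2 + eta * \sum_i q (g i).
  apply: cvgD.
    apply: (cvg_sum (F := fun b j => iprod mu Omega (phi j) (h b) ^+ 2)) => b.
    have [hb _] := hh b; rewrite expr2; under eq_fun do rewrite expr2.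
    have hi : (fun j => iprod mu Omega (phi j) (h b)) @ \oo --> iprod mu Omega u (h b).
      by rewrite iprodC; under eq_fun do rewrite iprodC; exact: L2cvg_iprod.
    exact: cvgM.
  apply: cvgMl_tmp.
  apply: (cvg_sum (F := fun i j => iprod mu Omega (partial i (phi j)) (partial i (phi j)))) => i.
  have [hgi cgi] := cg i; apply: L2cvg_sqr => // j; exact: test_partial_L2.
rewrite -u1 -gl; apply: (ler_cvg_to h1 h2).
by apply: nearW => j; exact: hC.
Qed.

Section Eigensystem.
Variables (z : nat -> V -> R) (rho : nat -> R).
Hypothesis hz : dirichlet_eigensystem Omega z rho.

Lemma eigen_L2 k : L2 (z k).
Proof. by have [h _ _ _] := hz; have [g [/(Lp_fun_L2 mO)]] := h k. Qed.

Lemma eigen_orthonormal j k : iprod mu Omega (z j) (z k) = (j == k)%:R.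
Proof. by have [_ h _ _] := hz; exact: h. Qed.

Lemma eigenvalue0_gt0 (i0 : 'I_n) : 0 < rho 0%N.
Proof.
have [C C0 hC] := eigen_poincare i0; have [h _ _ _] := hz.
have := hC _ _ (h 0%N) (eigen_orthonormal 0 0).
have [r0|//] := leP (rho 0%N) 0 => h1; exfalso.
have : C * rho 0%N <= 0 by rewrite pmulr_rle0.
lra.
Qed.

Lemma eigenvalue_infty (L : R) : exists K, forall k, (K <= k)%N -> L < rho k.
Proof.
wlog L0 : L / 0 < L.
  move=> H; have L1 : 0 < Num.max L 1 by rewrite lt_max ltr01 orbT.
  have [K hK] := H _ L1.
  by exists K => k /hK; rewrite gt_max => /andP[].
apply: contrapT => no.
have [|f fi fP] := @subsequence_of (fun _ k => rho k <= L).
  move=> _ i0; apply: contrapT => no2; apply: no; exists i0.+1 => k i0k.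
  by rewrite ltNge; apply/negP => kL; apply: no2; exists k.
have eta0 : 0 < (2 * L)^-1 by rewrite invr_gt0 mulr_gt0.
have [N [h [hh hC]]] := eigen_finite_rank eta0.
have [eig _ _ _] := hz.
pose e k := z (f k).
have finj i j : (f i == f j) = (i == j).
  by case: (ltngtP i j) => [/fi|/fi|->]; [case: ltngtP|case: ltngtP|rewrite eqxx].
have eO j k : iprod mu Omega (e j) (e k) = (j == k)%:R by rewrite eigen_orthonormal finj.
have eL2 k : L2 (e k) by exact: eigen_L2.
have low k : 2^-1 <= \sum_b iprod mu Omega (e k) (h b) ^+ 2.
  have ek : q (e k) = 1 by rewrite eO eqxx.
  have := hC _ _ (eig (f k)) ek; rewrite -/(e k).
  have : (2 * L)^-1 * rho (f k) <= (2 * L)^-1 * L by rewrite ler_pM2l.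
  have -> : (2 * L)^-1 * L = 2^-1 by rewrite invfM -mulrA mulVf ?mulr1 // gt_eqF.
  lra.
(* Exchanging the sums, Bessel's inequality bounds the right side by [N], one unit per [h b], while
   the left side is [N + 1/2]. *)
have : \sum_(k < (2 * N).+1) 2^-1 <= \sum_(k < (2 * N).+1) \sum_b iprod mu Omega (e k) (h b) ^+ 2.
  exact: ler_sum.
rewrite exchange_big /= leNgt => /negP; apply.
apply: (@le_lt_trans _ _ (\sum_(b < N) 1)).
  apply: ler_sum => b _; have [hb1 hb2] := hh b; apply: le_trans hb2.
  under eq_bigr do rewrite iprodC.
  exact: bessel.
rewrite !sumr_const !card_ord -[X in _ < X]mulr_natr -[(2 * N).+1%:R]natr1 natrM.
lra.
Qed.

End Eigensystem.

End DirichletSpectrum.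

(** * Functions and their coefficient sequences *)

Section FractionalCoefficients.
Context (R : realType) (n : nat) (Omega : set 'rV[R]_n).
Local Notation V := 'rV[R]_n.
Local Notation T := (caratheodory_type (@lebesgue_outer R n)).
Local Notation mu := (lebesgue R n).
Hypotheses (bOmega : bounded_set Omega) (oOmega : open Omega) (i0 : 'I_n).
Variables (z : nat -> V -> R) (rho : nat -> R) (alpha : R).
Hypotheses (hz : dirichlet_eigensystem Omega z rho) (alpha_gt0 : 0 < alpha).
Implicit Types (f g u v : V -> R) (a b : nat -> R).
Local Notation q f := (iprod mu Omega f f).
Local Notation L2 := (L2 mu Omega).
Local Notation coef := (coef Omega z).
Local Notation psum := (@partial_sum _ T R z).

Let mO : measurable (Omega : set T) := Omega_measurable oOmega.
Let fO : (mu Omega < +oo)%E := Omega_lty bOmega.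
Let zL2 k : L2 (z k) := eigen_L2 oOmega hz k.
Let zO j k : iprod mu Omega (z j) (z k) = (j == k)%:R := eigen_orthonormal hz j k.

Definition weight k : R := rho k `^ (alpha / 2).
Local Notation lam := weight.

Let rho0_gt0 : 0 < rho 0%N := eigenvalue0_gt0 bOmega oOmega hz i0.
Let rho_ge k : rho 0%N <= rho k.
Proof. by have [_ _ _ h] := hz; exact: h. Qed.
Let rho_gt0 k : 0 < rho k := lt_le_trans rho0_gt0 (rho_ge k).

Lemma weight_gt0 k : 0 < lam k.
Proof. exact: powR_gt0. Qed.

Lemma weight_ge k : lam 0%N <= lam k.
Proof.
by apply: ge0_ler_powR; rewrite ?nnegrE ?divr_ge0 ?(ltW alpha_gt0) ?(ltW (rho_gt0 _)).
Qed.

Lemma weight_infty (L : R) : exists K, forall k, (K <= k)%N -> L <= lam k.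
Proof.
pose L' := Num.max 1 L.
have L'0 : 0 <= L' by rewrite le_max ler01.
have [K hK] := eigenvalue_infty bOmega oOmega hz (L' `^ (2 / alpha)).
exists K => k /hK lt; apply: (@le_trans _ _ L'); first by rewrite le_max lexx orbT.
have -> : L' = (L' `^ (2 / alpha)) `^ (alpha / 2).
  rewrite -powRrM mulrA divfK ?gt_eqF // divff // powRr1 //.
apply: ge0_ler_powR; rewrite ?nnegrE ?divr_ge0 ?powR_ge0 ?(ltW alpha_gt0) //.
  exact: ltW.
exact: ltW.
Qed.

Lemma coefE u k : coef u k = iprod mu Omega u (z k).
Proof. by []. Qed.

Lemma expansionP a f : L2 f -> L2_expansion Omega z a f <->
  (fun N => q (fun x => f x - psum a N x)) @ \oo --> 0.
Proof.
move=> hf; have hs N : L2 (fun x => f x - psum a N x).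
  by apply: L2B => //; exact: partial_sum_L2.
split=> [[_ h]|h]; first by apply/(Lp_norm2_cvg mO hs).
by split; [exact: L2_Lp_fun | apply/(Lp_norm2_cvg mO hs)].
Qed.

Lemma expansion_coef a f : L2 f -> L2_expansion Omega z a f -> coef f = a.
Proof.
move=> hf /(expansionP _ hf) h; apply/funext => k.
have hs N : L2 (psum a N) by exact: partial_sum_L2.
have h' : L2cvg mu Omega (fun N => psum a N) f.
  rewrite /L2cvg (_ : (fun N => _) = fun N => q (fun x => f x - psum a N x)) //.
  by apply/funext => N; apply: eq_Int => x _; ring.
have h1 := L2cvg_iprod mO hs hf (zL2 k) h'.
have h2 : (fun N => iprod mu Omega (z k) (psum a N)) @ \oo --> a k.
  apply: cvg_near_cst; exists k.+1 => // N /= kN.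
  by rewrite iprodC iprod_partial_sum_basis // kN.
by rewrite coefE iprodC; exact: cvg_unique h1 h2.
Qed.

Lemma L2_expand u : L2 u -> L2_expansion Omega z (coef u) u.
Proof. by move=> hu; have [_ _ h _] := hz; apply: h; exact: L2_Lp_fun. Qed.

Lemma parseval u : L2 u -> (fun N => \sum_(k < N) coef u k ^+ 2) @ \oo --> q u.
Proof.
move=> hu; have /(expansionP _ hu) h := L2_expand hu.
have h2 : (fun N => q u - q (fun x => u x - psum (coef u) N x)) @ \oo --> q u - 0.
  by apply: cvgB => //; exact: cvg_cst.
rewrite subr0 in h2; move: h2.
under eq_fun do rewrite (sqr_sub_partial_sum mO fO zL2 zO) //.
by under eq_fun do rewrite opprB addrCA subrr addr0.
Qed.

(** By orthonormality the squared distance of two partial sums is a difference of partial sums of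
    the [a k ^+ 2], so [riesz_fischer] applies. *)
Lemma realize_l2 a c : (forall N, \sum_(k < N) a k ^+ 2 <= c) ->
  exists2 u, L2 u & L2_expansion Omega z a u.
Proof.
move=> ac.
have hs N : L2 (psum a N) by exact: partial_sum_L2.
pose S N := \sum_(k < N) a k ^+ 2.
have S_nd : {homo S : i j / (i <= j)%N >-> i <= j}.
  apply/nondecreasing_seqP => j; rewrite /S big_ord_recr /= lerDl; exact: sqr_ge0.
have Scvg : cvgn S.
  by apply: nondecreasing_is_cvgn => //; exists c => _ [N _ <-]; exact: ac.
have diffE i j : (i <= j)%N -> q (fun x => psum a i x - psum a j x) = S j - S i.
  move=> ij; have cross : iprod mu Omega (psum a i) (psum a j) = S i.
    rewrite iprod_partial_sum //; apply: eq_bigr => k _.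
    by rewrite iprodC iprod_partial_sum_basis // (leq_trans (ltn_ord k) ij) expr2.
  by rewrite iprod_sqrB // cross !sqr_partial_sum // -/(S i) -/(S j); ring.
have [|u hu cu] := @riesz_fischer _ _ _ mu Omega mO fO (fun N => psum a N) hs.
  move=> e e0; have e2 : 0 < e by [].
  have /cvgrPdist_lt/(_ _ e2)[K _ hK] := Scvg.
  exists K => i j Ki Kj.
  have le k : (K <= k)%N -> limn S - S k < e.
    by move=> Kk; have := hK k Kk; rewrite /= ltr_norml => /andP[].
  have up k : S k <= limn S by apply: nondecreasing_cvgn_le.
  case: (leqP i j) => ij.
    by rewrite diffE //; have := le _ Ki; have := up j; lra.
  have -> : q (fun x => psum a i x - psum a j x) =
            q (fun x => psum a j x - psum a i x).
    by apply: eq_Int => x _; ring.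
  by rewrite diffE ?(ltnW ij) //; have := le _ Kj; have := up i; lra.
exists u => //; apply/expansionP => //; move: cu; rewrite /L2cvg.
rewrite (_ : (fun j => _) = fun N => q (fun x => u x - psum a N x)) //.
by apply/funext => N; apply: eq_Int => x _; ring.
Qed.

Lemma sum_coef_le a N : wspace lam a ->
  \sum_(k < N) a k ^+ 2 <= wreal lam a / lam 0%N.
Proof.
move=> Ha; rewrite ler_pdivlMr ?weight_gt0 // mulr_suml.
apply: le_trans (wsum_le weight_gt0 N Ha); rewrite /wsum big_mkord.
by apply: ler_sum => k _; rewrite ler_wpM2l ?sqr_ge0 // weight_ge.
Qed.

(** Beyond [K] the weights are at least [L], so the high modes are controlled by the fractional
    norm. [K = 0] gives the continuous embedding in L^2, large [K] its compactness. *)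
Lemma sqr_coef_tail u K (L : R) : L2 u -> wspace lam (coef u) -> 0 < L ->
  (forall k, (K <= k)%N -> L <= lam k) ->
  q u <= \sum_(k < K) coef u k ^+ 2 + wreal lam (coef u) / L.
Proof.
move=> hu Hu L0 hK; apply: (cvgr_to_le (parseval hu)).
exists K => // N /= KN.
rewrite -(big_mkord xpredT (fun k => coef u k ^+ 2)) (big_cat_nat (leq0n K) KN) /=.
rewrite big_mkord lerD2l ler_pdivlMr //.
apply: le_trans (wsum_le weight_gt0 N Hu).
rewrite /wsum (big_cat_nat (leq0n K) KN) /= -[leLHS]add0r lerD //.
  by apply: sumr_ge0 => k _; rewrite mulr_ge0 ?sqr_ge0 // ltW // weight_gt0.
rewrite mulr_suml [leLHS]big_nat [leRHS]big_nat; apply: ler_sum => k /andP[Kk _].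
by rewrite ler_wpM2l ?sqr_ge0 // hK.
Qed.

Lemma sqr_coef_le u : L2 u -> wspace lam (coef u) -> q u <= wreal lam (coef u) / lam 0%N.
Proof.
move=> hu Hu; have := @sqr_coef_tail u 0 (lam 0%N) hu Hu (weight_gt0 0).
by rewrite big_ord0 add0r; apply=> k _; exact: weight_ge.
Qed.

Lemma HfracP u : Hfrac Omega z rho alpha u <-> L2 u /\ wspace lam (coef u).
Proof.
split=> [[[hu _] Hu]|[hu Hu]].
  by split; [exact: Lp_fun_L2 | exact: Hu].
by split; [exact: L2_expand | exact: Hu].
Qed.

Lemma coef_comb (s t : R) u v : L2 u -> L2 v ->
  coef (fun x => s * u x + t * v x) = wadd (wscale s (coef u)) (wscale t (coef v)).
Proof.
move=> hu hv; apply/funext => k; rewrite /wadd /wscale !coefE.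
by rewrite (iprodDl mO (L2Z mO s hu) (L2Z mO t hv) (zL2 k)) (iprodZl mO s hu (zL2 k)) (iprodZl mO t hv (zL2 k)).
Qed.

Lemma coef_sub u v : L2 u -> L2 v ->
  coef (fun x => u x - v x) = wsub (coef u) (coef v).
Proof. by move=> hu hv; apply/funext => k; rewrite /wsub !coefE iprodBl. Qed.

Lemma realize_spec a : wspace lam a -> exists u, L2 u /\ coef u = a.
Proof.
move=> Ha; have [u hu eu] := @realize_l2 a _ (fun N => sum_coef_le N Ha).
by exists u; split => //; exact: expansion_coef.
Qed.

(* Determined up to a null set, and junk if no function has coefficients a. *)
Definition realize a : V -> R := xget (fun=> 0) [set u | L2 u /\ coef u = a].

Lemma realizeP a : wspace lam a -> L2 (realize a) /\ coef (realize a) = a.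
Proof.
by move=> /realize_spec[u hu]; rewrite /realize; case: xgetP => [_ _ //|/(_ u)].
Qed.

Lemma realize_Hfrac a : wspace lam a -> Hfrac Omega z rho alpha (realize a).
Proof. by move=> Ha; apply/HfracP; have [h1 ->] := realizeP Ha. Qed.

Lemma coef_inj_ae u v : L2 u -> L2 v -> coef u = coef v ->
  {ae mu, forall x, Omega x -> u x = v x}.
Proof.
move=> hu hv uv; have hB := L2B mO hu hv.
have q0 : q (fun x => u x - v x) = 0.
  have h1 := parseval hB; apply: (cvg_unique _ h1) => //.
  rewrite (_ : (fun N => _) = fun=> 0); first exact: cvg_cst.
  apply/funext => N; apply: big1 => k _.
  by rewrite coef_sub // uv /wsub subrr expr0n.
have [mB rB] := hB.
have : (\int[mu]_(x in (Omega : set T)) `|((u x - v x) ^+ 2)%:E| = 0)%E.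
  rewrite (eq_integral (fun x : T => ((u x - v x) ^+ 2)%:E)); last first.
    by move=> x _; rewrite gee0_abs // lee_fin sqr_ge0.
  by rewrite rint_integral // -[RHS]/(0%:E) -q0.
have mB2 : measurable_fun (Omega : set T) (fun x : T => ((u x - v x) ^+ 2)%:E).
  by apply/measurable_EFinP; exact: rint_measurable rB.
move=> /(ae_eq_integral_abs mu mO mB2); apply: filterS => x h Ox.
by have := h Ox => -[] /eqP; rewrite sqrf_eq0 subr_eq0 => /eqP.
Qed.

(** The compact embedding: the finitely many low coordinates of the difference tend to 0, and the
    tail is uniformly small because the weights tend to infinity. *)
Lemma realize_cvg (s : nat -> nat -> R) a c : (forall j, wspace lam (s j)) ->
  (forall j, wreal lam (s j) <= c) -> coordinatewise s a ->
  L2cvg mu Omega (fun j => realize (s j)) (realize a).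
Proof.
move=> Hs sc sa; have [Ha ac] := wspace_bounded_limit weight_gt0 sa Hs sc.
have [hTa cTa] := realizeP Ha.
have hT j := (realizeP (Hs j)).1; have cT j := (realizeP (Hs j)).2.
have hB j := L2B mO (hT j) hTa.
have cB j : coef (fun x => realize (s j) x - realize a x) = wsub (s j) a.
  by rewrite coef_sub // cT cTa.
have HB j : wspace lam (wsub (s j) a) := wspace_sub weight_gt0 (Hs j) Ha.
have wB j : wreal lam (wsub (s j) a) <= 4 * c.
  have := wreal_parallelogram weight_gt0 (Hs j) Ha.
  have := wreal_ge0 weight_gt0 (wadd (s j) a); have := sc j; lra.
apply/cvgrPdist_le => e e0.
have c0 : 0 <= c by apply: le_trans (wreal_ge0 weight_gt0 _) ac.
(* The difference has squared norm at most [4 c], so its tail is at most [4 c / L], below [e / 2];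
   the summand 1 keeps [L] positive when [c = 0]. *)
pose L := 8 * (c + 1) / e; have L0 : 0 < L by rewrite divr_gt0 // mulr_gt0 //; lra.
have [K hK] := weight_infty L.
have e2 : 0 < e / 2 by lra.
have lim0 : (fun j => \sum_(k < K) wsub (s j) a k ^+ 2) @ \oo --> \sum_(k < K) (0 : R).
  apply: (@cvg_sum _ _ (fun (k : 'I_K) j => wsub (s j) a k ^+ 2) (fun=> 0)) => k.
  have h : (fun j => wsub (s j) a k) @ \oo --> 0.
    by rewrite -(subrr (a k)); apply: cvgB; [exact: sa | exact: cvg_cst].
  have := cvgM h h; rewrite mulr0 => hh.
  by under eq_fun do rewrite expr2; exact: hh.
rewrite big1 // in lim0.
have /cvgrPdist_le/(_ _ e2) := lim0; apply: filterS => j.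
rewrite !sub0r !normrN !ger0_norm ?iprod_ge0 ?sumr_ge0 // => [le|? _]; last exact: sqr_ge0.
have Hcj : wspace lam (coef (fun x => realize (s j) x - realize a x)) by rewrite cB.
have := sqr_coef_tail (hB j) Hcj L0 hK; rewrite cB => le2.
have : wreal lam (wsub (s j) a) / L <= e / 2.
  rewrite ler_pdivrMr // /L.
  have -> : e / 2 * (8 * (c + 1) / e) = 4 * (c + 1) by field; rewrite gt_eqF.
  by have := wB j; lra.
lra.
Qed.

(** The square of [rho k] to the power [alpha / 4] is the weight, so the coefficients are square
    summable and [xget] finds a function; Parseval computes its norm. *)
Lemma frac_laplacian_spec u : Hfrac Omega z rho alpha u ->
  L2 (frac_laplacian Omega z rho (alpha / 4) u) /\
  q (frac_laplacian Omega z rho (alpha / 4) u) = wreal lam (coef u).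
Proof.
move=> /HfracP[hu Hu]; pose a k := coef u k * rho k `^ (alpha / 4).
have a2 k : a k ^+ 2 = coef u k ^+ 2 * lam k.
  rewrite /a exprMn; congr (_ * _); rewrite expr2 -powRD; last first.
    by rewrite (gt_eqF (rho_gt0 k)) implybT.
  by rewrite /weight; congr powR; field.
have sumE N : \sum_(k < N) a k ^+ 2 = wsum lam N (coef u).
  by rewrite /wsum big_mkord; apply: eq_bigr => k _; exact: a2.
have [N|f hf ef] := @realize_l2 a (wreal lam (coef u)).
  by rewrite sumE; exact: wsum_le weight_gt0 _ _ Hu.
rewrite /frac_laplacian; case: xgetP => [g _ eg|/(_ f) //].
have hg : L2 g by apply: Lp_fun_L2 => //; case: eg.
split => //; have cg := expansion_coef hg eg.
have h1 := parseval hg; rewrite cg in h1.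
apply: (cvg_unique _ h1) => //.
rewrite (_ : (fun N => _) = fun N => wsum lam N (coef u)); last first.
  by apply/funext => N; exact: sumE.
exact: wsum_cvg weight_gt0 _ Hu.
Qed.

End FractionalCoefficients.

(** * The energy as a function of the coefficients *)

Section EnergyOnCoefficients.
Context (R : realType) (n m : nat) (Omega : set 'rV[R]_n).
Local Notation V := 'rV[R]_n.
Local Notation T := (caratheodory_type (@lebesgue_outer R n)).
Local Notation mu := (lebesgue R n).
Hypotheses (bOmega : bounded_set Omega) (oOmega : open Omega) (i0 : 'I_n).
Variables (z : nat -> V -> R) (rho : nat -> R) (alpha : R).
Hypotheses (hz : dirichlet_eigensystem Omega z rho) (alpha_gt0 : 0 < alpha).
Variables (M : set 'rV[R]_m) (G : V -> R -> R -> 'rV[R]_m -> R).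
Local Notation L2 := (L2 mu Omega).
Local Notation coef := (coef Omega z).
Local Notation Hf := (Hfrac Omega z rho alpha).
Local Notation lam := (weight rho alpha).
Local Notation real := (realize Omega z).
Hypothesis carG : caratheodory_fun G Omega.
Hypothesis A3 : forall u, Hf u ->
  exists (b : R) (beta1 gamma1 : V -> R),
    [/\ 2 * b < rho 0%N `^ (alpha / 2),
        Lp_fun Omega 2%:E beta1, Lp_fun Omega 1%:E gamma1 &
        {ae mu, forall x, Omega x -> forall (v : R) (y : 'rV[R]_m), M y ->
          - b * `|v| ^+ 2 - beta1 x * v - gamma1 x <= G x (u x) v y}].
Hypothesis A4 : forall v, Hf v ->
  exists (B : R) (beta2 gamma2 : V -> R),
    [/\ 2 * B < rho 0%N `^ (alpha / 2),
        Lp_fun Omega 2%:E beta2, Lp_fun Omega 1%:E gamma2 &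
        {ae mu, forall x, Omega x -> forall (u : R) (y : 'rV[R]_m), M y ->
          G x u (v x) y <= B * `|u| ^+ 2 + beta2 x * u + gamma2 x}].

Let mO : measurable (Omega : set T) := Omega_measurable oOmega.
Let fO : (mu Omega < +oo)%E := Omega_lty bOmega.
Let cmu : measure_is_complete mu := @lebesgue_complete R n.
#[local] Instance ae_lebesgue_filter : Filter (nbhs (almost_everywhere mu)).
Proof. exact: ae_filter_ringOfSetsType. Qed.
Let lam_gt0 := weight_gt0 bOmega oOmega i0 alpha hz.
Let HfL2 u : Hf u -> L2 u.
Proof. by move=> /(HfracP oOmega alpha hz)[]. Qed.

Local Notation ctrl := (control mu (Omega : set T) M).
Local Notation swapG := (fun x a b y => - G x b a y).

Let Glow u : Hf u -> exists (b : R) (beta gamma : T -> R),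
  [/\ 2 * b < lam 0%N, L2 beta, rint mu Omega gamma &
   {ae mu, forall x, Omega x -> forall (t : R) y, M y ->
     - b * `|t| ^+ 2 - beta x * t - gamma x <= G x (u x) t y}].
Proof.
move=> /A3[b [beta [gamma [h1 h2 h3 h4]]]]; exists b, beta, gamma; split => //.
  exact: Lp_fun_L2.
exact: Lp_fun1_rint.
Qed.

(** (A4) for [G] is (A3) for [swapG]; this makes everything on the concave side an instance of the
    convex side. *)
Let swapGlow u : Hf u -> exists (b : R) (beta gamma : T -> R),
  [/\ 2 * b < lam 0%N, L2 beta, rint mu Omega gamma &
   {ae mu, forall x, Omega x -> forall (t : R) y, M y ->
     - b * `|t| ^+ 2 - beta x * t - gamma x <= swapG x (u x) t y}].
Proof.
move=> /A4[b [beta [gamma [h1 h2 h3 h4]]]]; exists b, beta, gamma; split => //.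
- exact: Lp_fun_L2.
- exact: Lp_fun1_rint.
- apply: filterS h4 => x h Ox t y My; have := h Ox t y My; lra.
Qed.

Let Gmeas a b y : measurable_fun (Omega : set T) (fun x : T => G x a b y).
Proof. by case: carG => h _; exact: h. Qed.

Let Gcont : {ae mu, forall x, Omega x ->
  continuous (fun q : R * R * 'rV[R]_m => G x q.1.1 q.1.2 q.2 : R^o)}.
Proof. by case: carG. Qed.

Let swapGcont : {ae mu, forall x, Omega x ->
  continuous (fun q : R * R * 'rV[R]_m => swapG x q.1.1 q.1.2 q.2 : R^o)}.
Proof.
apply: filterS Gcont => x h Ox q.
apply: (@cvgN _ R^o).
have sw : (fun q : R * R * 'rV[R]_m => (q.1.2, q.1.1, q.2)) @ q --> (q.1.2, q.1.1, q.2).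
  have c1 : (fun q : R * R * 'rV[R]_m => q.1) @ q --> q.1 by exact: cvg_fst.
  have c2 : (fun q : R * R * 'rV[R]_m => q.2) @ q --> q.2 by exact: cvg_snd.
  have c11 : (fun q : R * R * 'rV[R]_m => q.1.1) @ q --> q.1.1.
    exact: (@cvg_comp _ _ _ fst fst _ _ _ c1 cvg_fst).
  have c12 : (fun q : R * R * 'rV[R]_m => q.1.2) @ q --> q.1.2.
    exact: (@cvg_comp _ _ _ fst snd _ _ _ c1 cvg_snd).
  exact: (@cvg_pair _ _ _ (nbhs q) (nbhs (q.1.2, q.1.1)) (nbhs q.2) _ _ _
    (fun q => (q.1.2, q.1.1)) snd
    (@cvg_pair _ _ _ (nbhs q) (nbhs q.1.2) (nbhs q.1.1) _ _ _
       (fun q => q.1.2) (fun q => q.1.1) c12 c11) c2).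
exact: (@cvg_comp _ _ _ _ _ _ _ _ sw (h Ox (q.1.2, q.1.1, q.2))).
Qed.

(** (A3) at [u] bounds the integrand below by a quadratic in [v], and (A4) at [v] bounds it above by
    a quadratic in [u]; both are integrable. *)
Let Gint u v w : Hf u -> Hf v -> ctrl w ->
  rint mu Omega (fun x : T => G x (u x) (v x) (w x)).
Proof.
move=> Hu Hv [mw Mw].
have hu := HfL2 Hu; have hv := HfL2 Hv.
have [b [beta [gamma [_ hb hg low]]]] := Glow Hu.
have [B [beta2 [gamma2 [_ hb2 hg2 up]]]] := swapGlow Hv.
have [r1 _] := lower_bound_int mO b hb hg hv.
have [r2 _] := lower_bound_int mO B hb2 hg2 hu.
have r := rintD mO (rint_norm mO r1) (rint_norm mO r2).
apply: (rint_ae_le mO _ r).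
  by apply: (caratheodory_measurable mO cmu) => //; [case: hu|case: hv].
move: low up Mw; apply: filterS3 => x low up Mx Ox.
have h1 := low Ox (v x) _ (Mx Ox); have h2 := up Ox (u x) _ (Mx Ox).
rewrite !real_normK ?num_real // in h1 h2.
rewrite [leRHS]ger0_norm ?addr_ge0 // ler_norml.
have := ler_norm (b * v x ^+ 2 + beta x * v x + gamma x).
have := ler_norm (B * u x ^+ 2 + beta2 x * u x + gamma2 x).
have := normr_ge0 (b * v x ^+ 2 + beta x * v x + gamma x).
have := normr_ge0 (B * u x ^+ 2 + beta2 x * u x + gamma2 x).
by move=> *; apply/andP; split; lra.
Qed.

Let swapGint u v w : Hf u -> Hf v -> ctrl w ->
  rint mu Omega (fun x : T => swapG x (u x) (v x) (w x)).
Proof. by move=> Hu Hv cw; apply: rintN => //; exact: Gint. Qed.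

Definition potential (w : V -> 'rV[R]_m) (a b : nat -> R) : R :=
  superpose mu (Omega : set T) G w (real a) (real b).

Let potential_swap w a b : wspace lam a -> wspace lam b -> ctrl w ->
  - potential w b a = superpose mu (Omega : set T) swapG w (real a) (real b).
Proof.
move=> Ha Hb cw; rewrite /potential /superpose -IntN //.
by apply: Gint => //; exact: (realize_Hfrac bOmega oOmega i0 hz alpha_gt0).
Qed.

Let realHf a : wspace lam a -> Hf (real a).
Proof. exact: realize_Hfrac. Qed.

Lemma potential_lsc (W : nat -> V -> 'rV[R]_m) w : (forall k, ctrl (W k)) -> ctrl w ->
  ae_subsequence mu (Omega : set T) W w ->
  lsc_along lam (fun j => potential (W j)) (potential w).
Proof.
move=> cW cw Ww kappa kinf a s b c e Ha Hs Nc sb e0.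
have [Hb _] := wspace_bounded_limit lam_gt0 sb Hs Nc.
have sv := realize_cvg bOmega oOmega i0 hz alpha_gt0 Hs Nc sb.
exact: (superpose_lsc mO HfL2 Gcont Glow Gint cW cw Ww kinf (realHf Ha) (realHf Hb)
  (fun j => realHf (Hs j)) sv e0).
Qed.

Lemma potential_usc (W : nat -> V -> 'rV[R]_m) w : (forall k, ctrl (W k)) -> ctrl w ->
  ae_subsequence mu (Omega : set T) W w ->
  lsc_along lam (flip (fun j => potential (W j))) (flip1 (potential w)).
Proof.
move=> cW cw Ww kappa kinf a s b c e Ha Hs Nc sb e0.
have [Hb _] := wspace_bounded_limit lam_gt0 sb Hs Nc.
have sv := realize_cvg bOmega oOmega i0 hz alpha_gt0 Hs Nc sb.
have := (superpose_lsc mO HfL2 swapGcont swapGlow swapGint cW cw Ww kinf (realHf Ha) (realHf Hb)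
  (fun j => realHf (Hs j)) sv e0).
by apply: filterS => j; rewrite /flip /flip1 !potential_swap.
Qed.

(** An L^2 bound with constant [c] below [lam 0 / 2] becomes a margin [1/2 - c / lam 0] for the
    fractional norm, since [lam 0] times the squared L^2 norm is at most that norm squared. *)
Let coercive_weight (J : nat -> (nat -> R) -> (nat -> R) -> R) :
  (forall a, wspace lam a -> exists c C : R, [/\ 0 <= c, c < lam 0%N / 2 &
    forall j b, wspace lam b -> - c * iprod mu Omega (real b) (real b) - C <= J j a b]) ->
  coercive_along lam J.
Proof.
move=> H a Ha; have [c [C [c0 cl h]]] := H a Ha.
have l0 := lam_gt0 0%N.
exists (2^-1 - c / lam 0%N), C; split.
  by rewrite subr_gt0 ltr_pdivrMr //; lra.
move=> j b Hb; apply: le_trans (h j b Hb); rewrite lerD2r.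
have [hb cb] := realizeP bOmega oOmega i0 hz alpha_gt0 Hb.
have Hcb : wspace lam (coef (real b)) by rewrite cb.
have := sqr_coef_le bOmega oOmega i0 hz alpha_gt0 hb Hcb; rewrite cb => le.
have -> : - (2^-1 - (2^-1 - c / lam 0%N)) = - (c / lam 0%N) by ring.
rewrite !mulNr lerN2.
have -> : c / lam 0%N * wreal lam b = c * (wreal lam b / lam 0%N) by rewrite mulrAC mulrA.
by rewrite ler_wpM2l.
Qed.

Lemma potential_coercive (W : nat -> V -> 'rV[R]_m) : (forall k, ctrl (W k)) ->
  coercive_along lam (fun j => potential (W j)).
Proof.
move=> cW; apply: coercive_weight => a Ha.
have [c [C [c0 cl h]]] := superpose_coercive mO HfL2 Glow (lam_gt0 0%N) Gint (realHf Ha).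
by exists c, C; split => // j b Hb; apply: h => //; exact: realHf.
Qed.

Lemma potential_anticoercive (W : nat -> V -> 'rV[R]_m) : (forall k, ctrl (W k)) ->
  coercive_along lam (flip (fun j => potential (W j))).
Proof.
move=> cW; apply: coercive_weight => a Ha.
have [c [C [c0 cl h]]] := superpose_coercive mO HfL2 swapGlow (lam_gt0 0%N) swapGint (realHf Ha).
exists c, C; split => // j b Hb; rewrite /flip potential_swap //.
by apply: h => //; exact: realHf.
Qed.

(** [u] and [v] agree only almost everywhere with the realizations of their coefficients used by
    [potential], which leaves the integral unchanged. *)
Lemma energyE w u v : Hf u -> Hf v -> ctrl w ->
  energy Omega z rho alpha G w u v =
  saddle_functional lam (potential w) (coef u) (coef v).
Proof.
move=> Hu Hv cw.
have [lu qu] := frac_laplacian_spec bOmega oOmega i0 hz Hu.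
have [lv qv] := frac_laplacian_spec bOmega oOmega i0 hz Hv.
have rG := Gint Hu Hv cw.
rewrite /energy /saddle_functional.
set fu := frac_laplacian _ _ _ _ u in lu qu *.
set fv := frac_laplacian _ _ _ _ v in lv qv *.
clearbody fu fv.
have ru : rint mu Omega (fun x : T => fu x ^+ 2) := lu.2.
have rv : rint mu Omega (fun x : T => fv x ^+ 2) := lv.2.
have hu : rint mu Omega (fun x : T => 2^-1 * fu x ^+ 2) := rintZ mO _ ru.
have hv : rint mu Omega (fun x : T => 2^-1 * fv x ^+ 2) := rintZ mO _ rv.
rewrite (@eq_Int _ T R mu Omega _ (fun x : T =>
    (2^-1 * fv x ^+ 2 - 2^-1 * fu x ^+ 2) + G x (u x) (v x) (w x))); last first.
  by move=> x _; rewrite !real_normK ?num_real.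
rewrite (RintegralD mO (rintB mO hv hu) rG) (RintegralB mO hv hu).
rewrite (RintegralZl _ mO ru) (RintegralZl _ mO rv).
have sqE (f : T -> R) :
    Rintegral mu (Omega : set T) (fun x => f x ^+ 2) = iprod mu Omega f f.
  by apply: (@eq_Int _ T R mu) => x _; rewrite expr2.
rewrite (sqE fu) (sqE fv) qu qv.
have /(HfracP oOmega alpha hz)[hLu Hcu] := Hu.
have /(HfracP oOmega alpha hz)[hLv Hcv] := Hv.
have [hu' cu'] := realizeP bOmega oOmega i0 hz alpha_gt0 Hcu.
have [hv' cv'] := realizeP bOmega oOmega i0 hz alpha_gt0 Hcv.
have aeu := coef_inj_ae bOmega oOmega hz hLu hu' (esym cu').
have aev := coef_inj_ae bOmega oOmega hz hLv hv' (esym cv').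
have -> : Rintegral mu (Omega : set T) (fun x => G x (u x) (v x) (w x)) =
    potential w (coef u) (coef v).
  apply: (@ae_eq_Int _ T R mu Omega mO (fun x => G x (u x) (v x) (w x))
    (fun x => G x (real (coef u) x) (real (coef v) x) (w x))).
  - exact: rint_measurable rG.
  - exact: rint_measurable (Gint (realHf Hcu) (realHf Hcv) cw).
  - by move: aeu aev; apply: filterS2 => x eu ev Ox; rewrite eu // ev.
by congr (_ - _ + _); rewrite mulrC.
Qed.

Let functionalE w a b : wspace lam a -> wspace lam b -> ctrl w ->
  saddle_functional lam (potential w) a b =
  energy Omega z rho alpha G w (real a) (real b).
Proof.
move=> Ha Hb cw; rewrite (energyE (realHf Ha) (realHf Hb) cw).
have [_ ->] := realizeP bOmega oOmega i0 hz alpha_gt0 Ha.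
by have [_ ->] := realizeP bOmega oOmega i0 hz alpha_gt0 Hb.
Qed.

Let comb_Hf (s t : R) a b : wspace lam a -> wspace lam b ->
  Hf (fun x => s * real a x + t * real b x) /\
  coef (fun x => s * real a x + t * real b x) = wadd (wscale s a) (wscale t b).
Proof.
move=> Ha Hb; have [ha ca] := realizeP bOmega oOmega i0 hz alpha_gt0 Ha.
have [hb cb] := realizeP bOmega oOmega i0 hz alpha_gt0 Hb.
have cE := coef_comb oOmega hz s t ha hb.
rewrite ca cb in cE; split => //.
apply/(HfracP oOmega alpha hz); rewrite cE; split.
  exact: (@L2D _ T R mu Omega mO (fun x => s * real a x) (fun x => t * real b x)
    (L2Z mO s ha) (L2Z mO t hb)).
exact: (wspace_add lam_gt0 (wspace_scale lam_gt0 s Ha) (wspace_scale lam_gt0 t Hb)).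
Qed.

Lemma functional_concave w : ctrl w ->
  (forall v, Hf v -> concave_on_Hfrac Omega z rho alpha
     (fun u => energy Omega z rho alpha G w u v)) ->
  forall a1 a2 b (t : R), wspace lam a1 -> wspace lam a2 -> wspace lam b -> 0 <= t <= 1 ->
  t * saddle_functional lam (potential w) a1 b +
  (1 - t) * saddle_functional lam (potential w) a2 b <=
  saddle_functional lam (potential w) (wadd (wscale t a1) (wscale (1 - t) a2)) b.
Proof.
move=> cw conc a1 a2 b t H1 H2 Hb t01.
rewrite (functionalE H1 Hb cw) (functionalE H2 Hb cw).
apply: le_trans (conc _ (realHf Hb) _ _ _ (realHf H1) (realHf H2) t01) _.
have [Hc cE] := comb_Hf t (1 - t) H1 H2.
by rewrite (energyE Hc (realHf Hb) cw) cE (realizeP bOmega oOmega i0 hz alpha_gt0 Hb).2.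
Qed.

Lemma functional_convex w : ctrl w ->
  (forall u, Hf u -> convex_on_Hfrac Omega z rho alpha
     (fun v => energy Omega z rho alpha G w u v)) ->
  forall a b1 b2 (t : R), wspace lam a -> wspace lam b1 -> wspace lam b2 -> 0 <= t <= 1 ->
  saddle_functional lam (potential w) a (wadd (wscale t b1) (wscale (1 - t) b2)) <=
  t * saddle_functional lam (potential w) a b1 +
  (1 - t) * saddle_functional lam (potential w) a b2.
Proof.
move=> cw conv a b1 b2 t Ha H1 H2 t01.
rewrite (functionalE Ha H1 cw) (functionalE Ha H2 cw).
apply: le_trans (conv _ (realHf Ha) _ _ _ (realHf H1) (realHf H2) t01).
have [Hc cE] := comb_Hf t (1 - t) H1 H2.
by rewrite (energyE (realHf Ha) Hc cw) cE (realizeP bOmega oOmega i0 hz alpha_gt0 Ha).2.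
Qed.

End EnergyOnCoefficients.

Lemma powR_cvg0 (R : realType) (x : nat -> R) (s : R) : 0 < s -> (forall j, 0 <= x j) ->
  x @ \oo --> 0 -> (fun j => x j `^ s) @ \oo --> 0.
Proof.
move=> s0 x0 cx; apply/cvgrPdist_le => e e0.
have d0 : 0 < e `^ s^-1 by exact: powR_gt0.
have /cvgrPdist_le/(_ _ d0) := cx; apply: filterS => j.
rewrite !sub0r !normrN !ger0_norm ?powR_ge0 // => h.
have -> : e = (e `^ s^-1) `^ s by rewrite -powRrM mulVf ?gt_eqF // powRr1 // ltW.
by apply: ge0_ler_powR; rewrite ?nnegrE ?powR_ge0 // ltW.
Qed.

(** * From convergence of controls in L^p to convergence almost everywhere *)

Section ControlConvergence.
Context (R : realType) (n m : nat) (Omega : set 'rV[R]_n).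
Local Notation V := 'rV[R]_n.
Local Notation T := (caratheodory_type (@lebesgue_outer R n)).
Local Notation mu := (lebesgue R n).
Hypothesis (mO : measurable (Omega : set T)) (fO : (mu Omega < +oo)%E).
Variable (M : set 'rV[R]_m).
Hypothesis bM : bounded_set M.
Implicit Types (w : V -> 'rV[R]_m) (y : 'rV[R]_m).

#[local] Instance ae_lebesgue_filter' : Filter (nbhs (almost_everywhere mu)).
Proof. exact: ae_filter_ringOfSetsType. Qed.

Local Notation ctrl := (control mu (Omega : set T) M).

Lemma admissible_control_control p w : admissible_control Omega p M w -> ctrl w.
Proof. by move=> [h1 h2]; split; [move=> i; exact: (Lp_fun_measurable mO (h1 i))|exact: h2]. Qed.

Lemma coord_le_enorm y i : `|y 0 i| <= enorm y.
Proof.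
rewrite /enorm -(@ler_pXn2r _ 2) ?nnegrE ?sqrtr_ge0 // sqr_sqrtr.
  rewrite real_normK ?num_real // /dot (bigD1 i) //= -expr2 lerDl.
  by apply: sumr_ge0 => j _; rewrite -expr2 sqr_ge0.
by apply: sumr_ge0 => j _; rewrite -expr2 sqr_ge0.
Qed.

Lemma enorm_bounded : exists2 C, 0 <= C & forall y y', M y -> M y' -> enorm (y - y') <= C.
Proof.
move: bM; rewrite /bounded_set /bounded_near => /pinfty_ex_gt0[B B0 /= hB].
exists (Num.sqrt (\sum_(i < m) (2 * B) ^+ 2)); first exact: sqrtr_ge0.
move=> y y' My My'; apply: ler_wsqrtr; apply: ler_sum => i _.
rewrite -expr2 -[leLHS]real_normK ?num_real // lerXn2r ?nnegrE ?mulr_ge0 ?(ltW B0) //.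
rewrite !mxE; apply: le_trans (ler_normB _ _) _.
have := le_trans (coord_le_norm y i) (hB _ My).
have := le_trans (coord_le_norm y' i) (hB _ My'); lra.
Qed.

Lemma enorm_measurable w w' : ctrl w -> ctrl w' ->
  measurable_fun (Omega : set T) (fun x : T => enorm (w x - w' x)).
Proof.
move=> [mw _] [mw' _]; rewrite /enorm /dot.
apply: (@measurableT_comp _ _ _ _ _ _ (@Num.sqrt R)).
  by apply: continuous_measurable_fun; exact: sqrt_continuous.
apply: measurable_sum => i; apply: measurable_funM.
  by under eq_fun do rewrite !mxE; apply: measurable_funB; [exact: mw|exact: mw'].
by under eq_fun do rewrite !mxE; apply: measurable_funB; [exact: mw|exact: mw'].
Qed.

Lemma cvg_of_enorm (s : nat -> 'rV[R]_m) y :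
  (fun j => enorm (s j - y)) @ \oo --> 0 -> s @ \oo --> y.
Proof.
move=> h; apply: cvg_row => i; apply/cvgrPdist_le => e e0.
have /cvgrPdist_le/(_ _ e0) := h; apply: filterS => j.
rewrite sub0r normrN ger0_norm ?sqrtr_ge0 //; apply: le_trans.
by have := coord_le_enorm (s j - y) i; rewrite !mxE distrC.
Qed.

(** For finite [p], boundedness of [M] makes the powers of the differences integrable, and they tend
    to 0 in L^1. For [p = +oo] the norms bound the differences off one null set and no extraction is
    made. *)
Lemma Lp_vcvg_ae_subsequence p (w : nat -> V -> 'rV[R]_m) : (1 <= p)%E ->
  (forall k, ctrl (w k)) -> Lp_vcvg Omega p w (w 0%N) ->
  ae_subsequence mu (Omega : set T) (fun k => w k.+1) (w 0%N).
Proof.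
move=> p1 cw wc kappa kinf.
pose g j x := enorm (w (kappa j).+1 x - w 0%N x).
have g0 j x : 0 <= g j x by exact: sqrtr_ge0.
have mg j : measurable_fun (Omega : set T) (g j : T -> R).
  exact: enorm_measurable.
have gc : (fun j => Lp_norm Omega p (g j)) @ \oo --> 0%E.
  have kS : (fun j => (kappa j).+1) @ \oo --> \oo.
    apply/cvgnyPge => A; have /cvgnyPge/(_ A) := kinf.
    by apply: filterS => j /leq_trans; apply.
  exact: (@cvg_comp _ _ _ (fun j => (kappa j).+1) _ _ _ _ kS wc).
suff [l li lae] : exists2 l : nat -> nat, {homo l : i j / (i < j)%N} &
    {ae mu, forall x, Omega x -> (fun j => g (l j) x) @ \oo --> 0}.
  by exists l => //; apply: filterS lae => x lx Ox; apply: cvg_of_enorm; exact: lx.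
case: p p1 wc gc => [r| |] // p1 wc gc.
- have r1 : 1 <= r by rewrite -lee_fin.
  have r0 : 0 < r by lra.
  have [C C0 hC] := enorm_bounded.
  pose h j x := g j x `^ r.
  have mh j : measurable_fun (Omega : set T) (h j : T -> R).
    by apply: (@measurableT_comp _ _ _ _ _ _ (fun t : R => t `^ r)) => //; exact: measurable_powR.
  have rh j : rint mu (Omega : set T) (h j : T -> R).
    apply: (rint_ae_le mO (mh j) (rint_cst mO fO (C `^ r))).
    have [_ M1] := cw (kappa j).+1; have [_ M2] := cw 0%N.
    move: M1 M2; apply: filterS2 => x M1 M2 Ox.
    rewrite !ger0_norm ?powR_ge0 //; apply: ge0_ler_powR; rewrite ?nnegrE //; first lra.
    by apply: hC; [exact: M1|exact: M2].
  have I0 j : 0 <= Rintegral mu (Omega : set T) (h j).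
    by apply: Rintegral_ge0 => x _; exact: powR_ge0.
  have NE j : Lp_norm Omega r%:E (g j) = (Rintegral mu (Omega : set T) (h j) `^ r^-1)%:E.
    rewrite /Lp_norm unlock -poweR_EFin -(rint_integral mO (rh j)); congr (_ `^ _)%E.
    rewrite [RHS]integral_mkcond; apply: eq_integral => x _ /=.
    rewrite !patchE; case: ifP => _; first by rewrite ger0_norm.
    by rewrite normr0 powR0 // gt_eqF.
  have Ic : (fun j => Rintegral mu (Omega : set T) (fun x => `|h j x|)) @ \oo --> 0.
    have cI : (fun j => Rintegral mu (Omega : set T) (h j) `^ r^-1) @ \oo --> 0.
      rewrite [X in X @ _](_ : _ = fun j => fine (Lp_norm Omega r%:E (g j))); last first.
        by apply/funext => j; rewrite NE.
      exact: fine_cvg gc.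
    rewrite [X in X @ _](_ : _ = fun j => (Rintegral mu (Omega : set T) (h j) `^ r^-1) `^ r).
      exact: powR_cvg0 r0 (fun j => powR_ge0 _ _) cI.
    apply/funext => j; rewrite -powRrM mulVf ?gt_eqF // powRr1 //.
    by apply: (@eq_Int _ T R mu) => x _; rewrite ger0_norm ?powR_ge0.
  have [l li lae] := subsequence_ae_cvg0 mO rh Ic.
  exists l => //; apply: filterS lae => x lx Ox.
  have rV0 : 0 < r^-1 by rewrite invr_gt0.
  rewrite [X in X @ _](_ : _ = fun j => (h (l j) x) `^ r^-1).
    exact: powR_cvg0 rV0 (fun j => powR_ge0 _ _) (lx Ox).
  by apply/funext => j; rewrite -powRrM divff ?gt_eqF // powRr1.
- exists id => //.
  (* The supremum norm is defined by cases on [0 < mu setT]; if the whole space had measure 0, any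
     statement would hold almost everywhere. *)
  have [mu0|mu0] := boolP (0 < mu setT)%E; last first.
    exists setT; split; [exact: measurableT| |by []].
    by apply/eqP; rewrite eq_le measure_ge0 andbT leNgt.
  pose f j := (fun x : T => abse (((g j : T -> R) \_ (Omega : set T)) x)%:E).
  have gf j : {ae mu, forall x, (f j x <= Lp_norm Omega +oo (g j))%E}.
    rewrite /Lp_norm unlock mu0; exact: ess_sup_ge.
  have := ae_foralln gf.
  have /fine_cvgP[Nfin /cvgrPdist_le Nc] := gc.
  apply: filterS => x h Ox; apply/cvgrPdist_le => e e0.
  move: Nfin (Nc e e0); apply: filterS2 => j Nf.
  rewrite !sub0r !normrN => Ne; apply: le_trans Ne; apply: le_trans (ler_norm _).
  have := h j; rewrite -[X in (_ <= X)%E]fineK // lee_fin /f patchE mem_set //.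
Qed.

End ControlConvergence.

(** * Topology of pairs and saddle sets *)

Section WeightedQuasiTriangle.
Context (R : realType) (lam : nat -> R).
Hypothesis lam_gt0 : forall k, 0 < lam k.

(** Young's inequality term by term. It replaces the triangle inequality for squared norms, and a
    small [t] keeps the first factor close to 1. *)
Lemma wreal_add_le (t : R) a b : 0 < t -> wspace lam a -> wspace lam b ->
  wreal lam (wadd a b) <= (1 + t) * wreal lam a + (1 + t^-1) * wreal lam b.
Proof.
move=> t0 Ha Hb; have tV0 : 0 < t^-1 by rewrite invr_gt0.
apply: (wspace_bound lam_gt0 _).2 => K.
have step : wsum lam K (wadd a b) <= (1 + t) * wsum lam K a + (1 + t^-1) * wsum lam K b.
  rewrite /wsum !mulr_sumr -big_split /=; apply: ler_sum => k _.
  rewrite !mulrA -mulrDl ler_wpM2r ?(ltW (lam_gt0 k)) // /wadd.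
  have := mulr_ge0 (ltW tV0) (sqr_ge0 (t * a k - b k)).
  have : t^-1 * t = 1 by rewrite mulVf ?gt_eqF.
  move: t^-1 => r rt; have -> : r * (t * a k - b k) ^+ 2 =
    (r * t) * (t * a k ^+ 2) - 2 * (r * t) * (a k * b k) + r * b k ^+ 2 by ring.
  rewrite rt => h; have -> : (a k + b k) ^+ 2 = a k ^+ 2 + 2 * (a k * b k) + b k ^+ 2 by ring.
  lra.
apply: le_trans step _; apply: lerD; apply: ler_wpM2l; rewrite ?wsum_le //; lra.
Qed.

Lemma wreal_subC a b : wspace lam a -> wspace lam b ->
  wreal lam (wsub a b) = wreal lam (wsub b a).
Proof.
move=> Ha Hb; rewrite (_ : wsub a b = wscale (- 1) (wsub b a)); last first.
  by apply/funext => k; rewrite /wsub /wscale; ring.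
by rewrite wreal_scale ?sqrrN ?expr1n ?mul1r //; exact: wspace_sub.
Qed.

End WeightedQuasiTriangle.

Section PairTopology.
Context (R : realType) (n : nat) (Omega : set 'rV[R]_n).
Local Notation V := 'rV[R]_n.
Hypotheses (bOmega : bounded_set Omega) (oOmega : open Omega) (i0 : 'I_n).
Variables (z : nat -> V -> R) (rho : nat -> R) (alpha : R).
Hypotheses (hz : dirichlet_eigensystem Omega z rho) (alpha_gt0 : 0 < alpha).
Local Notation Hf := (Hfrac Omega z rho alpha).
Local Notation lam := (weight rho alpha).
Local Notation pairT := (Hpair Omega z rho alpha).
Local Notation real := (realize Omega z).
Implicit Types p q x : pairT.
Let lam_gt0 := weight_gt0 bOmega oOmega i0 alpha hz.

Definition coef1 p := coef Omega z (sval p).1.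
Definition coef2 p := coef Omega z (sval p).2.

Definition pair_dist2 p q :=
  wreal lam (wsub (coef1 p) (coef1 q)) + wreal lam (wsub (coef2 p) (coef2 q)).

Lemma coef1_wspace p : wspace lam (coef1 p).
Proof. by have [Hu _] := svalP p; have /(HfracP oOmega alpha hz)[] := Hu. Qed.

Lemma coef2_wspace p : wspace lam (coef2 p).
Proof. by have [_ Hv] := svalP p; have /(HfracP oOmega alpha hz)[] := Hv. Qed.

Local Notation c1 := coef1_wspace.
Local Notation c2 := coef2_wspace.

Lemma pair_dist2_ge0 p q : 0 <= pair_dist2 p q.
Proof. by apply: addr_ge0; exact: wreal_ge0. Qed.

Lemma Hpair_distE p q : Hpair_dist p q = Num.sqrt (pair_dist2 p q).
Proof.
have [Hu Hv] := svalP p; have [Hu' Hv'] := svalP q.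
have /(HfracP oOmega alpha hz)[lu _] := Hu; have /(HfracP oOmega alpha hz)[lv _] := Hv.
have /(HfracP oOmega alpha hz)[lu' _] := Hu'; have /(HfracP oOmega alpha hz)[lv' _] := Hv'.
rewrite /Hpair_dist /pair_dist2 /coef1 /coef2.
by rewrite -(coef_sub oOmega hz lu lu') -(coef_sub oOmega hz lv lv').
Qed.

Lemma Hpair_dist_lt p q e : 0 < e -> (Hpair_dist p q < e) = (pair_dist2 p q < e ^+ 2).
Proof.
move=> e0; rewrite Hpair_distE -(@ltr_pXn2r _ 2) ?nnegrE ?sqrtr_ge0 ?ltW //.
by rewrite sqr_sqrtr ?pair_dist2_ge0.
Qed.

Lemma pair_dist2_triangle t p q r : 0 < t ->
  pair_dist2 p r <= (1 + t) * pair_dist2 p q + (1 + t^-1) * pair_dist2 q r.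
Proof.
move=> t0; have addE a b c : wsub a c = wadd (wsub a b) (wsub b c).
  by apply/funext => k; rewrite /wsub /wadd; ring.
rewrite /pair_dist2 (addE _ (coef1 p) (coef1 q)) (addE _ (coef2 p) (coef2 q)).
rewrite !mulrDr addrACA; apply: lerD.
  by apply: wreal_add_le => //; apply: wspace_sub => //; exact: c1.
by apply: wreal_add_le => //; apply: wspace_sub => //; exact: c2.
Qed.

(** Each of the two excess terms receives half of the gap [E - A]; the summand 1 in the denominator
    of [t] covers [A = 0]. *)
Lemma quasi_triangle_radius (A E : R) : 0 <= A -> A < E ->
  exists t d : R, [/\ 0 < t, 0 < d &
    forall D, D < d -> (1 + t) * A + (1 + t^-1) * D < E].
Proof.
move=> A0 AE; pose t := (E - A) / (2 * (A + 1)).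
have t0 : 0 < t by apply: divr_gt0; lra.
have tV0 : 0 < t^-1 by rewrite invr_gt0.
have tA : t * A <= (E - A) / 2.
  rewrite /t invfM mulrA -[leRHS]mulr1 -mulrA ler_wpM2l ?mulVf ?ler_pdivrMl; lra.
exists t, ((E - A) / 2 / (1 + t^-1)); split => //; first by apply: divr_gt0; lra.
move=> D; rewrite ltr_pdivlMr ?addr_gt0 // mulrC.
move: tA; move: (t * A) (mulrDl 1 t A) => s ->; move: (_ * D) => r; lra.
Qed.

(** The topology is given by its open sets, so this is what makes balls neighbourhoods of their
    centres. *)
Lemma ball_open x (e : R) : 0 < e -> open [set q | Hpair_dist x q < e].
Proof.
move=> e0; change (Hpair_open [set q : pairT | Hpair_dist x q < e]) => p.
move=> xp; have {}xp : pair_dist2 x p < e ^+ 2 by rewrite -Hpair_dist_lt.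
have [t [d [t0 d0 hd]]] := quasi_triangle_radius (pair_dist2_ge0 x p) xp.
have s0 : 0 < Num.sqrt d by rewrite sqrtr_gt0.
exists (Num.sqrt d) => // q pq.
have {}pq : pair_dist2 p q < d by rewrite -(sqr_sqrtr (ltW d0)) -Hpair_dist_lt.
change (Hpair_dist x q < e); rewrite (Hpair_dist_lt _ _ e0).
exact: le_lt_trans (pair_dist2_triangle x p q t0) (hd _ pq).
Qed.

Lemma cluster_subsequence (s : nat -> pairT) x : cluster (s @ \oo) x ->
  exists2 f : nat -> nat, {homo f : i j / (i < j)%N} &
    (fun j => pair_dist2 x (s (f j))) @ \oo --> 0.
Proof.
move=> cl.
have H j i1 : exists2 i, (i1 < i)%N & pair_dist2 x (s i) < j.+1%:R^-1.
  have e0 : 0 < Num.sqrt (j.+1%:R^-1 : R) by rewrite sqrtr_gt0 invr_gt0.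
  have B : nbhs x [set q | Hpair_dist x q < Num.sqrt (j.+1%:R^-1 : R)].
    apply: open_nbhs_nbhs; split; first exact: ball_open.
    change (Hpair_dist x x < Num.sqrt (j.+1%:R^-1 : R)); rewrite Hpair_dist_lt //.
    have wsubxx a : wsub a a = fun=> 0 :> R by apply/funext => k; rewrite /wsub subrr.
    by rewrite /pair_dist2 !wsubxx (wreal0 lam_gt0) addr0 exprn_gt0.
  have A : (s @ \oo) (s @` [set i | (i1 < i)%N]).
    by exists i1.+1 => // i /= ii; exists i.
  have [_ [[i ii <-] h]] := cl _ _ A B; exists i => //.
  by rewrite -[ltRHS](sqr_sqrtr (_ : 0 <= _)) ?invr_ge0 // -Hpair_dist_lt.
have [f fh hf] := subsequence_of H; exists f => //.
apply: (@squeeze_cvgr _ _ _ _ (fun=> 0) (fun j => j.+1%:R^-1)).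
- by near=> j; rewrite pair_dist2_ge0 ltW.
- exact: cvg_cst.
- exact: cvg_harmonic.
Unshelve. all: by end_near. Qed.

Lemma subsequence_cluster (s : nat -> pairT) x (f : nat -> nat) :
  {homo f : i j / (i < j)%N} -> (fun j => pair_dist2 x (s (f j))) @ \oo --> 0 ->
  cluster (s @ \oo) x.
Proof.
move=> fh cf A B sA; rewrite nbhsE => -[U [oU Ux] UB].
have [e e0 eU] : exists2 e : R, 0 < e & [set q | Hpair_dist x q < e] `<=` U.
  by have : Hpair_open U := oU; exact.
have fA : \forall j \near \oo, A (s (f j)) by exact: (increasing_infty fh sA).
have e20 : 0 < e ^+ 2 by rewrite exprn_gt0.
have /cvgrPdist_lt/(_ _ e20) fB := cf.
have [j [hA hB]] := filter_ex (filterI fA fB); exists (s (f j)); split => //.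
apply: UB; apply: eU; change (Hpair_dist x (s (f j)) < e); rewrite Hpair_dist_lt //.
by move: hB; rewrite sub0r normrN ger0_norm ?pair_dist2_ge0.
Qed.

Lemma pair_dist2_coordinatewise (s : nat -> pairT) x :
  (fun j => pair_dist2 x (s j)) @ \oo --> 0 ->
  [/\ coordinatewise (fun j => coef1 (s j)) (coef1 x),
      coordinatewise (fun j => coef2 (s j)) (coef2 x) &
      exists c, forall j, wreal lam (coef1 (s j)) <= c /\ wreal lam (coef2 (s j)) <= c].
Proof.
move=> cs.
have cw (c : pairT -> nat -> R) : (forall p, wspace lam (c p)) ->
    (forall p q, wreal lam (wsub (c p) (c q)) <= pair_dist2 p q) ->
    coordinatewise (fun j => c (s j)) (c x).
  move=> Hc le k; apply/cvgrPdist_lt => e e0.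
  have d0 : 0 < e ^+ 2 * lam k by rewrite mulr_gt0 ?exprn_gt0.
  have /cvgrPdist_lt/(_ _ d0) := cs; apply: filterS => j.
  rewrite sub0r normrN ger0_norm ?pair_dist2_ge0 // => h.
  have := coord_le lam_gt0 k (wspace_sub lam_gt0 (Hc x) (Hc (s j))).
  move=> /le_trans/(_ (le _ _))/le_lt_trans/(_ h).
  rewrite ltr_pM2r // -[X in X < _]real_normK ?num_real //.
  by rewrite ltr_pXn2r ?nnegrE // ltW.
have le1 p q : wreal lam (wsub (coef1 p) (coef1 q)) <= pair_dist2 p q.
  by rewrite lerDl wreal_ge0.
have le2 p q : wreal lam (wsub (coef2 p) (coef2 q)) <= pair_dist2 p q.
  by rewrite lerDr wreal_ge0.
split; [exact: cw c1 le1|exact: cw c2 le2|].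
have [B [Br hB]] := cvg_seq_bounded (cvgP _ cs).
have hB1 j : pair_dist2 x (s j) <= B + 1.
  by apply: le_trans (ler_norm _) _; apply: (hB (B + 1)) => //; rewrite ltrDl.
exists (2 * (wreal lam (coef1 x) + wreal lam (coef2 x) + (B + 1))) => j.
have bd a b : wspace lam a -> wspace lam b ->
    wreal lam b <= 2 * wreal lam a + 2 * wreal lam (wsub a b).
  move=> Ha Hb; rewrite {1}(_ : b = wsub a (wsub a b)); last first.
    by apply/funext => k; rewrite /wsub; ring.
  have Hab := wspace_sub lam_gt0 Ha Hb.
  have := wreal_parallelogram lam_gt0 Ha Hab.
  have := wreal_ge0 lam_gt0 (wadd a (wsub a b)); lra.
split.
  apply: le_trans (bd _ _ (c1 x) (c1 (s j))) _; rewrite -mulrDr ler_wpM2l // lerD //.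
    by rewrite lerDl wreal_ge0.
  exact: le_trans (le1 _ _) (hB1 j).
apply: le_trans (bd _ _ (c2 x) (c2 (s j))) _; rewrite -mulrDr ler_wpM2l // lerD //.
  by rewrite lerDr wreal_ge0.
exact: le_trans (le2 _ _) (hB1 j).
Qed.

Lemma realize_pair a b : wspace lam a -> wspace lam b ->
  exists p, coef1 p = a /\ coef2 p = b.
Proof.
move=> Ha Hb; have rH := @realize_Hfrac R n Omega bOmega oOmega i0 z rho alpha hz alpha_gt0.
pose P (uv : (V -> R) * (V -> R)) := Hf uv.1 /\ Hf uv.2.
exists (exist P (real a, real b) (conj (rH a Ha) (rH b Hb))).
by split; exact: (realizeP bOmega oOmega i0 hz alpha_gt0 _).2.
Qed.

End PairTopology.

(** * Upper limits of the saddle sets *)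

Section SaddleSets.
Context (R : realType) (n m : nat) (Omega : set 'rV[R]_n).
Local Notation V := 'rV[R]_n.
Local Notation T := (caratheodory_type (@lebesgue_outer R n)).
Local Notation mu := (lebesgue R n).
Hypotheses (bOmega : bounded_set Omega) (oOmega : open Omega) (i0 : 'I_n).
Variables (z : nat -> V -> R) (rho : nat -> R) (alpha : R).
Hypotheses (hz : dirichlet_eigensystem Omega z rho) (alpha_gt0 : 0 < alpha).
Variables (M : set 'rV[R]_m) (G : V -> R -> R -> 'rV[R]_m -> R).
Local Notation Hf := (Hfrac Omega z rho alpha).
Local Notation lam := (weight rho alpha).
Local Notation pairT := (Hpair Omega z rho alpha).
Hypothesis carG : caratheodory_fun G Omega.
Hypothesis A3 : forall u, Hf u ->
  exists (b : R) (beta1 gamma1 : V -> R),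
    [/\ 2 * b < rho 0%N `^ (alpha / 2),
        Lp_fun Omega 2%:E beta1, Lp_fun Omega 1%:E gamma1 &
        {ae mu, forall x, Omega x -> forall (v : R) (y : 'rV[R]_m), M y ->
          - b * `|v| ^+ 2 - beta1 x * v - gamma1 x <= G x (u x) v y}].
Hypothesis A4 : forall v, Hf v ->
  exists (B : R) (beta2 gamma2 : V -> R),
    [/\ 2 * B < rho 0%N `^ (alpha / 2),
        Lp_fun Omega 2%:E beta2, Lp_fun Omega 1%:E gamma2 &
        {ae mu, forall x, Omega x -> forall (u : R) (y : 'rV[R]_m), M y ->
          G x u (v x) y <= B * `|u| ^+ 2 + beta2 x * u + gamma2 x}].
Let lam_gt0 := weight_gt0 bOmega oOmega i0 alpha hz.
Local Notation ctrl := (control mu (Omega : set T) M).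
Local Notation E w := (energy Omega z rho alpha G w).
Local Notation F w := (saddle_functional lam (potential Omega z G w)).
Local Notation saddle w := (saddle_points (E w) : set pairT).

(** Taking [a] or [b] to be the coefficients of [p] itself recovers the two halves of the saddle
    property from the single inequality. *)
Lemma saddle_pointsP w (p : pairT) : ctrl w ->
  saddle w p <-> forall a b, wspace lam a -> wspace lam b ->
    F w a (coef2 p) <= F w (coef1 p) b.
Proof.
move=> cw; have [Hu Hv] := svalP p.
have EE := energyE bOmega oOmega i0 hz alpha_gt0 carG A3 A4.
have rP := realizeP bOmega oOmega i0 hz alpha_gt0.
have rH := realize_Hfrac bOmega oOmega i0 hz alpha_gt0.
split=> [sp a b Ha Hb|sp u v Hu' Hv'].
  have /andP[h1 h2] := sp _ _ (rH _ Ha) (rH _ Hb).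
  move: (le_trans h1 h2); rewrite (EE _ _ _ (rH _ Ha) Hv cw) (EE _ _ _ Hu (rH _ Hb) cw).
  by rewrite (rP _ Ha).2 (rP _ Hb).2.
have /(HfracP oOmega alpha hz)[_ Hcu] := Hu; have /(HfracP oOmega alpha hz)[_ Hcv] := Hv.
have /(HfracP oOmega alpha hz)[_ Hcu'] := Hu'; have /(HfracP oOmega alpha hz)[_ Hcv'] := Hv'.
rewrite (EE _ _ _ Hu' Hv cw) (EE _ _ _ Hu Hv cw) (EE _ _ _ Hu Hv' cw).
by apply/andP; split; apply: sp.
Qed.

Variable w : nat -> V -> 'rV[R]_m.
Hypothesis cw : forall k, ctrl (w k).
Hypothesis wc : ae_subsequence mu (Omega : set T) (fun k => w k.+1) (w 0%N).
Hypothesis A5 : forall k,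
  (forall v, Hf v -> concave_on_Hfrac Omega z rho alpha (fun u => E (w k) u v)) /\
  (forall u, Hf u -> convex_on_Hfrac Omega z rho alpha (fun v => E (w k) u v)).

Let J k := potential Omega z G (w k.+1).
Let cw' k : ctrl (w k.+1) := cw k.+1.
Let lJ : lsc_along lam J (potential Omega z G (w 0%N)) :=
  potential_lsc bOmega oOmega i0 hz alpha_gt0 carG A3 A4 cw' (cw 0%N) wc.
Let uJ : lsc_along lam (flip J) (flip1 (potential Omega z G (w 0%N))) :=
  potential_usc bOmega oOmega i0 hz alpha_gt0 carG A3 A4 cw' (cw 0%N) wc.

Lemma saddle_points_nonempty k : exists a b, [/\ wspace lam a, wspace lam b &
  forall a' b', wspace lam a' -> wspace lam b' -> F (w k) a' b <= F (w k) a b'].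
Proof.
have ck : forall j : nat, ctrl ((fun=> w k) j) by move=> j; exact: cw.
have ak : ae_subsequence mu (Omega : set T) (fun=> w k) (w k).
  move=> kappa _; exists id => //.
  by apply: aeW => x _; exact: cvg_cst.
have [cc cv] := A5 k.
apply: (saddle_exists lam_gt0).
- exact: (potential_lsc bOmega oOmega i0 hz alpha_gt0 carG A3 A4 ck (cw k) ak).
- exact: (potential_usc bOmega oOmega i0 hz alpha_gt0 carG A3 A4 ck (cw k) ak).
- exact: (potential_coercive bOmega oOmega i0 hz alpha_gt0 carG A3 A4 ck).
- exact: (potential_anticoercive bOmega oOmega i0 hz alpha_gt0 carG A3 A4 ck).
- exact: (functional_concave bOmega oOmega i0 hz alpha_gt0 carG A3 A4 (cw k) cc).
- exact: (functional_convex bOmega oOmega i0 hz alpha_gt0 carG A3 A4 (cw k) cv).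
Qed.

Lemma limsup_saddle_nonempty :
  kuratowski_limsup (fun k => saddle (w k.+1)) !=set0.
Proof.
have ex k : exists p : pairT, forall a b, wspace lam a -> wspace lam b ->
    F (w k.+1) a (coef2 p) <= F (w k.+1) (coef1 p) b.
  have [a [b [Ha Hb h]]] := saddle_points_nonempty k.+1.
  have [p [pa pb]] := realize_pair bOmega oOmega i0 hz alpha_gt0 Ha Hb.
  by exists p; rewrite pa pb.
have [s hs] := choice ex.
have c1 p := @coef1_wspace R n Omega oOmega z rho alpha hz p.
have c2 p := @coef2_wspace R n Omega oOmega z rho alpha hz p.
(* The saddle points are exact and the whole sequence of controls is followed, hence [eps] is 0 and
   [kappa] the identity. *)
have [||||||f [a [b [fh [Ha Hb] _ ca cb]]]] := saddle_stability lam_gt0 (kappa := id)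
  (eps := fun=> 0) (sa := fun j => coef1 (s j)) (sb := fun j => coef2 (s j)) lJ uJ
  (potential_coercive bOmega oOmega i0 hz alpha_gt0 carG A3 A4 cw')
  (potential_anticoercive bOmega oOmega i0 hz alpha_gt0 carG A3 A4 cw').
- exact: cvg_id.
- by [].
- exact: cvg_cst.
- by move=> j; exact: c1.
- by move=> j; exact: c2.
- by move=> j a' b' Ha' Hb'; rewrite !mul0r !addr0; exact: hs.
have [x [xa xb]] := realize_pair bOmega oOmega i0 hz alpha_gt0 Ha Hb.
exists x, s; first by move=> k; apply/(saddle_pointsP _ (cw k.+1)); exact: hs.
apply: (subsequence_cluster bOmega oOmega i0 hz fh).
rewrite (_ : (fun j => pair_dist2 x (s (f j))) = fun j =>
  wreal lam (wsub (coef1 (s (f j))) a) + wreal lam (wsub (coef2 (s (f j))) b)); last first.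
  apply/funext => j; rewrite /pair_dist2 xa xb.
  by rewrite (wreal_subC lam_gt0 Ha (c1 _)) (wreal_subC lam_gt0 Hb (c2 _)).
by rewrite -[0]addr0; apply: cvgD; [exact: ca|exact: cb].
Qed.

(** The limit point is prescribed here, so [saddle_limit] is applied along a subsequence converging
    to it, which becomes [kappa]. *)
Lemma limsup_saddle_sub :
  kuratowski_limsup (fun k => saddle (w k.+1)) `<=` saddle (w 0%N).
Proof.
move=> x [s hs /(cluster_subsequence bOmega oOmega i0 hz)[f fh cf]].
have [co1 co2 [c hc]] := pair_dist2_coordinatewise bOmega oOmega i0 hz cf.
have c1 p := @coef1_wspace R n Omega oOmega z rho alpha hz p.
have c2 p := @coef2_wspace R n Omega oOmega z rho alpha hz p.
apply/(saddle_pointsP _ (cw 0%N)).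
have [||||||||||h _ _ //] := saddle_limit lam_gt0 (kappa := f) (eps := fun=> 0) (c := c)
  (sa := fun j => coef1 (s (f j))) (sb := fun j => coef2 (s (f j)))
  (a := coef1 x) (b := coef2 x) lJ uJ.
- exact: increasing_infty fh.
- by [].
- exact: cvg_cst.
- by move=> j; exact: c1.
- by move=> j; exact: c2.
- by move=> j; have [] := hc j.
- by move=> j; have [] := hc j.
- exact: co1.
- exact: co2.
move=> j a' b' Ha' Hb'; rewrite !mul0r !addr0.
by have /(saddle_pointsP _ (cw (f j).+1)) := hs (f j); apply.
Qed.

End SaddleSets.

Theorem proposition2 (R : realType) (n m : nat) (Omega : set 'rV[R]_n)
  (alpha : R) (z : nat -> 'rV[R]_n -> R) (rho : nat -> R)
  (p : \bar R) (M : set 'rV[R]_m)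
  (G : 'rV[R]_n -> R -> R -> 'rV[R]_m -> R)
  (w : nat -> 'rV[R]_n -> 'rV[R]_m)
  (hn : (3 <= n)%N)
  (hOmega : bounded_lipschitz_domain Omega)
  (halpha : 1 < alpha < 2)
  (hz : dirichlet_eigensystem Omega z rho)
  (hp : (1 <= p)%E)
  (hM_convex : convex_set (M : set (convex_lmodType 'rV[R]_m)))
  (hM_bounded : bounded_set M)
  (hG : forall x u v y, Omega x ->
     derivable (fun t : R => G x t v y : R^o) u 1 /\
     derivable (fun t : R => G x u t y : R^o) v 1)
  (A1 : [/\ caratheodory_fun G Omega, caratheodory_fun (Gu G) Omega &
            caratheodory_fun (Gv G) Omega])
  (A2 : exists s c : R,
     [/\ 1 < s < 2 * n%:R / (n%:R - alpha), 0 < c,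
       p = +oo%E -> {ae lebesgue R n, forall x, Omega x ->
         forall (u v : R) (y : 'rV[R]_m), M y ->
         [/\ `|G x u v y| <= c * (1 + `|u| `^ s + `|v| `^ s),
             `|Gu G x u v y| <= c * (1 + `|u| `^ (s - 1) + `|v| `^ (s - 1)) &
             `|Gv G x u v y| <= c * (1 + `|u| `^ (s - 1) + `|v| `^ (s - 1))]} &
       forall r : R, p = r%:E -> {ae lebesgue R n, forall x, Omega x ->
         forall (u v : R) (y : 'rV[R]_m),
         [/\ `|G x u v y| <=
               c * (1 + `|u| `^ s + `|v| `^ s + enorm y `^ r),
             `|Gu G x u v y| <=
               c * (1 + `|u| `^ (s - 1) + `|v| `^ (s - 1)
                    + enorm y `^ (r - r / s)) &
             `|Gv G x u v y| <=
               c * (1 + `|u| `^ (s - 1) + `|v| `^ (s - 1)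
                    + enorm y `^ (r - r / s))]}])
  (A3 : forall u, Hfrac Omega z rho alpha u ->
     exists (b : R) (beta1 gamma1 : 'rV[R]_n -> R),
       [/\ 2 * b < rho 0%N `^ (alpha / 2),
           Lp_fun Omega 2%:E beta1, Lp_fun Omega 1%:E gamma1 &
           {ae lebesgue R n, forall x, Omega x ->
             forall (v : R) (y : 'rV[R]_m), M y ->
             - b * `|v| ^+ 2 - beta1 x * v - gamma1 x <= G x (u x) v y}])
  (A4 : forall v, Hfrac Omega z rho alpha v ->
     exists (B : R) (beta2 gamma2 : 'rV[R]_n -> R),
       [/\ 2 * B < rho 0%N `^ (alpha / 2),
           Lp_fun Omega 2%:E beta2, Lp_fun Omega 1%:E gamma2 &
           {ae lebesgue R n, forall x, Omega x ->
             forall (u : R) (y : 'rV[R]_m), M y ->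
             G x u (v x) y <= B * `|u| ^+ 2 + beta2 x * u + gamma2 x}])
  (A5 : forall w', admissible_control Omega p M w' ->
     (forall v, Hfrac Omega z rho alpha v ->
        concave_on_Hfrac Omega z rho alpha
          (fun u => energy Omega z rho alpha G w' u v)) /\
     (forall u, Hfrac Omega z rho alpha u ->
        convex_on_Hfrac Omega z rho alpha
          (fun v => energy Omega z rho alpha G w' u v)))
  (hw : forall k, admissible_control Omega p M (w k))
  (hw_cvg : Lp_vcvg Omega p w (w 0%N)) :
  let saddle k := saddle_points (energy Omega z rho alpha G (w k)) in
  let limsup_S :=
    kuratowski_limsup
      (fun k => saddle k.+1 : set (Hpair Omega z rho alpha)) in
  limsup_S !=set0 /\ limsup_S `<=` saddle 0%N.
Proof.
have [_ oO _ bO _] := hOmega.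
(* A coordinate direction, along which the Poincare inequality is applied. *)
have i0 : 'I_n := Ordinal (leq_trans (isT : (0 < 3)%N) hn).
have a0 : 0 < alpha by have /andP[a1 _] := halpha; exact: lt_trans ltr01 a1.
have mO := Omega_measurable oO; have fO := Omega_lty bO.
have cw k := admissible_control_control mO (hw k).
have wc := Lp_vcvg_ae_subsequence mO fO hM_bounded hp cw hw_cvg.
have [carG _ _] := A1.
split; last exact: (limsup_saddle_sub bO oO i0 hz a0 carG A3 A4 cw wc).
exact: (limsup_saddle_nonempty bO oO i0 hz a0 carG A3 A4 cw wc (fun k => A5 _ (hw k))).
Qed.
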